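(* Let $d,s\in\mathbb{N}$ with $2s>d$, let $\Omega\subset\mathbb{R}^d$ be a bounded domain with Lipschitz boundary, let $\mathcal{L}:H^s_0(\Omega)\to H^{-s}(\Omega)$ be a symmetric, positive, local linear bijection with Green's function $G$, let $\{x_i\}_{i\in I}\subset\Omega$ be $N=\#I$ distinct points with homogeneity parameter $\delta$, and let $\Theta_{ij}=G(x_i,x_j)$. Let $L$ be the (dense) lower-triangular Cholesky factor of $\Theta$ in the maximin ordering and, for $1\le k\le N$, let $L^{(k)}$ be the rank-$k$ matrix defined by the first $k$ columns of $L$. Then $$\|\Theta-L^{(k)}L^{(k),\top}\|\le C\,\|\Theta\|\,k^{-\frac{2s}{d}},$$ where $\|\cdot\|$ is the operator norm and $C>0$ depends only on $d,\Omega,s,\|\mathcal{L}\|,\|\mathcal{L}^{-1}\|$ and $\delta$.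
   Context: $[\cdot,\cdot]$ is the duality pairing between $H^{-s}(\Omega)$ (dual of $H^s_0(\Omega)$ with respect to the $L^2(\Omega)$ scalar product) and $H^s_0(\Omega)$. Symmetric: $[\mathcal{L}u,v]=[\mathcal{L}v,u]$; positive: $[\mathcal{L}u,u]\ge0$; local: $[\mathcal{L}v,u]=0$ whenever $\operatorname{supp}u\cap\operatorname{supp}v=\emptyset$. $\|\mathcal{L}\|$, $\|\mathcal{L}^{-1}\|$ are the operator norms between $H_0^s(\Omega)$ and $H^{-s}(\Omega)$. The Green's function is $G(x,y)=[\boldsymbol\delta_x,\mathcal{L}^{-1}\boldsymbol\delta_y]$ with $\boldsymbol\delta_x$ the Dirac delta at $x$. The homogeneity parameter is $$\delta=\frac{\min_{i\ne j\in I}\operatorname{dist}(x_i,\{x_j\}\cup\partial\Omega)}{\max_{x\in\Omega}\operatorname{dist}(x,\{x_i\}_{i\in I}\cup\partial\Omega)} .$$ Maximin ordering: $i_1\in\arg\max_{i\in I}\operatorname{dist}(x_i,\partial\Omega)$ and $i_{k+1}\in\arg\max_{i\in I\setminus\{i_1,\dots,i_k\}}\operatorname{dist}(x_i,\{x_{i_1},\dots,x_{i_k}\}\cup\partial\Omega)$; rows and columns of $\Theta$ are ordered as $i_1,i_2,\dots,i_N$. *)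

(* Defs.v *)
From HB Require Import structures.
From mathcomp Require Import all_boot all_order all_algebra.
From mathcomp Require Import all_classical all_reals all_analysis.

Set Implicit Arguments.
Unset Strict Implicit.
Unset Printing Implicit Defensive.

Import Order.TTheory GRing.Theory Num.Theory.
Import numFieldNormedType.Exports.

Local Open Scope classical_set_scope.
Local Open Scope ring_scope.

Definition measure_rV_display : measure_display -> measure_display.
Proof. exact. Qed.

Section measurable_rV.
Context {disp} {T : measurableType disp} (n : nat).

Let coors : 'I_n -> 'rV[T]_n -> T := fun i x => x ord0 i.

Let rV_set0 : g_sigma_preimage coors set0.
Proof. exact: sigma_algebra0. Qed.

Let rV_setC A : g_sigma_preimage coors A -> g_sigma_preimage coors (~` A).
Proof. exact: sigma_algebraC. Qed.

Let rV_bigcup (F : _^nat) : (forall i, g_sigma_preimage coors (F i)) ->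
  g_sigma_preimage coors (\bigcup_i (F i)).
Proof. exact: sigma_algebra_bigcup. Qed.

HB.instance Definition _ := @isMeasurable.Build (measure_rV_display disp)
  'rV[T]_n (g_sigma_preimage coors) rV_set0 rV_setC rV_bigcup.

Lemma measurable_coor (i : 'I_n) :
  measurable_fun [set: 'rV[T]_n] (fun x : 'rV[T]_n => x ord0 i).
Proof.
move=> _ Y mY; rewrite setTI; apply: sub_sigma_algebra => /=.
rewrite -bigcup_seq/=; exists i => /=; first by rewrite mem_index_enum.
by exists Y => //; rewrite setTI.
Qed.

Lemma measurable_fun_rV d' (U : measurableType d') (f : U -> 'rV[T]_n) :
  (forall i, measurable_fun [set: U] (fun u => f u ord0 i)) ->
  measurable_fun [set: U] f.
Proof.
move=> mf _ A mA; rewrite setTI.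
suff : g_sigma_preimage coors `<=` [set B | measurable (f @^-1` B)] by exact.
apply: smallest_sub.
  split => /=.
  - by rewrite preimage_set0.
  - by move=> B mB; rewrite setTD preimage_setC; exact: measurableC.
  - by move=> F mF; rewrite preimage_bigcup; exact: bigcupT_measurable.
move=> B; rewrite -bigcup_seq/= => -[i _ [Y mY <-]]/=; rewrite setTI.
by have := mf i measurableT Y mY; rewrite setTI.
Qed.

End measurable_rV.

Section lebesgue_rV.
Context {R : realType}.

Definition rV_cons n (xv : measurableTypeR R * 'rV[R]_n) : 'rV[R]_n.+1 :=
  \row_i oapp (xv.2 ord0) xv.1 (unlift ord0 i).

Lemma measurable_rV_cons n :
  measurable_fun [set: measurableTypeR R * 'rV[R]_n] (@rV_cons n).
Proof.
apply: measurable_fun_rV => i; case: (unliftP ord0 i) => [j ->|->].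
- rewrite (_ : (fun u => _) = (fun v : 'rV[R]_n => v ord0 j) \o snd).
    by apply: measurableT_comp => //; exact: measurable_coor.
  by apply/funext => u; rewrite mxE liftK.
- rewrite (_ : (fun u => _) = fst); first exact: measurable_fst.
  by apply/funext => u; rewrite mxE unlift_none.
Qed.

Section cons_measure.
Variables (n : nat) (m : {sigma_finite_measure set 'rV[R]_n -> \bar R}).

Definition cons_measure : set 'rV[R]_n.+1 -> \bar R :=
  pushforward (@lebesgue_measure R \x m)%E (@rV_cons n).

Let cons_measure0 : cons_measure set0 = 0%E.
Proof. by rewrite /cons_measure /pushforward preimage_set0 measure0. Qed.

Let cons_measure_ge0 A : (0 <= cons_measure A)%E.
Proof. by rewrite /cons_measure /pushforward measure_ge0. Qed.

Let measurable_preimage_rV_cons A : measurable A ->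
  measurable (@rV_cons n @^-1` A).
Proof.
by move=> mA; rewrite -[X in measurable X]setTI; exact: measurable_rV_cons.
Qed.

Let cons_measure_sigma_additive : semi_sigma_additive cons_measure.
Proof.
move=> F mF tF mUF; rewrite /cons_measure /pushforward preimage_bigcup.
apply: measure_semi_sigma_additive.
- by move=> k; exact: measurable_preimage_rV_cons.
- apply/trivIsetP => /= i j _ _ ij; rewrite -preimage_setI.
  by move/trivIsetP : tF => /(_ _ _ _ _ ij) ->//; rewrite preimage_set0.
- by rewrite -preimage_bigcup; exact: measurable_preimage_rV_cons.
Qed.

HB.instance Definition _ := isMeasure.Build _ _ _
  cons_measure cons_measure0 cons_measure_ge0 cons_measure_sigma_additive.

Let cons_measure_sigma_finite : sigma_finite setT cons_measure.
Proof.
have /sigma_finiteP[F [TF ndF Foo]] := sigma_finiteT (@lebesgue_measure R).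
have /sigma_finiteP[G [TG ndG Goo]] := sigma_finiteT m.
pose g (x : 'rV[R]_n.+1) : measurableTypeR R * 'rV[R]_n :=
  (x ord0 ord0, \row_j x ord0 (lift ord0 j)).
have gK : cancel (@rV_cons n) g.
  move=> [x v]; rewrite /g /rV_cons !mxE unlift_none /=; congr pair.
  by apply/rowP => j; rewrite !mxE liftK.
have mg : measurable_fun [set: 'rV[R]_n.+1] g.
  apply/measurable_fun_pairP; split; first exact: measurable_coor.
  apply: measurable_fun_rV => j /=.
  rewrite (_ : (fun u => _) = (fun v : 'rV[R]_n.+1 => v ord0 (lift ord0 j))).
    exact: measurable_coor.
  by apply/funext => u; rewrite mxE.
exists (fun i => g @^-1` (F i `*` G i)).
  rewrite -preimage_bigcup (_ : \bigcup_i _ = setT) ?preimage_setT//.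
  rewrite -setXTT TF TG; apply/seteqP; split => [[x y] [k _ [/= ? ?]]|].
    by split; exists k.
  move=> [x y] [/= [i _ Fix] [j _ Gjy]]; exists (maxn i j) => //; split.
  - by move: x Fix; exact/subsetPset/ndF/leq_maxl.
  - by move: y Gjy; exact/subsetPset/ndG/leq_maxr.
move=> i; have [? ?] := Foo i; have [? ?] := Goo i; split.
  by rewrite -[X in measurable X]setTI; apply: mg => //; exact: measurableX.
rewrite /cons_measure /pushforward -comp_preimage (_ : g \o _ = id).
  by rewrite preimage_id product_measure1E// lte_mul_pinfty// ge0_fin_numE.
by apply/funext => x /=; rewrite gK.
Qed.

HB.instance Definition _ := Measure_isSigmaFinite.Build _ _ _ cons_measure
  cons_measure_sigma_finite.

End cons_measure.

Fixpoint lebesgue_rV n : {sigma_finite_measure set 'rV[R]_n -> \bar R} :=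
  if n is p.+1 then cons_measure (lebesgue_rV p) else dirac (0 : 'rV[R]_0).

Lemma lebesgue_rV_box n (A : 'I_n -> set (measurableTypeR R)) :
  (forall i, measurable (A i)) ->
  lebesgue_rV n [set x : 'rV[R]_n | forall i, A i (x ord0 i)] =
  (\prod_(i < n) lebesgue_measure (A i))%E.
Proof.
elim: n A => [|n IHn] A mA.
  rewrite big_ord0 /= diracE mem_set// => -[]//.
rewrite big_ord_recl -IHn//= /cons_measure /pushforward -product_measure1E//.
- congr (_ _); apply/seteqP; split => [[x v] /= Axv|[x v] /= [Ax Av] i].
  + split=> [|i]; first by have := Axv ord0; rewrite mxE unlift_none.
    by have := Axv (lift ord0 i); rewrite mxE liftK.
  + by rewrite mxE; case: (unliftP ord0 i) => [j ->|->].
- rewrite (_ : [set x | _] = \bigcap_(i in [set: 'I_n])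
    ((fun x : 'rV[R]_n => x ord0 i) @^-1` A (lift ord0 i))); last first.
    by apply/seteqP; split => x /= Ax i; [move=> _|]; exact: Ax.
  apply: fin_bigcap_measurable => // i _.
  by rewrite -[X in measurable X]setTI; apply: measurable_coor => //; exact: mA.
Qed.

End lebesgue_rV.

(* The library norm on ['rV[R]_d] is the sup norm; it is used below only where
   equivalent norms give the same notion (topology, boundedness, Lipschitz). *)

Section euclidean.
Context {R : realType}.

Definition dotp d (x y : 'rV[R]_d) : R := \sum_i x ord0 i * y ord0 i.

Definition enorm d (x : 'rV[R]_d) : R := Num.sqrt (dotp x x).

Definition dist d (x : 'rV[R]_d) (A : set 'rV[R]_d) : R :=
  inf [set enorm (x - y) | y in A].

Definition boundary d (A : set 'rV[R]_d) : set 'rV[R]_d := closure A `\` A°.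

(* Around every boundary point [z], after choosing a vertical unit vector [e],
   the set is the strict epigraph of a Lipschitz function [g] of the horizontal
   component [y - (y . e) e]. *)
Definition lipschitz_boundary d (A : set 'rV[R]_d) : Prop :=
  forall z, boundary A z ->
  exists (e : 'rV[R]_d) (g : 'rV[R]_d -> R), [/\ dotp e e = 1, lipschitz g &
    \forall y \near z, A y <-> g (y - dotp y e *: e) < dotp y e].

Definition bounded_lipschitz_domain d (A : set 'rV[R]_d) : Prop :=
  [/\ A !=set0, open A, connected A, bounded_set A & lipschitz_boundary A].

Definition opnorm m n (A : 'M[R]_(m, n)) : R :=
  sup [set enorm (A *m v)^T | v in [set v : 'cV[R]_n | enorm v^T <= 1]].

End euclidean.

(* Elements of function spaces over [A] are represented by functions on the
   whole of R^d of which only the values on [A], up to a.e. equality, matter. *)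

Section sobolev.
Context {R : realType} {d : nat}.
Local Notation V := 'rV[R]_d.
Local Notation mu := (lebesgue_rV d).
Implicit Types (A : set V) (u v g phi : V -> R).

Definition basis_vec (i : 'I_d) : V := delta_mx ord0 i.

Definition iter_deriv (l : seq 'I_d) phi : V -> R :=
  foldr (fun i h => 'D_(basis_vec i) h) phi l.

Definition smooth phi : Prop := forall l : seq 'I_d,
  continuous (iter_deriv l phi) /\
  (forall x i, derivable (iter_deriv l phi) x (basis_vec i)).

(* Membership in C_c^oo(A). *)
Definition test A phi : Prop :=
  [/\ smooth phi, compact (closure [set x | phi x != 0]) &
      closure [set x | phi x != 0] `<=` A].

Definition mdeg (a : 'I_d -> nat) : nat := (\sum_i a i)%N.

Definition mderiv (a : 'I_d -> nat) phi : V -> R :=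
  iter_deriv (flatten [seq nseq (a i) i | i <- enum 'I_d]) phi.

(* Membership in L^2(A). *)
Definition L2 A u : Prop :=
  measurable_fun A u /\ mu.-integrable A (EFin \o (fun x => u x ^+ 2)).

Definition is_wderiv A (a : 'I_d -> nat) u g : Prop :=
  forall phi, test A phi ->
    Rintegral mu A (fun x => u x * mderiv a phi x) =
    (-1) ^+ mdeg a * Rintegral mu A (fun x => g x * phi x).

Definition wderiv A (a : 'I_d -> nat) u : V -> R :=
  xget (fun=> 0) [set g | L2 A g /\ is_wderiv A a u g].

(* Membership in H^s(A). *)
Definition Hs A (s : nat) u : Prop :=
  L2 A u /\ forall a : 'I_d -> nat, (mdeg a <= s)%N ->
    exists g, L2 A g /\ is_wderiv A a u g.

(* The full norm, with one term per multi-index [a] such that [mdeg a <= s]; the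
   dual and operator norms below are taken with respect to it. *)
Definition Hnorm A (s : nat) u : R :=
  Num.sqrt (\sum_(a : {ffun 'I_d -> 'I_s.+1} | (mdeg (fun i => a i) <= s)%N)
    Rintegral mu A (fun x => wderiv A (fun i => a i) u x ^+ 2)).

(* Membership in H^s_0(A), the closure of C_c^oo(A) in H^s(A). *)
Definition H0 A (s : nat) u : Prop :=
  Hs A s u /\ exists phi : nat -> V -> R, (forall n, test A (phi n)) /\
    Hnorm A s (fun x => u x - phi n x) @[n --> \oo] --> (0 : R).

(* The essential support of [u], as a closed subset of R^d: it may contain
   boundary points of [A]. *)
Definition esupp A u : set V :=
  [set x | forall U, open U -> U x -> ~ (u = (fun=> 0) %[ae mu in U `&` A])].

(* Membership in H^{-s}(A); [f v] is the duality pairing of [f] and [v], and only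
   [v] in H^s_0(A) matter. *)
Definition Hdual A (s : nat) (f : (V -> R) -> R) : Prop :=
  (forall (c : R) u v, H0 A s u -> H0 A s v ->
     f (fun x => c * u x + v x) = c * f u + f v) /\
  (exists M : R, forall v, H0 A s v -> `|f v| <= M * Hnorm A s v).

Definition dual_norm A (s : nat) (f : (V -> R) -> R) : \bar R :=
  ereal_sup [set `|f v|%:E | v in [set v | H0 A s v /\ Hnorm A s v <= 1]].

Implicit Type L : (V -> R) -> (V -> R) -> R.

(* [L u v] is the duality pairing of [L u] and [v]. The second clause says that
   [L] acts on a.e. equivalence classes; for [L u] this follows from [Hdual]. *)
Definition linear_operator A (s : nat) L : Prop :=
  [/\ forall u, H0 A s u -> Hdual A s (L u),
      forall u u' v, H0 A s u -> H0 A s u' -> H0 A s v ->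
        u = u' %[ae mu in A] -> L u v = L u' v &
      forall (c : R) u u' v, H0 A s u -> H0 A s u' -> H0 A s v ->
        L (fun x => c * u x + u' x) v = c * L u v + L u' v].

Definition bijective_operator A (s : nat) L : Prop :=
  (forall u u', H0 A s u -> H0 A s u' ->
     (forall v, H0 A s v -> L u v = L u' v) -> u = u' %[ae mu in A]) /\
  (forall f, Hdual A s f ->
     exists2 u, H0 A s u & forall v, H0 A s v -> L u v = f v).

Definition symmetric_operator A (s : nat) L : Prop :=
  forall u v, H0 A s u -> H0 A s v -> L u v = L v u.

Definition positive_operator A (s : nat) L : Prop :=
  forall u, H0 A s u -> 0 <= L u u.

Definition local_operator A (s : nat) L : Prop :=
  forall u v, H0 A s u -> H0 A s v -> esupp A u `&` esupp A v = set0 ->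
    L v u = 0.

Definition inv_operator A (s : nat) L (f : (V -> R) -> R) : V -> R :=
  xget (fun=> 0) [set u | H0 A s u /\ forall v, H0 A s v -> L u v = f v].

Definition operator_norm A (s : nat) L : \bar R :=
  ereal_sup [set dual_norm A s (L u) |
    u in [set u | H0 A s u /\ Hnorm A s u <= 1]].

Definition inv_operator_norm A (s : nat) L : \bar R :=
  ereal_sup [set (Hnorm A s (inv_operator A s L f))%:E |
    f in [set f | Hdual A s f /\ (dual_norm A s f <= 1)%E]].

(* The Dirac delta at [x] as an element of H^{-s}(A). It exists when
   2s > d, and is unique on H^s_0(A) by density of test functions. *)
Definition delta A (s : nat) (x : V) : (V -> R) -> R :=
  xget (fun=> 0) [set f | Hdual A s f /\ forall phi, test A phi -> f phi = phi x].

Definition green A (s : nat) L (x y : V) : R :=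
  delta A s x (inv_operator A s L (delta A s y)).

End sobolev.

Section points.
Context {R : realType} {d : nat} {I : finType}.
Implicit Types (A : set 'rV[R]_d) (x : I -> 'rV[R]_d).

(* For finitely many distinct points of a bounded domain the inf is a min and the
   sup is a max, except that for a single point the inf ranges over the empty set
   and is 0 by convention. *)
Definition homogeneity A x : R :=
  inf [set dist (x ij.1) (x ij.2 |` boundary A) |
        ij in [set ij : I * I | ij.1 != ij.2]] /
  sup [set dist y (range x `|` boundary A) | y in A].

Definition maximin_ordering A x (o : 'I_#|I| -> I) : Prop :=
  bijective o /\ forall (k : 'I_#|I|) (i : I),
    (forall l : 'I_#|I|, (l < k)%N -> i != o l) ->
    dist (x i) ([set x (o l) | l in [set l : 'I_#|I| | (l < k)%N]]
                 `|` boundary A) <=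
    dist (x (o k)) ([set x (o l) | l in [set l : 'I_#|I| | (l < k)%N]]
                 `|` boundary A).

Definition cholesky_factor n (M L : 'M[R]_n) : Prop :=
  [/\ is_trig_mx L, forall i, 0 < L i i & L *m L^T = M].

Definition first_columns n k (hk : (k <= n)%N) (L : 'M[R]_n) : 'M[R]_(n, k) :=
  colsub (widen_ord hk) L.

End points.

(* Main.v *)
Require Import Defs.
From HB Require Import structures.
From mathcomp Require Import all_boot all_order all_algebra.
From mathcomp Require Import all_classical all_reals all_analysis measurable_realfun.
From mathcomp Require Import ring lra.

Set Implicit Arguments.
Unset Strict Implicit.
Unset Printing Implicit Defensive.

Import Order.TTheory GRing.Theory Num.Theory.
Import numFieldNormedType.Exports.

Local Open Scope classical_set_scope.
Local Open Scope ring_scope.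

(* With [u_i = L^-1 delta_i], the matrix Theta is the Gram matrix [L u_i u_j].
   The error of the rank-k Cholesky factor is the Schur complement, so its
   quadratic form at [v] is at most [c^T Theta c] for every [c] that agrees with
   [v] on the indices from [k] on, and [c^T Theta c] is bounded by
   [||L^-1|| * B^2] as soon as the functional [sum_i c_i delta_i] has norm at
   most [B] on test functions.

   Upper bound.  Let [l] be the maximin distance at step [k].  The first [k]
   points and the complement of Omega (where test functions vanish) come within
   a multiple of [l] of every point, so near each remaining point [x_j] there
   are nodes and weights reproducing all polynomials of degree [< s].  Taking
   for [c] the combination of these sampling errors, Taylor expansion and the
   bounded overlap of the cubes involved give [B^2 <= C l^(2s) h^(-d) |v|^2],
   where [h] is the separation distance.  The first [k] points are
   [l]-separated in a bounded set, so [l^(2s) <= C k^(-2s/d)].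

   Lower bound.  Test Theta against the indicator of the points of a fixed cube
   on which a fixed test function is bounded below: by Cauchy-Schwarz for the
   form of [L], the norm of Theta is at least a multiple of the number of these
   points, which is at least [c h^(-d)] when the fill distance is small.
   Otherwise the number of points is bounded, and it is enough that the Schur
   complement is dominated by Theta. *)

(** * Lebesgue measure on row vectors *)

(** The sampling estimates are proved for test functions. Extended by zero, these are smooth on all
    of R^d, so Taylor expansion runs over whole cubes that may stick out of Omega, and a node
    outside Omega costs nothing because the test function vanishes there. Density carries the bound
    to H^s_0.

    The expansion point is averaged over the cube, because the squared remainder is then controlled
    by L^2 norms of derivatives of order s. The average meets the contraction towards the sampling
    point, whose Jacobian has to be absorbed by the weight in the Taylor remainder; the condition d
    < 2s is what makes this possible.

    The Dirac functionals come with the Cholesky factor: its positive diagonal makes every diagonal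
    entry of Theta positive, and such an entry certifies that the functional exists. *)

Section rV_measure.
Context {R : realType}.
Implicit Types (d : nat).

(** The open ball of the sup norm, written by coordinates so that it is a product of intervals and
    [lebesgue_rV_box] gives its measure. *)
Definition cube d (x : 'rV[R]_d) (r : R) : set 'rV[R]_d :=
  [set y | forall i, `|y ord0 i - x ord0 i| < r].

Lemma cubeE d (x : 'rV[R]_d) r :
  cube x r = [set y : 'rV[R]_d | forall i, `](x ord0 i - r), (x ord0 i + r)[%classic (y ord0 i)].
Proof.
apply/seteqP; split => y /= h i; have := h i; rewrite /= in_itv/= ltr_distlC.
  by move=> /andP[]; lra.
by move=> /andP[]; lra.
Qed.

Lemma measurable_box d (A : 'I_d -> set (measurableTypeR R)) :
  (forall i, measurable (A i)) ->
  measurable [set x : 'rV[R]_d | forall i, A i (x ord0 i)].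
Proof.
move=> mA; rewrite (_ : [set x | _] = \bigcap_(i in [set: 'I_d])
    ((fun x : 'rV[R]_d => x ord0 i) @^-1` A i)); last first.
  by apply/seteqP; split => x /= Ax i; [move=> _|]; exact: Ax.
apply: fin_bigcap_measurable => // i _.
by rewrite -[X in measurable X]setTI; apply: measurable_coor => //; exact: mA.
Qed.

Lemma measurable_cube d (x : 'rV[R]_d) r : measurable (cube x r).
Proof. by rewrite cubeE; apply: (@measurable_box _ (fun i => `](x ord0 i - r), (x ord0 i + r)[%classic)) => i; exact: measurable_itv. Qed.

Lemma lebesgue_cube d (x : 'rV[R]_d) r : 0 <= r ->
  lebesgue_rV d (cube x r) = ((2 * r) ^+ d)%:E.
Proof.
move=> r0; rewrite cubeE (@lebesgue_rV_box _ _ (fun i => `](x ord0 i - r), (x ord0 i + r)[%classic)); last by move=> i; exact: measurable_itv.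
rewrite (eq_bigr (fun=> (2 * r)%:E)).
  by rewrite prodEFin big_const_ord iter_mulr_1.
move=> i _; rewrite lebesgue_measure_itv/= lte_fin.
by case: ltP => h; rewrite -?EFinD; congr EFin; lra.
Qed.

Lemma nbhs_cubeP d (x : 'rV[R]_d) (A : set 'rV[R]_d) :
  nbhs x A <-> exists2 r : R, 0 < r & cube x r `<=` A.
Proof.
split => [/nbhs_ballP[r /= r0 rA]|[r r0 rA]].
  exists r => // y xy; apply: rA; split => // i j.
  by rewrite (ord1 i) -ball_normE/= distrC; exact: xy.
apply/nbhs_ballP; exists r => //= y [_ xy]; apply: rA => i.
by have := xy ord0 i; rewrite -ball_normE/= distrC.
Qed.

Lemma open_cubeP d (A : set 'rV[R]_d) :
  open A <-> forall x, A x -> exists2 r : R, 0 < r & cube x r `<=` A.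
Proof.
rewrite openE; split => [oA x /oA /nbhs_cubeP//|oA x /oA].
by move=> rA; apply/nbhs_cubeP.
Qed.

(** The measurable sets are generated by the coordinates, so open sets become measurable through a
    countable union. A cube is kept only if the concentric cube of twice its radius lies in [A];
    [fundamental_lemma] uses this margin to fit closed boxes into [A]. *)
Lemma open_bigcup_cube d (A : set 'rV[R]_d) : open A ->
  A = \bigcup_(q : 'rV[rat]_d * nat)
    (if `[< cube (map_mx ratr q.1) (2 / q.2.+1%:R) `<=` A >]
     then cube (map_mx ratr q.1) q.2.+1%:R^-1 else set0).
Proof.
move=> /open_cubeP oA; apply/seteqP; split => [x Ax|x [q _]]; last first.
  case: ifPn => // /asboolP qA xq; apply: qA => i; rewrite (lt_le_trans (xq i))//.
  by rewrite ler_peMl ?invr_ge0// ler1n.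
have [r r0 rA] := oA x Ax.
have [n nr] : exists n : nat, n.+1%:R^-1 < r / 3.
  have r30 : 0 < r / 3 by rewrite divr_gt0.
  exists (Num.trunc (r / 3)^-1); rewrite -[ltRHS]invrK ltf_pV2 ?posrE ?invr_gt0//.
  exact: truncnS_gt.
have n0 : 0 < n.+1%:R^-1 :> R by rewrite invr_gt0.
have near i : exists q : rat, `|x ord0 i - ratr q| < n.+1%:R^-1.
  have [q] := @rat_in_itvoo R (x ord0 i) (x ord0 i + n.+1%:R^-1) ltac:(by rewrite ltrDl).
  rewrite in_itv/= => /andP[q1 q2]; exists q.
  by rewrite distrC ger0_norm ?subr_ge0 ?(ltW q1)// ltrBlDl.
pose q : 'rV[rat]_d := \row_i sval (cid (near i)).
have xq : cube (map_mx ratr q) n.+1%:R^-1 x.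
  by move=> i; rewrite !mxE; case: cid.
exists (q, n) => //=; case: ifPn => // /asboolP; case; move=> y yq; apply: rA => i.
apply: (@lt_trans _ _ (3 * n.+1%:R^-1)); last by rewrite mulrC -ltr_pdivlMr.
have -> : y ord0 i - x ord0 i = (y ord0 i - map_mx ratr q ord0 i) + (map_mx ratr q ord0 i - x ord0 i).
  by rewrite addrA subrK.
apply: (le_lt_trans (ler_normD _ _)).
have -> : 3 * n.+1%:R^-1 = 2 / n.+1%:R + n.+1%:R^-1 :> R by rewrite -[X in _ = _ + X]mul1r -mulrDl natr1.
by apply: ltrD; [exact: yq|rewrite distrC; exact: xq].
Qed.

Lemma open_measurable_rV d (A : set 'rV[R]_d) : open A -> measurable A.
Proof.
move=> /open_bigcup_cube ->; apply: countable_bigcupT_measurable.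
  exact: countableP.
by move=> q; case: ifP => // _; exact: measurable_cube.
Qed.

Lemma continuous_measurable_rV d (f : 'rV[R]_d -> measurableTypeR R) :
  continuous f -> measurable_fun setT f.
Proof.
move=> cf; apply: (measurability _ (@RGenOInfty.measurableE R)).
move=> _ [_ [a ->]] <-; rewrite setTI.
apply: open_measurable_rV; apply: open_comp; last exact: rray_open.
by move=> x _; exact: cf.
Qed.

Lemma measurable_rowP d n (f : 'rV[R]_n -> 'rV[R]_d) :
  (forall i, measurable_fun setT (fun u => f u ord0 i : measurableTypeR R)) ->
  measurable_fun setT f.
Proof. by move=> mf; exact: measurable_fun_rV. Qed.

Lemma ge0_integral_rV_cons n (f : 'rV[R]_n.+1 -> \bar R) :
  measurable_fun setT f -> (forall x, (0 <= f x)%E) ->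
  (\int[lebesgue_rV n.+1]_x f x =
   \int[@lebesgue_measure R]_t \int[lebesgue_rV n]_v f (rV_cons (t, v)))%E.
Proof.
move=> mf f0.
transitivity (\int[pushforward (@lebesgue_measure R \x lebesgue_rV n)%E (@rV_cons R n)]_x f x)%E => //.
rewrite (ge0_integral_pushforward (@measurable_rV_cons R n))// preimage_setT.
rewrite fubini_tonelli1//; last by move=> x /=; exact: f0.
exact: (measurableT_comp mf (@measurable_rV_cons R n)).
Qed.

(** The pushforward of Lebesgue measure under the affine map, scaled by [t], agrees with Lebesgue
    measure on intervals, hence everywhere. *)
Lemma ge0_integral_affineR (a t : R) (f : measurableTypeR R -> \bar R) : 0 < t ->
  measurable_fun setT f -> (forall x, (0 <= f x)%E) ->
  (t%:E * \int[lebesgue_measure]_x f (a + t * x)%R = \int[@lebesgue_measure R]_x f x)%E.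
Proof.
move=> t0 mf f0.
pose g : measurableTypeR R -> measurableTypeR R := fun x => a + t * x.
have mg : measurable_fun setT g by apply: measurable_funD => //; exact: measurable_funM.
pose m := mscale (NngNum (ltW t0)) (measure_function_pushforward__canonical__measure_function_Measure (@lebesgue_measure R) mg).
transitivity (\int[m]_x f x)%E.
  by rewrite ge0_integral_mscale// ge0_integral_pushforward// preimage_setT.
apply: eq_measure_integral => A mA _; apply/esym.
apply: (@lebesgue_measure_unique R m) => // _ [[x y] _ <-] /=.
rewrite /m /mscale /= /pushforward (_ : g @^-1` _ = `](x - a) / t, (y - a) / t]%classic).
  rewrite !lebesgue_measure_itv /= !lte_fin ltr_pM2r ?invr_gt0// ltrD2r.
  case: ifP => _; last by rewrite mule0.
  by rewrite -!EFinD -EFinM; congr EFin; field; exact: lt0r_neq0.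
by apply/seteqP; split => u /=; rewrite !in_itv/= ltr_pdivrMr// ler_pdivlMr// ltrBlDl lerBrDl [u * t]mulrC.
Qed.

(** Homotheties split over the coordinates, so Tonelli and induction on [d] reduce them to the line.
    They serve to contract cubes in the Taylor remainder and to get translation invariance. *)
Lemma ge0_integral_affine d (z : 'rV[R]_d) (t : R) (f : 'rV[R]_d -> \bar R) : 0 < t ->
  measurable_fun setT f -> (forall x, (0 <= f x)%E) ->
  ((t ^+ d)%:E * \int[lebesgue_rV d]_x f (z + t *: x)%R = \int[lebesgue_rV d]_x f x)%E.
Proof.
move=> t0; elim: d z f => [|d IH] z f mf f0.
  rewrite expr0 mul1e; apply: eq_integral => x _; congr f.
  by rewrite [LHS]thinmx0 [RHS]thinmx0.
have ma : measurable_fun setT (fun x : 'rV[R]_d.+1 => z + t *: x).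
  apply: measurable_rowP => i; under eq_fun do rewrite !mxE.
  by apply: measurable_funD => //; apply: measurable_funM => //; exact: measurable_coor.
rewrite ge0_integral_rV_cons//; last exact: (measurableT_comp mf ma).
pose z' : 'rV[R]_d := \row_j z ord0 (lift ord0 j).
have zE s v : z + t *: rV_cons (s, v) = rV_cons (z ord0 ord0 + t * s, z' + t *: v).
  by apply/rowP => i; rewrite !mxE; case: (unliftP ord0 i) => [j ->|->] /=; rewrite ?liftK ?unlift_none /= ?mxE.
pose F (s : measurableTypeR R) := (\int[lebesgue_rV d]_v f (rV_cons (s, v)))%E.
have mc : measurable_fun setT (f \o @rV_cons R d) by exact: (measurableT_comp mf (@measurable_rV_cons R d)).
have mF : measurable_fun setT F.
  by apply: (@measurable_fun_fubini_tonelli_F _ _ _ _ _ (lebesgue_rV d) (f \o @rV_cons R d)) => // x; exact: f0.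
have F0 s : (0 <= F s)%E by apply: integral_ge0.
have step s : ((t ^+ d)%:E * \int[lebesgue_rV d]_v f (z + t *: rV_cons (s, v))%R = F (z ord0 ord0 + t * s)%R)%E.
  under eq_integral do rewrite zE.
  rewrite (IH z' (fun v => f (rV_cons (z ord0 ord0 + t * s, v))))//.
  exact: (measurableT_comp mc (pair1_measurable _)).
rewrite [RHS]ge0_integral_rV_cons// -/(F _) -(ge0_integral_affineR (z ord0 ord0) t0 mF F0).
rewrite exprS EFinM -muleA; congr (_ * _)%E.
have td : 0 < t ^+ d by rewrite exprn_gt0.
have -> : (fun s => \int[lebesgue_rV d]_v f (z + t *: rV_cons (s, v))%R)%E =
    (fun s => ((t ^+ d)^-1)%:E * F (z ord0 ord0 + t * s)%R)%E.
  apply/funext => s; rewrite -step muleA -EFinM mulVf ?mul1e//.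
  exact: lt0r_neq0.
have mg : measurable_fun setT (fun s : measurableTypeR R => z ord0 ord0 + t * s : measurableTypeR R).
  by apply: measurable_funD => //; exact: measurable_funM.
rewrite ge0_integralZl//.
- by rewrite muleA -EFinM mulfV ?mul1e//; exact: lt0r_neq0.
- exact: (measurableT_comp mF mg).
- by rewrite lee_fin invr_ge0 ltW.
Qed.

End rV_measure.

(** * Partial derivatives *)

Section calculus.
Context {R : realType}.

(** The endpoints come in either order, since increments along a coordinate may be negative. *)
Lemma MVT_dist (g dg : R -> R) (a b : R) :
  (forall t : R, is_derive t 1 g (dg t)) ->
  exists2 c : R, `|c - a| <= `|b - a| & g b - g a = dg c * (b - a).
Proof.
move=> gd.
have cg A : {within A, continuous g}.
  apply: continuous_subspaceT => t; apply: differentiable_continuous.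
  exact/derivable1_diffP.
have [ab|/ltW ba] := leP a b.
  have [c] := MVT_segment ab (fun t _ => gd t) (cg _).
  rewrite in_itv/= => /andP[ac cb] ->; exists c => //.
  by rewrite !ger0_norm; lra.
have [c] := MVT_segment ba (fun t _ => gd t) (cg _).
rewrite in_itv/= => /andP[ac cb] E; exists c; first by rewrite !ler0_norm; lra.
by rewrite -[LHS]opprB E; lra.
Qed.

Lemma is_derive_line (V : normedModType R) (f : V -> R) (x v : V) (t : R) :
  derivable f (x + t *: v) v ->
  is_derive t 1 (fun u : R => f (x + u *: v)) ('D_v f (x + t *: v)).
Proof.
move=> df.
have E : (fun h : R => h^-1 *: (((fun u : R => f (x + u *: v)) \o shift t) (h *: 1) -
    f (x + t *: v))) = (fun h => h^-1 *: ((f \o shift (x + t *: v)) (h *: v) - f (x + t *: v))).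
  apply/funext => h /=; congr (_ *: (f _ - _)).
  by rewrite /shift /= [h *: 1]mulr1 scalerDl addrCA.
split; first by rewrite /derivable E.
by rewrite /derive E.
Qed.

Context {d : nat}.
Local Notation V := 'rV[R]_d.
Implicit Types (f g phi : V -> R) (x y z v : V).

Definition C1 f := forall i, (forall x, derivable f x (basis_vec i)) /\
  continuous ('D_(basis_vec i) f).

(** Walk from [x] to [x + h *: v] one coordinate at a time. The mean value theorem turns each leg
    into a partial derivative at a point near [x], and continuity of the partial derivatives gives
    the limit after division by [h]. *)
Lemma C1_directional f x v : C1 f ->
  is_derive x v f (\sum_i v ord0 i * 'D_(basis_vec i) f x).
Proof.
move=> Cf.
(* The point reached after the first [k] legs. *)
pose p (h : R) k : V := x + h *: \sum_(j < d | (j < k)%N) v ord0 j *: basis_vec j.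
have pS h (i : 'I_d) : p h i.+1 = p h i + (h * v ord0 i) *: basis_vec i.
  rewrite /p (bigD1 i)//= scalerDr scalerA addrAC -addrA; congr (_ + (_ *: _ + _ *: _)).
  by apply: eq_bigl => j; rewrite ltnS andbC -val_eqE ltn_neqAle.
have p0 h : p h 0%N = x by rewrite /p big_pred0 ?scaler0 ?addr0// => i; rewrite ltn0.
have vE : \sum_(j < d) v ord0 j *: basis_vec j = v.
  by rewrite [RHS]row_sum_delta.
have pd h : p h d = x + h *: v.
  rewrite /p -[in RHS]vE; congr (_ + _ *: _).
  by apply: eq_bigl => j; rewrite ltn_ord.
pose N := 1 + \sum_i `|v ord0 i|.
have Ngt0 : 0 < N by rewrite ltr_pwDl// sumr_ge0.
have vN i : `|v ord0 i| <= N.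
  by rewrite /N (bigD1 i)//= addrCA lerDl addr_ge0// sumr_ge0.
have pcoord h k (i : 'I_d) : `|p h k ord0 i - x ord0 i| <= `|h| * N.
  rewrite /p !mxE (addrC (x ord0 i)) addrK normrM ler_wpM2l// summxE (le_trans (ler_norm_sum _ _ _))//.
  rewrite (le_trans _ (vN i))// (bigID (pred1 i))/= [X in _ + X]big1 ?addr0; last first.
    by move=> j /andP[_ ji]; rewrite !mxE eqxx eq_sym (negbTE ji) mulr0 normr0.
  rewrite (eq_bigl (fun j => (j == i) && (i < k)%N)); last first.
    by move=> j /=; rewrite andbC; case: eqP => // ->.
  case: ltnP => ik; last by rewrite big_pred0// => j; rewrite andbF.
  rewrite (eq_bigl (pred1 i)); last by move=> j; rewrite andbT.
  by rewrite big_pred1_eq !mxE !eqxx mulr1.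
have step h : f (x + h *: v) - f x = \sum_(i < d) (f (p h i.+1) - f (p h i)).
  rewrite -(big_mkord xpredT (fun i => f (p h i.+1) - f (p h i))) telescope_sumr//.
  by rewrite pd p0.
have mv h (i : 'I_d) : exists2 w : V, (forall j, `|w ord0 j - x ord0 j| <= `|h| * (2 * N)) &
    f (p h i.+1) - f (p h i) = h * (v ord0 i * 'D_(basis_vec i) f w).
  have [] := @MVT_dist (fun t => f (p h i + t *: basis_vec i))
    (fun t => 'D_(basis_vec i) f (p h i + t *: basis_vec i)) 0 (h * v ord0 i).
    by move=> t; apply: is_derive_line; exact: (Cf i).1.
  move=> c; rewrite !subr0 normrM => cle; rewrite scale0r addr0 -pS => ->.
  exists (p h i + c *: basis_vec i); last by rewrite mulrC mulrA.
  move=> j; rewrite mxE [X in _ + X - _]mxE [basis_vec _ _ _]mxE eqxx/= addrAC.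
  rewrite (le_trans (ler_normD _ _))// (_ : 2 * N = N + N); last by ring.
  rewrite mulrDr lerD//.
  rewrite normrM (le_trans _ (le_trans cle _))//; last by rewrite ler_wpM2l.
  by case: eqP => _; rewrite ?normr1 ?normr0 ?mulr1 ?mulr0.
have main : (h^-1 *: ((f \o shift x) (h *: v) - f x)) @[h --> (0 : R)^'] -->
    \sum_i v ord0 i * 'D_(basis_vec i) f x.
  apply/cvgrPdist_le => e e0.
  have e0' : 0 < e / (d.+1%:R * N) by rewrite divr_gt0// mulr_gt0// ltr0Sn.
  have /(_ _)/nbhs_cubeP cont i : nbhs x [set w | `|'D_(basis_vec i) f x - 'D_(basis_vec i) f w| <= e / (d.+1%:R * N)].
    by have /cvgrPdist_le := (Cf i).2 x; exact.
  pose r := \big[Order.min/1]_i (sval (cid2 (cont i))).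
  have r0 : 0 < r.
    apply: (big_ind (fun t => 0 < t)) => //; first by move=> a b; rewrite lt_min => -> ->.
    by move=> i _; case: cid2.
  have rle i : r <= sval (cid2 (cont i)) by rewrite /r (bigD1 i)//= ge_min lexx.
  near=> h.
  have h0 : h != 0 by near: h; exact: nbhs_dnbhs_neq.
  have hr : `|h| * (2 * N) < r.
    rewrite -ltr_pdivlMr ?mulr_gt0//; near: h; apply: dnbhs0_lt.
    by rewrite divr_gt0// mulr_gt0.
  have -> : (f \o shift x) (h *: v) = f (x + h *: v) by rewrite /= addrC.
  rewrite step scaler_sumr -sumrB.
  rewrite (le_trans (ler_norm_sum _ _ _))//.
  apply: (@le_trans _ _ (\sum_(i < d) (e / d.+1%:R))); last first.
    rewrite sumr_const card_ord -[_ *+ d]mulr_natr -mulrA ler_piMr ?(ltW e0)//.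
    by rewrite ler_pdivrMl ?ltr0Sn// mulr1 ler_nat.
  apply: ler_sum => i _; have [w wx ->] := mv h i.
  rewrite -[_ *: _]/(_ * _) mulKf// -mulrBr normrM.
  rewrite (le_trans (ler_wpM2r _ (vN i)))// mulrC -ler_pdivlMr//.
  rewrite -mulrA -invfM; move: (rle i); case: cid2 => /= ri ri0 cri rri; apply: cri.
  by move=> j; rewrite (le_lt_trans (wx j))// (lt_le_trans hr).
split; first by apply/cvg_ex; eexists; exact: main.
by apply: cvg_lim => //; exact: main.
Unshelve. all: by end_near. Qed.

Lemma iter_deriv_cat l l' phi :
  iter_deriv (l ++ l') phi = iter_deriv l (iter_deriv l' phi).
Proof. exact: foldr_cat. Qed.

Lemma smooth_iter_deriv l phi : smooth phi -> smooth (iter_deriv l phi).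
Proof. by move=> sphi l'; rewrite -iter_deriv_cat; exact: sphi. Qed.

Lemma smooth_continuous phi : smooth phi -> continuous phi.
Proof. by move=> /(_ [::])[]. Qed.

Lemma smooth_C1 phi : smooth phi -> C1 phi.
Proof.
by move=> sphi i; split; [move=> x; exact: (sphi [::]).2|exact: (sphi [:: i]).1].
Qed.

Lemma smooth_iter_continuous l phi : smooth phi -> continuous (iter_deriv l phi).
Proof. by move=> /(_ l)[]. Qed.

(** The mean value theorem, applied once in each direction. The second difference is symmetric under
    exchange of [(i, h)] and [(j, k)], and [schwarz] transfers this symmetry to the mixed
    derivatives. *)
Lemma second_difference f x (i j : 'I_d) (h k : R) : smooth f ->
  exists2 w : V, (forall m, `|w ord0 m - x ord0 m| <= `|h| + `|k|) &
   f (x + h *: basis_vec i + k *: basis_vec j) - f (x + h *: basis_vec i)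
   - f (x + k *: basis_vec j) + f x =
   h * k * iter_deriv [:: j; i] f w.
Proof.
move=> sf.
pose ei := basis_vec i : V; pose ej := basis_vec j : V.
have [] := @MVT_dist (fun t => f (x + k *: ej + t *: ei) - f (x + t *: ei))
    (fun t => 'D_ei f (x + k *: ej + t *: ei) - 'D_ei f (x + t *: ei)) 0 h.
  by move=> t; apply: is_deriveB; apply: is_derive_line; exact: (smooth_C1 sf i).1.
move=> c; rewrite !subr0 => ch E1.
have [] := @MVT_dist (fun t => 'D_ei f (x + c *: ei + t *: ej))
    (fun t => 'D_ej ('D_ei f) (x + c *: ei + t *: ej)) 0 k.
  by move=> t; apply: is_derive_line; exact: (smooth_C1 (@smooth_iter_deriv [:: i] _ sf) j).1.
move=> b; rewrite !subr0 => bk E2.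
exists (x + c *: ei + b *: ej).
  move=> m; rewrite !mxE eqxx /=.
  rewrite [X in `|X|](_ : _ = c * (m == i)%:R + b * (m == j)%:R); last by ring.
  rewrite (le_trans (ler_normD _ _))// !normrM lerD//.
    by rewrite (le_trans _ ch)// ler_piMr//; case: eqP => _; rewrite ?normr1 ?normr0.
  by rewrite (le_trans _ bk)// ler_piMr//; case: eqP => _; rewrite ?normr1 ?normr0.
rewrite /= -/ei -/ej; move: E1 E2; rewrite !scale0r !addr0.
rewrite (addrAC x (k *: ej) (c *: ei)) (addrAC x (k *: ej) (h *: ei)) => E1 E2.
by move: E1; rewrite E2 => E1; rewrite (mulrC h) mulrAC (mulrC k) -E1; lra.
Qed.

(** The two orders of differentiation produce different intermediate points, so values can be
    matched only near [x]; continuity closes the gap. *)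
Lemma eq_of_near_values (f g : V -> R) x : continuous f -> continuous g ->
  (forall r, 0 < r -> exists w w', [/\ cube x r w, cube x r w' & f w = g w']) ->
  f x = g x.
Proof.
move=> cf cg fg; apply/eqP; rewrite -subr_eq0 -normr_le0.
apply/ler_addgt0Pl => e e0; rewrite addr0.
have e20 : 0 < e / 2 by rewrite divr_gt0.
have /cvgrPdist_le/(_ _ e20)/nbhs_cubeP[r1 r10 H1] := cf x.
have /cvgrPdist_le/(_ _ e20)/nbhs_cubeP[r2 r20 H2] := cg x.
have r0 : 0 < Num.min r1 r2 by rewrite lt_min r10.
have [w [w' [wx w'x ww]]] := fg _ r0.
have D1 : `|f x - f w| <= e / 2.
  by apply: H1 => m; rewrite (lt_le_trans (wx m))// ge_min lexx.
have D2 : `|g x - g w'| <= e / 2.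
  by apply: H2 => m; rewrite (lt_le_trans (w'x m))// ge_min lexx orbT.
rewrite [leRHS]splitr -(subrK (f w) (f x)) -addrA.
by rewrite (le_trans (ler_normD _ _))// lerD// ww distrC.
Qed.

Lemma schwarz f (i j : 'I_d) : smooth f ->
  iter_deriv [:: i; j] f = iter_deriv [:: j; i] f.
Proof.
move=> sf; apply/funext => x; apply: eq_of_near_values.
- exact: (@smooth_iter_continuous [:: i; j] f sf).
- exact: (@smooth_iter_continuous [:: j; i] f sf).
move=> r r0; pose h := r / 4.
have h0 : 0 < h by rewrite divr_gt0.
have hr : `|h| + `|h| < r by rewrite gtr0_norm// /h; lra.
have [w wx E] := second_difference x i j h h sf.
have [w' wx' E'] := second_difference x j i h h sf.
exists w', w; split.
- by move=> m; exact: le_lt_trans (wx' m) hr.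
- by move=> m; exact: le_lt_trans (wx m) hr.
have hh : h * h != 0 by rewrite mulf_neq0// lt0r_neq0.
apply: (mulfI hh); rewrite -[LHS]E' -[RHS]E (addrAC x (h *: basis_vec i)).
by congr (_ + _); rewrite -!addrA; congr (_ + _); exact: addrC.
Qed.

Lemma iter_deriv_perm (l l' : seq 'I_d) f : smooth f -> perm_eq l l' ->
  iter_deriv l f = iter_deriv l' f.
Proof.
move=> sf.
have rot1 i l1 : forall l2, iter_deriv (l1 ++ i :: l2) f = iter_deriv (i :: l1 ++ l2) f.
  elim: l1 => // j l1 IH l2; rewrite [LHS]/= IH.
  exact: (@schwarz (iter_deriv (l1 ++ l2) f) j i (@smooth_iter_deriv (l1 ++ l2) f sf)).
elim: l l' => [|i l IH] l'; first by rewrite perm_sym => /perm_nilP ->.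
move=> pl; have : i \in l' by rewrite -(perm_mem pl) mem_head.
move=> /splitPr il'; case: il' pl => l1 l2 pl; rewrite rot1.
rewrite /= (IH (l1 ++ l2))//.
by rewrite -(perm_cons i) (perm_trans pl)// perm_catC /= perm_cons perm_catC.
Qed.

End calculus.

(** * Sampling inequality *)

Section taylor.
Context {R : realType} {d : nat}.
Local Notation V := 'rV[R]_d.
Implicit Types (phi : V -> R) (x y z v : V).

(* A multi-index occurs once for each ordering of its entries. *)
Fixpoint words k : seq (seq 'I_d) :=
  if k is k'.+1 then [seq i :: l | i <- enum 'I_d, l <- words k'] else [:: [::]].

Lemma size_words k l : l \in words k -> size l = k.
Proof.
elim: k l => [|k IH] l /=; first by rewrite inE => /eqP ->.
by move=> /allpairsP[[i l'] /= [_ l'k ->]] /=; rewrite (IH _ l'k).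
Qed.

Lemma big_words k (F : seq 'I_d -> R) :
  \sum_(l <- words k.+1) F l = \sum_i \sum_(l <- words k) F (i :: l).
Proof. by rewrite /= big_allpairs_dep big_enum. Qed.

Definition monv v (l : seq 'I_d) : R := \prod_(i <- l) v ord0 i.

Lemma is_derive_bigsum (W : normedModType R) (T : Type) (r : seq T) (F : T -> W -> R) (dF : T -> R) (p q : W) :
  (forall i, is_derive p q (F i) (dF i)) ->
  is_derive p q (fun w => \sum_(i <- r) F i w) (\sum_(i <- r) dF i).
Proof.
move=> H; elim: r => [|i r IH].
  rewrite big_nil; under eq_fun do rewrite big_nil; exact: is_derive_cst.
rewrite big_cons; under eq_fun do rewrite big_cons.
exact: (is_deriveD (H i) IH).
Qed.

(** The [k]-th derivative of the function that sends [t] to [phi (z + t *: v)]. *)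
Definition dirder phi k z v (t : R) : R :=
  \sum_(l <- words k) iter_deriv l phi (z + t *: v) * monv v l.

Lemma is_derive_dirder phi k z v (t : R) : smooth phi ->
  is_derive t 1 (dirder phi k z v) (dirder phi k.+1 z v t).
Proof.
move=> sphi; rewrite /dirder big_words exchange_big/=.
apply: is_derive_bigsum => l.
have [dl dlE] := C1_directional (z + t *: v) v (smooth_C1 (@smooth_iter_deriv _ _ l _ sphi)).
have := is_derive_line dl; rewrite dlE => D.
rewrite (_ : (fun _ => _) = monv v l \*: (fun u : R => iter_deriv l phi (z + u *: v))); last first.
  by apply/funext => u /=; rewrite mulrC.
apply: is_derive_eq; rewrite -[_ *: _]/(_ * _) mulr_sumr; apply: eq_bigr => i _.
by rewrite /monv big_cons /=; ring.
Qed.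

Lemma is_derive_exprn (n : nat) (t : R) :
  is_derive t 1 (fun u : R => u ^+ n) (n%:R * t ^+ n.-1).
Proof.
split; first exact: exprn_derivable.
by rewrite exp_derive -[RHS]mulr1.
Qed.

(** The Taylor polynomial at [y], evaluated at [y - v], hence the signs. Since a multi-index occurs
    once per ordering, the factorial of [k] is the only one. *)
Definition taylor_poly phi s y v : R :=
  \sum_(k < s) (-1) ^+ k / k`!%:R * \sum_(l <- words k) iter_deriv l phi y * monv v l.

(* The Taylor polynomial at [z + t ^+ 2 *: v], evaluated at [z]: it runs from
   [phi z] to the Taylor polynomial at [z + v], and its derivative is a single
   term.  The parameter [t ^+ 2] makes the powers of [t] left by the contraction
   by [t ^+ 2] in the remainder nonnegative for all [d < 2 * s]. *)
Let tpath phi s z v (t : R) :=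
  \sum_(k < s) (-1) ^+ k / k`!%:R * (dirder phi k z v (t ^+ 2) * t ^+ (2 * k)).

(** The sum telescopes: differentiating the power of [t] in term [k + 1] cancels what the
    directional derivative contributes in term [k], and only the last contribution survives. *)
Lemma is_derive_tpath phi s z v (t : R) : smooth phi ->
  is_derive t 1 (tpath phi s.+1 z v)
    ((-1) ^+ s / s`!%:R * (dirder phi s.+1 z v (t ^+ 2) * (2 * t ^+ (2 * s).+1))).
Proof.
move=> sphi.
have D k : is_derive t 1 (fun u : R => dirder phi k z v (u ^+ 2) * u ^+ (2 * k))
    (dirder phi k.+1 z v (t ^+ 2) * (2 * t ^+ (2 * k).+1) +
     dirder phi k z v (t ^+ 2) * ((2 * k)%:R * t ^+ (2 * k).-1)).
  have D1 := @is_derive1_comp _ (dirder phi k z v) (fun u => u ^+ 2) t _ _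
    (is_derive_dirder k z v (t ^+ 2) sphi) (is_derive_exprn 2 t).
  have D2 := is_deriveM D1 (is_derive_exprn (2 * k) t).
  apply: is_derive_eq; rewrite -![_ *: _]/(_ * _) /= expr1.
  rewrite [t ^+ (2 * k).+1]exprS; move: (t ^+ (2 * k).-1) (t ^+ (2 * k)) (dirder _ _ _ _ _) (dirder _ _ _ _ _) => *; ring.
elim: s => [|s IH].
  rewrite /tpath; under eq_fun do rewrite big_ord_recr big_ord0 /= add0r.
  have D0 := is_deriveZ ((-1) ^+ 0 / 0`!%:R) (D 0%N).
  apply: (@is_derive_eq _ _ _ _ _ _ _ _ D0).
  by rewrite -[_ *: _]/(_ * _) muln0 mul0r mulr0 addr0.
have -> : tpath phi s.+2 z v = (fun u => tpath phi s.+1 z v u +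
   (-1) ^+ s.+1 / s.+1`!%:R * (dirder phi s.+1 z v (u ^+ 2) * u ^+ (2 * s.+1))).
  by apply/funext => u; rewrite /tpath big_ord_recr.
have D1 := is_deriveD IH (is_deriveZ ((-1) ^+ s.+1 / s.+1`!%:R) (D s.+1)).
apply: (@is_derive_eq _ _ _ _ _ _ _ _ D1); rewrite -[_ *: _]/(_ * _) mulrDr.
rewrite addrCA -[RHS]addr0; congr (_ + _).
have -> : (2 * s.+1).-1 = (2 * s).+1 by rewrite mulnS.
rewrite factS !natrM [(-1) ^+ s.+1]exprS.
have s0 : s.+1%:R != 0 :> R by rewrite pnatr_eq0.
have f0 : s`!%:R != 0 :> R by rewrite pnatr_eq0 -lt0n fact_gt0.
move: (dirder phi s.+1 z v (t ^+ 2)) => P; move: (t ^+ (2 * s).+1) ((-1) ^+ s) => T U.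
move: (s.+1%:R) (s`!%:R) s0 f0 => A B A0 B0.
by field; rewrite A0 B0.
Qed.

Lemma tpath0 phi s z v : tpath phi s.+1 z v 0 = phi z.
Proof.
rewrite /tpath big_ord_recl big1 ?addr0; last first.
  by move=> i _; rewrite lift0 mulnS [0 ^+ (_ + _)]expr0n !mulr0.
rewrite /= expr0 fact0 divr1 mul1r muln0 expr0 mulr1 /dirder /= big_seq1.
by rewrite /monv big_nil mulr1 /= expr0n /= scale0r addr0.
Qed.

Lemma tpath1 phi s z v : tpath phi s z v 1 = taylor_poly phi s (z + v) v.
Proof.
apply: eq_bigr => k _; congr (_ * _); rewrite !expr1n mulr1 /dirder.
by rewrite scale1r.
Qed.

(** Expand the integral of the nonnegative function (f - m)^2, where m is the mean of f. *)
Lemma jensen01 (f : R -> R) : continuous f ->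
  (((\int[@lebesgue_measure R]_(t in `[0, 1]) f t) ^+ 2)%R%:E <=
   \int[@lebesgue_measure R]_(t in `[0%R, 1%R]) (f t ^+ 2)%:E)%E.
Proof.
move=> cf.
have I (g : R -> R) : continuous g -> (@lebesgue_measure R).-integrable `[0, 1] (EFin \o g).
  move=> cg; apply: continuous_compact_integrable; first exact: segment_compact.
  exact: continuous_subspaceT.
have cf2 : continuous (fun t => f t ^+ 2).
  by move=> t; apply: (@continuousM _ _ f f); exact: cf.
have If := I _ cf; have If2 := I _ cf2.
pose m := (\int[@lebesgue_measure R]_(t in `[0, 1]) f t)%R.
rewrite -/m.
have Ic : (@lebesgue_measure R).-integrable `[0, 1] (EFin \o cst (m ^+ 2)).
  by apply: I => t; exact: cvg_cst.
have Il : (@lebesgue_measure R).-integrable `[0, 1] (EFin \o (fun t => 2 * m * f t)).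
  by apply: I => t; apply: cvgM; [exact: cvg_cst|exact: cf].
have : 0 <= (\int[@lebesgue_measure R]_(t in `[0, 1]) (f t ^+ 2 - 2 * m * f t + m ^+ 2))%R.
  by apply: Rintegral_ge0 => t _; rewrite (_ : _ + _ = (f t - m) ^+ 2) ?sqr_ge0//; ring.
rewrite RintegralD//=; last first.
  apply: I => t; apply: cvgB; first exact: cf2.
  by apply: cvgM; [exact: cvg_cst|exact: cf].
rewrite RintegralB//= RintegralZl//= -/m.
rewrite [X in _ + X]Rintegral_cst//= lebesgue_measure_itv/= lte_fin ltr01 oppr0 addr0 /= mulr1 => H.
have -> : (\int[@lebesgue_measure R]_(t in `[0%R, 1%R]) (f t ^+ 2)%:E =
  (\int[@lebesgue_measure R]_(t in `[0%R, 1%R]) (f t ^+ 2))%R%:E)%E.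
  by rewrite /Rintegral fineK//; exact: (integrable_fin_num _ If2).
by rewrite lee_fin; move: H; nra.
Qed.

Lemma is_derive_continuous (g dg : R -> R) : (forall t : R, is_derive t 1 g (dg t)) ->
  continuous g.
Proof.
move=> gd t; apply: differentiable_continuous; exact/derivable1_diffP.
Qed.

Lemma continuous_exprn (n : nat) : continuous (fun t : R => t ^+ n).
Proof. exact: (is_derive_continuous (is_derive_exprn _)). Qed.

Lemma continuous_dirder_sqr phi k z v : smooth phi ->
  continuous (fun t : R => dirder phi k z v (t ^+ 2)).
Proof.
move=> sphi; apply: is_derive_continuous => t.
exact: (@is_derive1_comp _ (dirder phi k z v) (fun u => u ^+ 2) t _ _
  (is_derive_dirder k z v (t ^+ 2) sphi) (is_derive_exprn 2 t)).
Qed.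

(** The fundamental theorem of calculus for [tpath] between 0 and 1, followed by [jensen01]; the
    inverse factorial is bounded by 1. *)
Lemma taylor_remainder_sqr phi s z y : smooth phi ->
  (((phi z - taylor_poly phi s.+1 y (y - z)) ^+ 2)%:E <=
   \int[@lebesgue_measure R]_(t in `[0%R, 1%R])
     ((2 * t ^+ (2 * s).+1 * dirder phi s.+1 z (y - z) (t ^+ 2)) ^+ 2)%:E)%E.
Proof.
move=> sphi; set v := y - z.
pose f t := (-1) ^+ s / s`!%:R * (dirder phi s.+1 z v (t ^+ 2) * (2 * t ^+ (2 * s).+1)).
have c1 := @continuous_dirder_sqr phi s.+1 z v sphi.
have c2 := @continuous_exprn (2 * s).+1.
have cf : continuous f.
  move=> t; rewrite /f; apply: cvgM; first exact: cvg_cst.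
  by apply: cvgM; [exact: c1|apply: cvgM; [exact: cvg_cst|exact: c2]].
have dT t := is_derive_tpath s z v t sphi.
have cT : continuous (tpath phi s.+1 z v) := is_derive_continuous dT.
have F : (\int[@lebesgue_measure R]_(t in `[0%R, 1%R]) (f t)%:E =
   (tpath phi s.+1 z v 1)%:E - (tpath phi s.+1 z v 0)%:E)%E.
  apply: continuous_FTC2 => //; first exact: continuous_subspaceT.
  - split; first by move=> t _; have [] := dT t.
    + by apply: cvg_at_right_filter; exact: cT.
    + by apply: cvg_at_left_filter; exact: cT.
  - by move=> t _; rewrite derive1E; have [] := dT t.
have E : phi z - taylor_poly phi s.+1 y v = - (\int[@lebesgue_measure R]_(t in `[0, 1]) f t)%R.
  rewrite /Rintegral F tpath1 tpath0 /= opprB; congr (_ - taylor_poly _ _ _ _).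
  by rewrite /v addrC subrK.
rewrite E sqrrN (le_trans (jensen01 cf))//.
have mc (g : R -> R) : continuous g -> measurable_fun (`[0%R, 1%R]%classic : set (measurableTypeR R)) (fun t => (g t ^+ 2)%:E).
  move=> cg; apply/measurable_EFinP; apply: measurable_funX; apply: measurable_funTS.
  exact: continuous_measurable_fun.
apply: ge0_le_integral => //=.
- by move=> t _; rewrite lee_fin sqr_ge0.
- exact: mc.
- apply: mc => t; apply: cvgM; last exact: c1.
  by apply: cvgM; [exact: cvg_cst|exact: c2].
move=> t _; rewrite lee_fin /f exprMn [leRHS](_ : _ =
   (dirder phi s.+1 z v (t ^+ 2) * (2 * t ^+ (2 * s).+1)) ^+ 2); last by ring.
rewrite ler_piMl ?sqr_ge0// exprMn sqrr_sign mul1r exprVn invf_le1 ?exprn_gt0 ?ltr0n ?fact_gt0//.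
by rewrite exprn_ege1// ler1n fact_gt0.
Qed.

End taylor.

Section sampling.
Context {R : realType}.

(** Weighted Cauchy-Schwarz. With partial sums P, S, T of p, p x, p x^2, the induction step needs T
    + P y^2 >= 2 S y for every y, which follows from S^2 <= P T; if P = 0 then S = 0. *)
Lemma convex_sqr (T : Type) (r : seq T) (p x : T -> R) : (forall i, 0 <= p i) ->
  (\sum_(i <- r) p i * x i) ^+ 2 <=
  (\sum_(i <- r) p i) * (\sum_(i <- r) p i * x i ^+ 2).
Proof.
move=> p0; elim: r => [|i r IH]; first by rewrite !big_nil expr0n mul0r.
rewrite !big_cons; move: IH.
have : 0 <= \sum_(j <- r) p j by exact: sumr_ge0.
have : 0 <= \sum_(j <- r) p j * x j ^+ 2.
  by apply: sumr_ge0 => j _; rewrite mulr_ge0// sqr_ge0.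
move: (\sum_(j <- r) p j) (\sum_(j <- r) p j * x j) (\sum_(j <- r) p j * x j ^+ 2).
move=> P S T' T0 P0 H; have pi0 := p0 i.
suff K : 0 <= T' + P * x i ^+ 2 - 2 * S * x i.
  by have := mulr_ge0 pi0 K; move: H; rewrite -subr_ge0 => H K'; rewrite -subr_ge0;
     apply: le_trans (addr_ge0 H K') _; rewrite le_eqVlt; apply/orP; left; apply/eqP; ring.
move: P0; rewrite le_eqVlt => /orP[/eqP P0|P0].
  move: H; rewrite -P0 mul0r => S0.
  have -> : S = 0 by apply/eqP; rewrite -sqrf_eq0 eq_le S0 sqr_ge0.
  by rewrite !mul0r mulr0 mul0r subr0 addr0.
rewrite -(pmulr_rge0 _ P0).
apply: le_trans (sqr_ge0 (S - P * x i)) _; move: H; rewrite -subr_ge0 => H.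
rewrite -subr_ge0; apply: le_trans H _.
rewrite le_eqVlt; apply/orP; left; apply/eqP; ring.
Qed.

Context {d : nat}.
Local Notation V := 'rV[R]_d.
Local Notation mu := (lebesgue_rV d : {sigma_finite_measure set V -> \bar R}).
Implicit Types (phi : V -> R) (x y z v : V).

(** The integrand of the squared seminorm of order [s], each derivative being counted once per
    ordering; [energy_integral_le] pays for this with the number of words. *)
Definition energy phi s x : R := \sum_(l <- words s) iter_deriv l phi x ^+ 2.

Lemma energy_ge0 phi s x : 0 <= energy phi s x.
Proof. by apply: sumr_ge0 => l _; exact: sqr_ge0. Qed.

Lemma continuous_bigsum (T : Type) (r : seq T) (F : T -> V -> R) :
  (forall i, continuous (F i)) -> continuous (fun x => \sum_(i <- r) F i x).
Proof.
move=> cF; elim: r => [|i r IH].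
  rewrite (_ : (fun x => _) = cst 0); first exact: cst_continuous.
  by apply/funext => x; rewrite big_nil.
rewrite (_ : (fun x => _) = (fun x => F i x + \sum_(j <- r) F j x)); last first.
  by apply/funext => x; rewrite big_cons.
by move=> x; exact: (continuousD (cF i x) (IH x)).
Qed.

Lemma energy_continuous phi s : smooth phi -> continuous (energy phi s).
Proof.
move=> sphi; apply: continuous_bigsum => l x.
have c := @smooth_iter_continuous _ _ l _ sphi x.
exact: (continuousM c c).
Qed.

Lemma monv_sqr_le v l (D : R) : (forall i, `|v ord0 i| <= D) ->
  monv v l ^+ 2 <= D ^+ (2 * size l).
Proof.
move=> vD; rewrite exprM; elim: l => [|i l IH].
  by rewrite /monv big_nil expr1n expr0.
rewrite /= [_ ^+ (size l).+1]exprS /monv big_cons exprMn ler_pM ?sqr_ge0//.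
rewrite -[leLHS]real_normK ?num_real// ler_pXn2r// nnegrE//.
exact: le_trans (vD i).
Qed.

Lemma dirder_sqr_le phi s z v (t D : R) : (forall i, `|v ord0 i| <= D) ->
  dirder phi s z v t ^+ 2 <=
  (size (words (d := d) s))%:R * D ^+ (2 * s) * energy phi s (z + t *: v).
Proof.
move=> vD; rewrite /dirder.
have := @convex_sqr _ (words s) (fun=> 1)
  (fun l => iter_deriv l phi (z + t *: v) * monv v l) (fun=> ler01).
under eq_bigr do rewrite mul1r.
under [X in _ <= _ * X]eq_bigr do rewrite mul1r.
rewrite big_const_seq count_predT iter_addr_0 => /le_trans; apply.
rewrite -mulrA ler_wpM2l// /energy mulr_sumr big_seq [leRHS]big_seq.
apply: ler_sum => l /size_words <-; rewrite exprMn mulrC ler_wpM2r ?sqr_ge0//.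
exact: monv_sqr_le.
Qed.

Lemma cube_segment (c : V) (r : R) x y (t : R) : 0 <= t <= 1 ->
  cube c r x -> cube c r y -> cube c r (x + t *: (y - x)).
Proof.
move=> /andP[t0 t1] xQ yQ i; have := xQ i; have := yQ i; rewrite !mxE.
set a := x _ _; set b := y _ _; set e := c _ _ => yb xa.
have -> : a + t * (b - a) - e = (1 - t) * (a - e) + t * (b - e) by ring.
rewrite (le_lt_trans (ler_normD _ _))// !normrM (ger0_norm t0) ger0_norm ?subr_ge0//.
have [->|tn0] := eqVneq t 0; first by rewrite subr0 mul1r mul0r addr0.
have tp : 0 < t by rewrite lt_def tn0.
rewrite (_ : r = (1 - t) * r + t * r); last by ring.
by rewrite ler_ltD// ?ltr_pM2l// ler_wpM2l ?subr_ge0// ltW.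
Qed.

Lemma measurable_contract (g : V -> R) z (m : nat) : continuous g ->
  measurable_fun setT (fun p : measurableTypeR R * V =>
    p.1 ^+ m * g (z + p.1 ^+ 2 *: (p.2 - z))).
Proof.
move=> cg; apply: measurable_funM; first by apply: measurable_funX; exact: measurable_fst.
have mg : measurable_fun setT (g : V -> measurableTypeR R) by exact: continuous_measurable_rV.
apply: (measurableT_comp mg); apply: measurable_fun_rV => i; under eq_fun do rewrite !mxE.
apply: measurable_funD => //; apply: measurable_funM.
  by apply: measurable_funX; exact: measurable_fst.
apply: measurable_funB => //.
exact: (measurableT_comp (measurable_coor i) measurable_snd).
Qed.

Lemma measurable_integral_contract (g : V -> R) z (m : nat) :
  continuous g -> (forall x, 0 <= g x) ->
  measurable_fun setT (fun y : V => \int[@lebesgue_measure R]_(t in `[0%R, 1%R])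
     (t ^+ m * g (z + t ^+ 2 *: (y - z)))%:E)%E.
Proof.
move=> cg g0.
pose F (p : measurableTypeR R * V) : \bar R :=
  (p.1 ^+ m * g (z + p.1 ^+ 2 *: (p.2 - z)) * \1_(`[0, 1]%classic : set R) p.1)%:E.
rewrite (_ : (fun y => _) = (fun y => \int[@lebesgue_measure R]_t F (t, y))%E); last first.
  apply/funext => y; rewrite integral_mkcond; apply: eq_integral => t _.
  by rewrite patchE /F /= indicE; case: ifPn => _; rewrite ?mulr1 ?mulr0.
apply: (measurable_fun_fubini_tonelli_G F).
  apply/measurable_EFinP; apply: measurable_funM; first exact: measurable_contract.
  apply: (measurableT_comp _ measurable_fst).
  by apply: measurable_indic; exact: measurable_itv.
move=> p; rewrite lee_fin; have [t01|t01] := boolP (p.1 \in (`[0, 1]%classic : set R)).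
  rewrite !mulr_ge0//; move: t01; rewrite inE/= in_itv/= => /andP[t0 _]; exact: exprn_ge0.
by rewrite [\1__ p.1]indicE (negbTE t01) mulr0.
Qed.

(** For fixed [t] the map from y to z + t^2 (y - z) sends the cube into itself and scales volumes by
    t^(2d). Undoing it costs t^(-2d), which t^m compensates because 2d <= m. The inner integral is
    thus at most the right-hand side for every [t] in the unit interval. *)
Lemma integral_contract_le (g : V -> R) (c : V) (r : R) z (m : nat) :
  continuous g -> (forall x, 0 <= g x) -> cube c r z -> (2 * d <= m)%N -> (0 < m)%N ->
  (\int[mu]_(y in cube c r) \int[@lebesgue_measure R]_(t in `[0%R, 1%R])
     (t ^+ m * g (z + t ^+ 2 *: (y - z)))%:E <= \int[mu]_(y in cube c r) (g y)%:E)%E.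
Proof.
move=> cg g0 zQ dm m0.
pose F (p : measurableTypeR R * V) : \bar R :=
  (p.1 ^+ m * g (z + p.1 ^+ 2 *: (p.2 - z)) * \1_(`[0, 1]%classic : set R) p.1 *
   \1_(cube c r) p.2)%:E.
have mg : measurable_fun setT (g : V -> measurableTypeR R) by exact: continuous_measurable_rV.
have mF : measurable_fun setT F.
  apply/measurable_EFinP; apply: measurable_funM; last first.
    apply: (measurableT_comp _ measurable_snd).
    by apply: measurable_indic; exact: measurable_cube.
  apply: measurable_funM; last first.
    apply: (measurableT_comp _ measurable_fst).
    by apply: measurable_indic; exact: measurable_itv.
  exact: measurable_contract.
have F0 p : (0 <= F p)%E.
  rewrite lee_fin -mulrA; have [t01|t01] := boolP (p.1 \in (`[0, 1]%classic : set R)).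
    rewrite !mulr_ge0//; move: t01; rewrite inE/= in_itv/= => /andP[t0 _]; exact: exprn_ge0.
  by rewrite [\1__ p.1]indicE (negbTE t01) mul0r mulr0.
have -> : (\int[mu]_(y in cube c r) \int[@lebesgue_measure R]_(t in `[0%R, 1%R])
     (t ^+ m * g (z + t ^+ 2 *: (y - z)))%:E =
   \int[mu]_y \int[@lebesgue_measure R]_t F (t, y))%E.
  rewrite integral_mkcond; apply: eq_integral => y _; rewrite patchE.
  case: ifPn => yQ; last first.
    rewrite integral0_eq// => t _; rewrite /F /= [\1_(cube _ _) _]indicE (negbTE yQ).
    by rewrite mulr0.
  rewrite integral_mkcond; apply: eq_integral => t _; rewrite patchE /F /= !indicE yQ mulr1.
  by case: ifPn => tI; rewrite ?mulr1 ?mulr0.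
rewrite -(fubini_tonelli F)//.
set I := (\int[mu]_(y in cube c r) (g y)%:E)%E.
have I0 : (0 <= I)%E by apply: integral_ge0 => y _; rewrite lee_fin.
apply: (@le_trans _ _ (\int[@lebesgue_measure R]_(t in `[0%R, 1%R]) cst I t)%E); last first.
  by rewrite integral_cst//= lebesgue_measure_itv/= lte_fin ltr01 oppr0 adde0 mule1.
rewrite [leRHS]integral_mkcond; apply: ge0_le_integral => //.
- by move=> t _; exact: integral_ge0.
- exact: (measurable_fun_fubini_tonelli_F F).
- apply/(measurable_restrictT _ (measurable_itv _)); exact: measurable_cst.
move=> t _; rewrite patchE; case: ifPn => tI; last first.
  by rewrite integral0_eq// => y _; rewrite /F /= [\1_(`[0, 1]%classic) _]indicE (negbTE tI) mulr0 mul0r.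
have /andP[t0 t1] : 0 <= t <= 1 by move: tI; rewrite inE/= in_itv.
(* At [t = 0] the map is constant and cannot be undone, but [t ^+ m] vanishes since [m] is
   positive. *)
move: t0; rewrite le_eqVlt => /orP[/eqP t0|t0].
  by rewrite integral0_eq// => y _; rewrite /F /= -t0 expr0n (gtn_eqF m0) !mul0r.
pose h (x : V) : \bar R := (g x * \1_(cube c r) x)%:E.
have mh : measurable_fun setT h.
  apply/measurable_EFinP; apply: measurable_funM => //.
  by apply: measurable_indic; exact: measurable_cube.
have h0 x : (0 <= h x)%E by rewrite lee_fin mulr_ge0.
have -> : I = (\int[mu]_x h x)%E.
  rewrite /I integral_mkcond; apply: eq_integral => y _; rewrite patchE /h indicE.
  by case: ifPn; rewrite ?mulr1 ?mulr0.
have t20 : 0 < t ^+ 2 by rewrite exprn_gt0.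
rewrite -(ge0_integral_affine (z - t ^+ 2 *: z) t20 mh h0).
have mh' : measurable_fun setT (fun x => h (z - t ^+ 2 *: z + t ^+ 2 *: x)).
  apply: (measurableT_comp mh); apply: measurable_rowP => i.
  under eq_fun do rewrite !mxE.
  by apply: measurable_funD => //; apply: measurable_funM => //; exact: measurable_coor.
rewrite -ge0_integralZl//; last first.
  by rewrite lee_fin exprn_ge0// ltW.
apply: ge0_le_integral => //.
- exact: (measurableT_comp mF (pair1_measurable (t : measurableTypeR R))).
- exact: measurable_funeM.
move=> y _; rewrite /F /= [\1_(`[0, 1]%classic) _]indicE tI mulr1.
have E : z - t ^+ 2 *: z + t ^+ 2 *: y = z + t ^+ 2 *: (y - z).
  by rewrite scalerBr -addrA; congr (_ + _); rewrite addrC.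
rewrite /h E -EFinM lee_fin.
rewrite !indicE; have [yQ|yQ] := boolP (y \in cube c r); last first.
  by rewrite mulr0 !mulr_ge0// exprn_ge0// ltW.
rewrite mem_set; last first.
  apply: (cube_segment _ zQ); last by move: yQ; rewrite inE.
  by apply/andP; split; [exact/exprn_ge0/ltW|apply: exprn_ile1 => //; exact: ltW].
rewrite !mulr1 ler_wpM2r// -exprM.
exact: (ler_wiXn2l (ltW t0) t1 dm).
Qed.

Variable (s : nat).
Hypothesis s_large : (d < 2 * s)%N.

(** [J] hides the integral over [t], so that the sampling inequality only handles a nonnegative
    measurable majorant. The 4 is the square of the 2 from differentiating t^2, and 2r bounds the
    coordinates of y - z. *)
Lemma taylor_remainder_integral phi (c : V) (r : R) z : smooth phi -> 0 < r -> cube c r z ->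
  exists J : V -> \bar R, [/\ measurable_fun setT J, forall y, (0 <= J y)%E,
   forall y, cube c r y -> (((phi z - taylor_poly phi s y (y - z)) ^+ 2)%:E <= J y)%E &
   (\int[mu]_(y in cube c r) J y <=
     (4 * (size (words (d := d) s))%:R * (2 * r) ^+ (2 * s))%:E * \int[mu]_(y in cube c r) (energy phi s y)%:E)%E].
Proof.
move=> sphi r0 zQ.
have [s' s'E] : exists s', s = s'.+1 by exists s.-1; rewrite prednK//; case: (s) s_large => //; rewrite muln0.
set N := (size _)%:R; set K := 4 * N * (2 * r) ^+ (2 * s).
have K0 : 0 <= K by rewrite !mulr_ge0// exprn_ge0// mulr_ge0// ltW.
(* The exponent of [t] in the squared remainder. Since d < 2s means d <= 2s' + 1, it is at least
   2d. *)
pose m := (2 * (2 * s').+1)%N.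
have m0 : (0 < m)%N by [].
have dm : (2 * d <= m)%N by rewrite leq_mul2l -ltnS (leq_trans s_large)// s'E mulnS.
pose I y := (\int[@lebesgue_measure R]_(t in `[0%R, 1%R])
     (t ^+ m * energy phi s (z + t ^+ 2 *: (y - z)))%:E)%E.
have cE := @energy_continuous _ s sphi.
have mI : measurable_fun setT I.
  by apply: measurable_integral_contract => // x; exact: energy_ge0.
have mt y : measurable_fun (`[0%R, 1%R]%classic : set (measurableTypeR R))
    (fun t => (t ^+ m * energy phi s (z + t ^+ 2 *: (y - z)))%:E).
  apply/measurable_EFinP; apply: measurable_funTS.
  exact: (measurableT_comp (measurable_contract z m cE) (pair2_measurable y)).
have I0 y : (0 <= I y)%E.
  apply: integral_ge0 => t /=; rewrite in_itv/= => /andP[t0 _].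
  by rewrite lee_fin mulr_ge0// ?exprn_ge0// energy_ge0.
exists (fun y => K%:E * I y)%E; split.
- exact: measurable_funeM.
- by move=> y; rewrite mule_ge0// lee_fin.
- move=> y yQ; rewrite {1}s'E; apply: le_trans (taylor_remainder_sqr s' z y sphi) _.
  rewrite /I -ge0_integralZl//; last first.
    move=> t /=; rewrite in_itv/= => /andP[t0 _].
    by rewrite lee_fin mulr_ge0// ?exprn_ge0// energy_ge0.
  apply: ge0_le_integral => //.
  + by move=> t _; rewrite lee_fin sqr_ge0.
  + apply/measurable_EFinP; apply: measurable_funX; apply: measurable_funTS.
    apply: continuous_measurable_fun => t.
    apply: cvgM; last exact: continuous_dirder_sqr.
    by apply: cvgM; [exact: cvg_cst|exact: continuous_exprn].
  + exact: measurable_funeM.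
  move=> t /=; rewrite in_itv/= => /andP[t0 t1]; rewrite -EFinM lee_fin.
  have vD i : `|(y - z) ord0 i| <= 2 * r.
    have := yQ i; have := zQ i; rewrite !mxE.
    have := ler_distD (c ord0 i) (y ord0 i) (z ord0 i).
    by rewrite (distrC (c ord0 i)); lra.
  rewrite exprMn exprMn -exprM mulnC -/m -[in leLHS]s'E.
  have := dirder_sqr_le phi s z (t ^+ 2) vD; rewrite -/N /K => H.
  apply: le_trans (ler_wpM2l _ H) _; first by rewrite mulr_ge0// exprn_ge0.
  by rewrite le_eqVlt; apply/orP; left; apply/eqP; ring.
rewrite ge0_integralZl//; last 2 first.
- exact: measurable_cube.
- exact: measurable_funTS.
rewrite lee_wpmul2l//; apply: integral_contract_le => //.
by move=> x; exact: energy_ge0.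
Qed.

(* Expand at each [y] of the cube and average over [y]: the weights reproduce the
   Taylor polynomials exactly, so only the remainders are left. *)
Lemma sampling_inequality phi (c : V) (r : R) x (B : finType) (zz : B -> V) (w : B -> R) :
  smooth phi -> 0 < r -> cube c r x -> (forall b, cube c r (zz b)) ->
  \sum_b `|w b| <= 2 ->
  (forall y l, (size l < s)%N -> monv (y - x) l = \sum_b w b * monv (y - zz b) l) ->
  (((2 * r) ^+ d * (phi x - \sum_b w b * phi (zz b)) ^+ 2)%:E <=
   (36 * (size (words (d := d) s))%:R * (2 * r) ^+ (2 * s))%:E * \int[mu]_(y in cube c r) (energy phi s y)%:E)%E.
Proof.
move=> sphi r0 xQ zQ w2 wl.
(* The point [x] joins its nodes as [None] with weight 1, so the absolute weights sum to at most 3.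
   Convexity squares this to 9, and the 4 of the remainder makes 36. *)
pose pt (o : option B) := oapp zz x o.
pose wt (o : option B) : R := oapp (fun b => - w b) 1 o.
have ptQ o : cube c r (pt o) by case: o => [b|] /=.
have := fun o => taylor_remainder_integral sphi r0 (ptQ o).
set K := (_ * _ * _); set E := (\int[_]_(y in _) _)%E => HJ.
pose J o := sval (cid (HJ o)).
have mJ o : measurable_fun setT (J o) by rewrite /J; case: cid => j /= [].
have J0 o y : (0 <= J o y)%E by rewrite /J; case: cid => j /= [].
have TJ o y : cube c r y -> (((phi (pt o) - taylor_poly phi s y (y - pt o)) ^+ 2)%:E <= J o y)%E.
  by move=> yQ; rewrite /J; case: cid => j /= [_ _ H _]; exact: H.
have IJ o : (\int[mu]_(y in cube c r) J o y <= K%:E * E)%E by rewrite /J; case: cid => j /= [].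
have sumO (F : option B -> R) : \sum_o F o = F None + \sum_b F (Some b).
  rewrite (bigD1 None)//=; congr (_ + _).
  rewrite (reindex_omap Some id) //=; first by apply: eq_bigl => b; rewrite eqxx.
  by case.
have wt3 : \sum_o `|wt o| <= 3.
  rewrite sumO /= normr1 (eq_bigr (fun b => `|w b|)); first lra.
  by move=> b _; rewrite normrN.
set lam := phi x - _.
have lamE y : lam = \sum_o wt o * (phi (pt o) - taylor_poly phi s y (y - pt o)).
  under eq_bigr do rewrite mulrBr.
  rewrite sumrB sumO /= mul1r (_ : \sum_o wt o * taylor_poly _ _ _ _ = 0) ?subr0.
    by congr (_ + _); rewrite -sumrN; apply: eq_bigr => b _; rewrite mulNr.
  rewrite sumO /= mul1r; apply/eqP; rewrite addr_eq0; apply/eqP.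
  rewrite -sumrN; under [RHS]eq_bigr do rewrite mulNr opprK /taylor_poly mulr_sumr.
  rewrite exchange_big/=; apply: eq_bigr => k _.
  under [RHS]eq_bigr do rewrite mulrCA mulr_sumr.
  rewrite -mulr_sumr; congr (_ * _); rewrite exchange_big/=.
  rewrite big_seq [RHS]big_seq; apply: eq_bigr => l /size_words lk.
  rewrite wl ?lk// mulr_sumr; apply: eq_bigr => b _; ring.
have lamJ y : cube c r y -> ((lam ^+ 2)%:E <= 3%:E * \sum_o `|wt o|%:E * J o y)%E.
  move=> yQ.
  (* [convex_sqr] wants nonnegative weights, so the signs are moved to the values. *)
  have H : lam ^+ 2 <= 3 * \sum_o `|wt o| * (phi (pt o) - taylor_poly phi s y (y - pt o)) ^+ 2.
    have := @convex_sqr _ (index_enum _) (fun o => `|wt o|)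
      (fun o => Num.sg (wt o) * (phi (pt o) - taylor_poly phi s y (y - pt o))) (fun _ => normr_ge0 _).
    under [X in X ^+ 2 <= _]eq_bigr do rewrite mulrA [_ * Num.sg _]mulrC -numEsg.
    rewrite -lamE => /le_trans; apply.
    apply: ler_pM => //; [exact: sumr_ge0| |].
      by apply: sumr_ge0 => o _; rewrite mulr_ge0// sqr_ge0.
    apply: ler_sum => o _; rewrite exprMn mulrA ler_wpM2r ?sqr_ge0//.
    by rewrite sqr_sg ler_piMr//; case: eqP.
  apply: (@le_trans _ _ (3 * \sum_o `|wt o| * (phi (pt o) - taylor_poly phi s y (y - pt o)) ^+ 2)%:E).
    by rewrite lee_fin.
  rewrite EFinM lee_wpmul2l// -sumEFin; apply: lee_sum => o _.
  by rewrite EFinM lee_wpmul2l ?lee_fin//; exact: TJ.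
have mQ := measurable_cube c r.
have mS : measurable_fun setT (fun y => \sum_o `|wt o|%:E * J o y)%E.
  by apply: emeasurable_sum => o _; exact: measurable_funeM.
have -> : ((2 * r) ^+ d * lam ^+ 2)%:E = (\int[mu]_(y in cube c r) cst (lam ^+ 2)%:E y)%E.
  rewrite integral_cst//= EFinM muleC; congr mule.
  by rewrite lebesgue_cube// ltW.
apply: (@le_trans _ _ (\int[mu]_(y in cube c r) (3%:E * \sum_o `|wt o|%:E * J o y))%E).
  apply: ge0_le_integral => //.
  - by move=> y _; rewrite lee_fin sqr_ge0.
  - exact/measurable_funTS/measurable_funeM.
rewrite ge0_integralZl//=; last 2 first.
- exact: measurable_funTS.
- by move=> y _; apply: sume_ge0 => o _; rewrite mule_ge0.
rewrite ge0_integral_sum//; last 2 first.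
- by move=> o; exact/measurable_funTS/measurable_funeM.
- by move=> o y _; rewrite mule_ge0.
apply: (@le_trans _ _ (3%:E * \sum_o (`|wt o|%:E * (K%:E * E)))%E).
  rewrite lee_wpmul2l//; apply: lee_sum => o _.
  rewrite ge0_integralZl//; last exact: measurable_funTS.
  by rewrite lee_wpmul2l ?lee_fin//; exact: IJ.
have E0 : (0 <= E)%E by apply: integral_ge0 => y _; rewrite lee_fin energy_ge0.
have K0 : 0 <= K by rewrite !mulr_ge0// exprn_ge0// mulr_ge0// ltW.
rewrite -ge0_sume_distrl; last by move=> o _; rewrite lee_fin.
rewrite sumEFin !muleA -!EFinM; apply: lee_wpmul2r => //; rewrite lee_fin.
by rewrite /K; move: K0; rewrite /K; nra.
Qed.

End sampling.

(** * Polynomial reproduction at perturbed grid points *)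

Section weights.
Context {R : realType}.

(** The matrix I - A at least halves the l^1 norm, acting from either side. On row vectors this
    leaves no kernel; on the solution it allows half of the norm to be absorbed, hence the factor
    2. *)
Lemma near_identity_solve n (A : 'M[R]_n) (eta : R) (e : 'cV[R]_n) :
  (forall i j, `|A i j - (i == j)%:R| <= eta) -> n%:R * eta <= 2^-1 ->
  exists2 w : 'cV[R]_n, A *m w = e & \sum_i `|w i 0| <= 2 * \sum_i `|e i 0|.
Proof.
move=> AI neta.
have Au : A \in unitmx.
  rewrite -row_free_unit -kermx_eq0; apply/rowV0P => v /sub_kermxP vA.
  have vE j : v 0 j = \sum_i v 0 i * ((i == j)%:R - A i j).
    under eq_bigr do rewrite mulrBr.
    rewrite sumrB (bigD1 j)//= eqxx mulr1 big1 ?addr0; last first.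
      by move=> i /negbTE ->; rewrite mulr0.
    have /matrixP/(_ 0 j) := vA; rewrite !mxE => ->; rewrite subr0//.
  have vle j : `|v 0 j| <= (\sum_i `|v 0 i|) * eta.
    rewrite {1}vE (le_trans (ler_norm_sum _ _ _))// mulr_suml ler_sum// => i _.
    by rewrite normrM ler_wpM2l// distrC.
  have S0 : 0 <= \sum_i `|v 0 i| by exact: sumr_ge0.
  have : \sum_i `|v 0 i| <= n%:R * eta * \sum_i `|v 0 i|.
    apply: le_trans (ler_sum _ (fun j _ => vle j)) _.
    by rewrite sumr_const card_ord -[_ *+ n]mulr_natl le_eqVlt; apply/orP; left; apply/eqP; ring.
  move=> H; have {H S0} : \sum_i `|v 0 i| = 0.
    apply/eqP; rewrite eq_le S0 andbT.
    by have := ler_wpM2r S0 neta; lra.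
  move=> /eqP; rewrite psumr_eq0// => /allP v0; apply/rowP => j; rewrite mxE.
  by apply/eqP; rewrite -normr_eq0; apply: v0; rewrite mem_index_enum.
exists (invmx A *m e); first by rewrite mulKVmx.
set w := invmx A *m e.
have wE j : w j 0 = e j 0 + \sum_i ((j == i)%:R - A j i) * w i 0.
  have -> : e = A *m w by rewrite mulKVmx.
  rewrite [(A *m w) j 0]mxE -big_split/=; under eq_bigr do rewrite -mulrDl addrC subrK.
  rewrite (bigD1 j)//= eqxx mul1r big1 ?addr0// => i.
  by rewrite eq_sym => /negbTE ->; rewrite mul0r.
have S0 : 0 <= \sum_i `|w i 0| by exact: sumr_ge0.
have : \sum_i `|w i 0| <= \sum_i `|e i 0| + n%:R * eta * \sum_i `|w i 0|.
  have -> : n%:R * eta * \sum_i `|w i 0| = \sum_(j < n) (eta * \sum_i `|w i 0|).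
    by rewrite sumr_const card_ord -[RHS]mulr_natl mulrA.
  rewrite -big_split/= ler_sum// => j _; rewrite {1}wE.
  rewrite (le_trans (ler_normD _ _))// lerD2l (le_trans (ler_norm_sum _ _ _))//.
  by rewrite mulr_sumr ler_sum// => i _; rewrite normrM ler_wpM2r// distrC.
by have := ler_wpM2r S0 neta; lra.
Qed.

Definition lagr s (a : 'I_s) : {poly R} :=
  \prod_(j < s | j != a) ((a%:R - j%:R)^-1 *: ('X - j%:R%:P)).

Lemma lagr_node s (a b : 'I_s) : (lagr a).[b%:R] = (a == b)%:R.
Proof.
rewrite /lagr horner_prod; have [<-|ab] := eqVneq a b.
  rewrite big1// => j ja; rewrite hornerZ hornerXsubC mulVf// subr_eq0 eqr_nat.
  by rewrite eq_sym.
by rewrite (bigD1 b) 1?eq_sym//= hornerZ hornerXsubC subrr mulr0 mul0r.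
Qed.

Lemma size_lagr s (a : 'I_s) : (size (lagr a) <= s)%N.
Proof.
case: s a => [[]//|s a].
rewrite /lagr (leq_trans (size_poly_prod_leq _ _))//.
rewrite leq_subLR; apply: (@leq_trans (\sum_(j < s.+1 | j != a) 2).+1).
  rewrite ltnS leq_sum// => j _.
  by rewrite (leq_trans (size_scale_leq _ _))// size_XsubC.
rewrite sum_nat_const muln2 -addnn -addSn addnC.
rewrite leq_add2l.
have -> : #|[pred j | j != a]| = s.
  transitivity #|predC1 a|; first exact: eq_card.
  by rewrite cardC1 card_ord.
by [].
Qed.

(** The difference of the two sides has size at most [s] and vanishes at the [s] nodes 0, ..., s -
    1. *)
Lemma lagr_interp s (p : {poly R}) (t : R) : (size p <= s)%N ->
  p.[t] = \sum_(a < s) p.[a%:R] * (lagr a).[t].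
Proof.
move=> ps; pose q := \sum_(a < s) p.[a%:R] *: lagr a.
have qE u : q.[u] = \sum_(a < s) p.[a%:R] * (lagr a).[u].
  by rewrite /q horner_sum; apply: eq_bigr => a _; rewrite hornerZ.
rewrite -qE; suff /eqP -> : p == q by [].
rewrite -subr_eq0; apply/eqP.
apply: (@roots_geq_poly_eq0 _ _ [seq (val a)%:R | a <- enum 'I_s]).
- apply/allP => _ /mapP[b _ ->]; rewrite rootE hornerD hornerN qE.
  rewrite (bigD1 b)//= lagr_node eqxx mulr1 big1 ?addr0 ?subrr// => a ab.
  by rewrite lagr_node (negbTE ab) mulr0.
- rewrite map_inj_uniq ?enum_uniq// => a b /eqP; rewrite eqr_nat => /eqP; exact: val_inj.
- rewrite size_map size_enum_ord (leq_trans (size_polyD _ _))// size_polyN geq_max ps/=.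
  apply: (leq_trans (size_sum _ _ _)); apply/bigmax_leqP => a _.
  by rewrite (leq_trans (size_scale_leq _ _))// size_lagr.
Qed.

Context {d : nat}.
Local Notation V := 'rV[R]_d.

Lemma monv_count (v : V) l : monv v l = \prod_i v ord0 i ^+ count_mem i l.
Proof.
rewrite /monv; elim: l => [|j l IH]; first by rewrite big_nil big1.
rewrite big_cons IH (bigD1 j)//= [RHS](bigD1 j)//= eqxx exprD expr1 -mulrA.
congr (_ * (_ * _)); apply: eq_bigr => i /negbTE ij.
by rewrite eq_sym ij.
Qed.

Variable s : nat.
Hypothesis s_gt0 : (0 < s)%N.
Local Notation B := {ffun 'I_d -> 'I_s}.

Definition lagrV (b : B) (v : V) : R := \prod_i (lagr (b i)).[v ord0 i].

Definition node (b : B) : V := \row_i (b i)%:R.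

Lemma lagrV_node b c : lagrV b (node c) = (b == c)%:R.
Proof.
rewrite /lagrV; under eq_bigr do rewrite mxE lagr_node.
have [->|bc] := eqVneq b c; first by rewrite big1// => i _; rewrite eqxx.
have [i ib] : exists i, b i != c i.
  apply/existsP; rewrite -negb_forall; apply: contra bc => /forallP H.
  by apply/eqP/ffunP => i; exact/eqP/H.
by rewrite (bigD1 i)//= (negbTE ib) mul0r.
Qed.

Lemma lagrV_continuous b : continuous (lagrV b).
Proof.
suff H (r : seq 'I_d) : continuous (fun v : V => \prod_(i <- r) (lagr (b i)).[v ord0 i]).
  exact: H.
elim: r => [|i r IH].
  rewrite (_ : (fun v => _) = cst 1); first exact: cst_continuous.
  by apply/funext => v; rewrite big_nil.
rewrite (_ : (fun v => _) = (fun v : V => (lagr (b i)).[v ord0 i] *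
    \prod_(j <- r) (lagr (b j)).[v ord0 j])); last first.
  by apply/funext => v; rewrite big_cons.
move=> v; apply: (continuousM _ (IH v)).
apply: (@continuous_comp _ _ _ (fun v : V => v ord0 i) (horner (lagr (b i)))).
  exact: coord_continuous.
exact: continuous_horner.
Qed.

Lemma lagrV_interp (p : 'I_d -> {poly R}) (v : V) : (forall i, (size (p i) <= s)%N) ->
  \prod_i (p i).[v ord0 i] = \sum_(b : B) (\prod_i (p i).[(b i)%:R]) * lagrV b v.
Proof.
move=> ps; under eq_bigr do rewrite (lagr_interp _ (ps _)).
rewrite bigA_distr_bigA /=; apply: eq_bigr => b _.
by rewrite big_split.
Qed.

(** Continuity at finitely many nodes gives a common radius. The tolerance times the number of nodes
    is 1/2, as [near_identity_solve] requires, and [eps < 1] keeps the perturbation below the grid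
    step. *)
Lemma lagrV_near : exists2 eps : R, 0 < eps < 1 & forall (b c : B) (v : V),
  (forall i, `|v ord0 i - (c i)%:R| <= eps) ->
  `|lagrV b v - (b == c)%:R| <= (2 * #|{: B}|%:R)^-1.
Proof.
have e0 : 0 < (2 * #|{: B}|%:R)^-1 :> R.
  rewrite invr_gt0 mulr_gt0// ltr0n; apply/card_gt0P; exists [ffun=> Ordinal s_gt0].
  by [].
have H (bc : B * B) : exists2 r : R, 0 < r & cube (node bc.2) r `<=`
    [set v | `|lagrV bc.1 (node bc.2) - lagrV bc.1 v| <= (2 * #|{: B}|%:R)^-1].
  apply/nbhs_cubeP.
  by have /cvgrPdist_le := @lagrV_continuous bc.1 (node bc.2); exact.
pose r := \big[Order.min/1]_bc (sval (cid2 (H bc))).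
have r0 : 0 < r.
  apply: (big_ind (fun t => 0 < t)) => //; first by move=> a b; rewrite lt_min => -> ->.
  by move=> bc _; case: cid2.
have r1 : r <= 1 by rewrite /r; elim/big_rec: _ => // bc t _ t1; rewrite ge_min t1 orbT.
have rle bc : r <= sval (cid2 (H bc)) by rewrite /r (bigD1 bc)//= ge_min lexx.
exists (r / 2); first by apply/andP; split; lra.
move=> b c v vc; rewrite -lagrV_node distrC.
have := rle (b, c); case: cid2 => /= u u0 ucube ru; apply: ucube => i.
by rewrite mxE (le_lt_trans (vc i))//; lra.
Qed.

(* Tensor Lagrange weights on the grid [x + u * b], corrected by inverting a
   matrix close to the identity. *)
Lemma weights_exist : exists2 eps : R, 0 < eps < 1 &
  forall (x : V) (u : R) (zz : B -> V), 0 < u ->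
  (forall b i, `|zz b ord0 i - (x ord0 i + u * (b i)%:R)| <= eps * u) ->
  exists w : B -> R, \sum_b `|w b| <= 2 /\
  forall y l, (size l < s)%N -> monv (y - x) l = \sum_b w b * monv (y - zz b) l.
Proof.
have [eps e01 Heps] := lagrV_near; exists eps => // x u zz u0 zzx.
pose zeta c : V := u^-1 *: (zz c - x).
pose n := #|{: B}|.
(* The rescaled nodes are within [eps] of the integer grid, so evaluating the Lagrange polynomials
   there gives almost the identity. As [x] is the grid point [b0], the right-hand side [e] is a unit
   vector and the weights sum to at most 2 in absolute value. *)
pose A : 'M[R]_n := \matrix_(i, j) lagrV (enum_val i) (zeta (enum_val j)).
pose b0 : B := [ffun=> Ordinal s_gt0].
pose e : 'cV[R]_n := \col_i (enum_val i == b0)%:R.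
have zetaE c i : `|zeta c ord0 i - (c i)%:R| <= eps.
  have := zzx c i; rewrite -ler_pdivrMr// => /(le_trans _); apply.
  rewrite -[X in _ / X]gtr0_norm// -normf_div !mxE le_eqVlt; apply/orP; left; apply/eqP.
  by congr (`|_|); field; exact: lt0r_neq0.
have [||w wE wle] := @near_identity_solve n A (2 * n%:R)^-1 e.
- move=> i j; rewrite mxE; have := Heps (enum_val i) (enum_val j) _ (zetaE _).
  by rewrite (inj_eq enum_val_inj).
- rewrite invfM mulrCA mulfV ?mulr1// pnatr_eq0 -lt0n.
  by apply/card_gt0P; exists b0.
exists (fun b => w (enum_rank b) 0); split.
  rewrite (reindex _ (onW_bij _ (enum_val_bij _))) /=.
  under eq_bigr do rewrite enum_valK.
  apply: (le_trans wle); rewrite (bigD1 (enum_rank b0))//= big1 ?addr0.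
    by rewrite mxE enum_rankK eqxx normr1 mulr1.
  move=> i ib; rewrite mxE (_ : (_ == _) = false) ?normr0//.
  by apply: contra_neqF ib => /eqP <-; rewrite enum_valK.
move=> y l ls.
(* As a function of the rescaled sampling point, the monomial is a product of one-variable
   polynomials of size at most [s]. Hence it is a combination of tensor Lagrange polynomials, and
   reproducing those is enough. *)
pose p i : {poly R} := ((y - x) ord0 i)%:P - u *: 'X.
pose P i := p i ^+ count_mem i l.
have Ps i : (size (P i) <= s)%N.
  rewrite (leq_trans (size_poly_exp_leq _ _))//.
  have : (size (p i) <= 2)%N.
    rewrite (leq_trans (size_polyD _ _))// geq_max size_polyN.
    by rewrite (leq_trans (size_polyC_leq1 _))// (leq_trans (size_scale_leq _ _))// size_polyX.
  case: (size (p i)) => [|[|[|k]]]//= _; rewrite ?mul0n ?mul1n//.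
  by rewrite (leq_ltn_trans _ ls)// count_size.
have PE v : monv (y - (x + u *: v)) l = \prod_i (P i).[v ord0 i].
  rewrite monv_count; apply: eq_bigr => i _; rewrite horner_exp; congr (_ ^+ _).
  by rewrite /p !hornerE /= !mxE; ring.
have zzE c : zz c = x + u *: zeta c.
  by rewrite /zeta scalerA mulfV ?lt0r_neq0// scale1r addrC subrK.
have z0 : x = x + u *: node b0.
  rewrite (_ : node b0 = 0) ?scaler0 ?addr0//.
  by apply/rowP => i; rewrite !mxE ffunE.
rewrite {1}z0 PE.
under [RHS]eq_bigr do rewrite zzE PE lagrV_interp// mulr_sumr.
rewrite exchange_big/= lagrV_interp//; apply: eq_bigr => b _.
under [RHS]eq_bigr do rewrite mulrCA.
rewrite -mulr_sumr; congr (_ * _); rewrite lagrV_node.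
have /colP/(_ (enum_rank b)) := wE; rewrite !mxE enum_rankK => <-.
rewrite [RHS](reindex _ (onW_bij _ (enum_val_bij _))) /=.
by apply: eq_bigr => i _; rewrite mxE enum_rankK enum_valK mulrC.
Qed.

End weights.

(** * Test functions *)

Section bump.
Context {R : realType}.

(* The derivatives of [exp (- 1 / x)] stay in this family. *)
Definition psi (p : {poly R}) (x : R) : R :=
  if 0 < x then p.[x^-1] * expR (- x^-1) else 0.

Lemma poly_growth (p : {poly R}) : exists2 C : R, 0 <= C &
  forall u, 1 <= u -> `|p.[u]| <= C * u ^+ size p.
Proof.
exists (\sum_(i < size p) `|p`_i|); first exact: sumr_ge0.
move=> u u1; rewrite horner_coef (le_trans (ler_norm_sum _ _ _))// mulr_suml.
apply: ler_sum => i _; rewrite normrM ler_wpM2l// ger0_norm ?exprn_ge0 ?(le_trans ler01)//.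
by rewrite ler_weXn2l// ltnW.
Qed.

(** With u = 1/x and n the size of p, exp u >= u^(n+2) / (n+2)! beats the growth u^n of p by a
    factor u^2. The quadratic bound is what forces the derivative at 0 to be 0. *)
Lemma psi_small (p : {poly R}) : exists2 K : R, 0 <= K &
  forall x, x <= 1 -> `|psi p x| <= K * x ^+ 2.
Proof.
have [C C0 HC] := poly_growth p; set n := size p in HC.
exists (C * n.+2`!%:R); first by rewrite mulr_ge0.
move=> x x1; rewrite /psi; case: ifPn => x0; last by rewrite normr0 mulr_ge0 ?sqr_ge0 ?mulr_ge0.
have u1 : 1 <= x^-1 by rewrite invf_ge1.
have u0 : 0 < x^-1 by rewrite invr_gt0.
rewrite normrM (ger0_norm (expR_ge0 _)) expRN.
have E : x^-1 ^+ n.+2 / n.+2`!%:R <= expR x^-1.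
  by have := expR_ge1Dxn n.+1 (ltW u0); apply: le_trans; rewrite lerDr.
have F0 : 0 < n.+2`!%:R :> R by rewrite ltr0n fact_gt0.
apply: (@le_trans _ _ (C * x^-1 ^+ n * (x^-1 ^+ n.+2 / n.+2`!%:R)^-1)).
  apply: ler_pM => //; first exact: HC.
  by rewrite lef_pV2// posrE ?expR_gt0// divr_gt0// exprn_gt0.
rewrite le_eqVlt; apply/orP; left; apply/eqP.
rewrite -addn2 exprD invfM invrK invfM -!exprVn !invrK.
rewrite exprVn; field; by rewrite expf_neq0 ?lt0r_neq0.
Qed.

Lemma is_derive_sqr_small (f : R -> R) (K x : R) : 0 <= K ->
  (\forall h \near (0 : R), `|f (h + x) - f x| <= K * h ^+ 2) -> is_derive x 1 f 0.
Proof.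
move=> K0 H.
have main : (h^-1 *: ((f \o shift x) (h *: (1 : R)) - f x)) @[h --> (0 : R)^'] --> (0 : R).
  apply/cvgrPdist_le => e e0.
  have e1 : 0 < e / (K + 1) by rewrite divr_gt0// ltr_wpDl.
  near=> h.
  have h0 : h != 0 by near: h; exact: nbhs_dnbhs_neq.
  have he : `|h| <= e / (K + 1) by near: h; exact: dnbhs0_le.
  have Hh : `|f (h + x) - f x| <= K * h ^+ 2 by near: h; exact: nbhs_dnbhs.
  rewrite sub0r normrN [_ *: 1]mulr1 normrM normfV ler_pdivrMl ?normr_gt0//.
  rewrite (le_trans Hh)// -real_normK ?num_real// expr2 mulrCA ler_wpM2l//.
  move: he; rewrite ler_pdivlMr ?ltr_wpDl// => he.
  by rewrite (le_trans _ he)// mulrC ler_wpM2l// lerDl.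
split; first by apply/cvg_ex; eexists; exact: main.
by apply: cvg_lim => //; exact: main.
Unshelve. all: by end_near. Qed.

(** By the chain rule, the derivative of p(1/x) exp(-1/x) is x^(-2) (p - p')(1/x) exp(-1/x). *)
Definition dpsi (p : {poly R}) : {poly R} := 'X^2 * (p - p^`()).

Lemma is_derive_psi (p : {poly R}) (x : R) : is_derive x 1 (psi p) (psi (dpsi p) x).
Proof.
have [x0|x0|->] := ltgtP x 0.
- have -> : psi (dpsi p) x = 0 by rewrite /psi ltNge (ltW x0).
  have D0 : is_derive x 1 (cst (0 : R)) (0 : R) by exact: is_derive_cst.
  apply: near_eq_is_derive D0.
  by near=> y; rewrite /psi ltNge (_ : y <= 0)//; apply: ltW; near: y; exact: lt_nbhsl.
- have x0' : x != 0 by exact: lt0r_neq0.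
  have Dinv := is_deriveV (x0' : id x != 0) (is_derive_id x (1 : R)).
  have D1 := is_derive1_comp (is_derive_poly p x^-1) Dinv.
  have DN : is_derive x 1 (fun y : R => - y^-1) (- (- x ^- 2)%:A) by exact: (is_deriveN Dinv).
  have D2 := @is_derive1_comp _ expR (fun y : R => - y^-1) x _ _ (is_derive_expR (- x^-1)) DN.
  have D := is_deriveM D1 D2.
  apply: (@is_derive_eq _ _ _ _ _ _ (_ : R)); first apply: near_eq_is_derive D.
    by near=> y; rewrite /psi (_ : 0 < y)//; near: y; exact: lt_nbhsr.
  rewrite /psi x0 /dpsi !hornerE /= -![_ *: _]/(_ * _).
  have x2 : x ^- 2 = x^-1 ^+ 2 by rewrite exprVn.
  by rewrite x2; ring.
- have -> : psi (dpsi p) 0 = 0 by rewrite /psi ltxx.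
  have [K K0 HK] := psi_small p; apply: (is_derive_sqr_small K0).
  near=> h; rewrite addr0 {2}/psi ltxx subr0; apply: HK.
  by apply: ltW; near: h; apply: lt_nbhsl; exact: ltr01.
Unshelve. all: by end_near. Qed.

Lemma psi1_ge0_le1 x : 0 <= psi 1 x <= 1.
Proof.
rewrite /psi; case: ifPn => x0; last by rewrite lexx ler01.
by rewrite hornerE mul1r expR_ge0 expR_le1 oppr_le0 invr_ge0 ltW.
Qed.

Lemma psi1_cvg (t : R) : (psi 1 (n.+1%:R * t) @[n --> \oo]) --> ((0 < t)%R%:R : R).
Proof.
have [t0|t0] := ltP 0 t; last first.
  apply: cvg_near_cst; apply: nearW => n; rewrite /psi ifF//.
  by apply/negbTE; rewrite -leNgt pmulr_rle0.
rewrite (_ : (fun n => _) = (fun n => expR (- (n.+1%:R^-1 * t^-1)))); last first.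
  by apply/funext => n; rewrite /psi pmulr_rgt0// t0 hornerE mul1r invfM.
rewrite -[X in _ --> X](_ : expR (- (0 * t^-1)) = 1); last by rewrite mul0r oppr0 expR0.
apply: (continuous_cvg _ (@continuous_expR _ _)).
by apply: cvgN; apply: cvgMl; exact: cvg_harmonic.
Qed.

Context {d : nat}.
Local Notation V := 'rV[R]_d.
Implicit Types f g h : V -> R.

(** Proofs of smoothness reduce to exhibiting a class of continuous functions that is stable under
    partial derivatives. *)
Lemma smooth_coind (P : (V -> R) -> Prop) :
  (forall f, P f -> continuous f /\
    forall i, (forall x, derivable f x (basis_vec i)) /\ P ('D_(basis_vec i) f)) ->
  forall f, P f -> smooth f.
Proof.
move=> HP f Pf l.
have Pl : P (iter_deriv l f) by elim: l => //= i l /HP[_ /(_ i)[]].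
have [cf df] := HP _ Pl; split => // x i; exact: (df i).1.
Qed.

(* Unlike the products alone, closed under differentiation. *)
Inductive product_sum : (V -> R) -> Prop :=
| product_sum1 f g : smooth f -> smooth g -> product_sum (fun x => f x * g x)
| product_sumD f g : product_sum f -> product_sum g -> product_sum (fun x => f x + g x).

Lemma smoothM f g : smooth f -> smooth g -> smooth (fun x => f x * g x).
Proof.
move=> sf sg; apply: (@smooth_coind product_sum); last exact: product_sum1.
move=> {f g sf sg} h; elim => [f g sf sg|f g _ [cf IHf] _ [cg IHg]]; split.
- by move=> x; apply: continuousM; exact: smooth_continuous.
- move=> i; have df x := (smooth_C1 sf i).1 x; have dg x := (smooth_C1 sg i).1 x.
  split; first by move=> x; exact: derivableM.
  rewrite (_ : 'D_(basis_vec i) _ = (fun x => f x * 'D_(basis_vec i) g x + g x * 'D_(basis_vec i) f x)).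
    apply: product_sumD; apply: product_sum1; [exact: sf| |exact: sg|].
      exact: (@smooth_iter_deriv R d [:: i] g sg).
    exact: (@smooth_iter_deriv R d [:: i] f sf).
  by apply/funext => x; rewrite deriveM.
- by move=> x; apply: continuousD; [exact: cf|exact: cg].
- move=> i; have [df Pf] := IHf i; have [dg Pg] := IHg i; split.
    by move=> x; exact: derivableD.
  rewrite (_ : 'D_(basis_vec i) _ = (fun x => 'D_(basis_vec i) f x + 'D_(basis_vec i) g x)).
    exact: product_sumD.
  by apply/funext => x; rewrite deriveD.
Qed.

Lemma smooth_cst (c : R) : smooth (cst c : V -> R).
Proof.
apply: (@smooth_coind (fun f => exists c, f = cst c)); last by exists c.
move=> _ [{}c ->]; split; first exact: cst_continuous.
move=> i; split; first by move=> x; exact: derivable_cst.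
by exists 0; apply/funext => x; exact: derive_cst.
Qed.

Lemma smooth_prod (T : Type) (r : seq T) (F : T -> V -> R) : (forall i, smooth (F i)) ->
  smooth (fun x => \prod_(i <- r) F i x).
Proof.
move=> sF; elim: r => [|i r IH].
  rewrite (_ : (fun x => _) = cst 1); first exact: smooth_cst.
  by apply/funext => x; rewrite big_nil.
rewrite (_ : (fun x => _) = (fun x => F i x * \prod_(j <- r) F j x)); first exact: smoothM.
by apply/funext => x; rewrite big_cons.
Qed.

Lemma is_derive_of_line (W : normedModType R) (f : W -> R) (x v : W) (df : R) :
  is_derive (0 : R) 1 (fun t : R => f (x + t *: v)) df -> is_derive x v f df.
Proof.
have E : (fun k : R => k^-1 *: (((fun t : R => f (x + t *: v)) \o shift 0) (k *: 1) -
    f (x + 0 *: v))) = (fun k : R => k^-1 *: ((f \o shift x) (k *: v) - f x)).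
  apply/funext => k /=; rewrite scale0r addr0; congr (_ *: (f _ - _)).
    by rewrite [k%:A]mulr1 addrC.
  by rewrite addr0.
move=> [D <-]; split; first by move: D; rewrite /derivable E.
by rewrite /derive E.
Qed.

Lemma smooth_psi (p : {poly R}) (i : 'I_d) (c e : R) :
  smooth (fun x : V => psi p (c * x ord0 i + e)).
Proof.
apply: (@smooth_coind (fun f => exists p c', f = fun x : V => c' * psi p (c * x ord0 i + e))); last first.
  by exists p, 1; apply/funext => x; rewrite mul1r.
move=> _ {p} [p [c' ->]].
have D x j : is_derive x (basis_vec j) (fun x : V => c' * psi p (c * x ord0 i + e))
   (c' * c * (i == j)%:R * psi (dpsi p) (c * x ord0 i + e)).
  apply: is_derive_of_line.
  pose L (t : R) := c * (x ord0 i + t * (i == j)%:R) + e.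
  have DL : is_derive (0 : R) 1 L (c * (i == j)%:R).
    have H := is_deriveZ (c * (i == j)%:R) (is_derive_id (0 : R) (1 : R)).
    have H2 := is_deriveD H (is_derive_cst (c * x ord0 i + e) (0 : R) (1 : R)).
    rewrite (_ : L = (c * (i == j)%:R \*: id + cst (c * x ord0 i + e))).
      by apply: (@is_derive_eq _ _ _ _ _ _ _ _ H2); rewrite addr0 [LHS]mulr1.
    by apply/funext => t; rewrite /L /= -[RHS]/(c * (i == j)%:R * t + (c * x ord0 i + e)); ring.
  have := is_deriveZ c' (is_derive1_comp (is_derive_psi p (L 0)) DL).
  rewrite (_ : _ \*: _ = (fun t => c' * psi p (c * (x + t *: basis_vec j) ord0 i + e))); last first.
    by apply/funext => t /=; rewrite /L !mxE eqxx.
  move=> H; apply: (@is_derive_eq _ _ _ _ _ _ _ _ H).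
  by rewrite /L mul0r addr0 -[_ *: _]/(_ * _); ring.
split.
  move=> x; apply: (@continuous_comp _ _ _ (fun x : V => x ord0 i) (fun t => c' * psi p (c * t + e))).
    exact: coord_continuous.
  apply: cvgM; first exact: cvg_cst.
  apply: (@continuous_comp _ _ _ (fun t => c * t + e) (psi p)).
    by apply: cvgD; [apply: cvgM; [exact: cvg_cst|exact: cvg_id]|exact: cvg_cst].
  by apply: differentiable_continuous; apply/derivable1_diffP; have [] := is_derive_psi p (c * x ord0 i + e).
move=> j; split; first by move=> x; have [] := D x j.
exists (dpsi p), (c' * c * (i == j)%:R); apply/funext => x.
by have [_] := D x j.
Qed.

(** Positive exactly on the open box and convergent to its indicator as [n] grows: a test function
    and an approximate indicator at once. *)
Definition bump n (a b : V) (x : V) : R :=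
  \prod_i (psi 1 (n.+1%:R * (x ord0 i - a ord0 i)) * psi 1 (n.+1%:R * (b ord0 i - x ord0 i))).

Definition box (a b : V) : set V := [set x | forall i, a ord0 i < x ord0 i < b ord0 i].

Lemma smooth_bump n a b : smooth (bump n a b).
Proof.
apply: smooth_prod => i; apply: smoothM.
  rewrite (_ : (fun x => _) = (fun x : V => psi 1 (n.+1%:R * x ord0 i + - (n.+1%:R * a ord0 i)))).
    exact: smooth_psi.
  by apply/funext => x; rewrite mulrBr.
rewrite (_ : (fun x => _) = (fun x : V => psi 1 (- n.+1%:R * x ord0 i + n.+1%:R * b ord0 i))).
  exact: smooth_psi.
by apply/funext => x; congr psi; ring.
Qed.

Lemma bump_ge0_le1 n a b x : 0 <= bump n a b x <= 1.
Proof.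
rewrite /bump; apply: (big_ind (fun t : R => 0 <= t <= 1)); first by rewrite ler01 lexx.
  by move=> s t /andP[s0 s1] /andP[t0 t1]; rewrite mulr_ge0//= mulr_ile1.
move=> i _; have /andP[s0 s1] := psi1_ge0_le1 (n.+1%:R * (x ord0 i - a ord0 i)).
have /andP[t0 t1] := psi1_ge0_le1 (n.+1%:R * (b ord0 i - x ord0 i)).
by rewrite mulr_ge0//= mulr_ile1.
Qed.

Lemma bump_out n a b x : ~ box a b x -> bump n a b x = 0.
Proof.
move=> nbx; have [i ni] : exists i, ~~ (a ord0 i < x ord0 i < b ord0 i).
  by apply/existsP; rewrite -negb_forall; apply/negP => /forallP.
rewrite /bump (bigD1 i)//=; apply/eqP; rewrite mulf_eq0; apply/orP; left.
rewrite mulf_eq0; move: ni; rewrite negb_and -!leNgt => /orP[] le.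
  by apply/orP; left; rewrite /psi ltNge pmulr_rle0// subr_le0 le.
by apply/orP; right; rewrite /psi ltNge pmulr_rle0// subr_le0 le.
Qed.

Lemma bump_cvg a b x : (bump n a b x @[n --> \oo]) --> (\1_(box a b) x : R).
Proof.
have E : \prod_i ((0 < x ord0 i - a ord0 i)%R%:R * (0 < b ord0 i - x ord0 i)%R%:R) = \1_(box a b) x :> R.
  rewrite indicE; have [xb|xb] := boolP (x \in box a b).
    rewrite big1// => i _; move: xb; rewrite inE => /(_ i) /andP[ax bx].
    by rewrite !subr_gt0 ax bx mulr1.
  have [i ni] : exists i, ~~ (a ord0 i < x ord0 i < b ord0 i).
    apply/existsP; rewrite -negb_forall; apply: contra xb => /forallP H.
    by rewrite inE => i; exact: H.
  rewrite (bigD1 i)//= !subr_gt0; move: ni; rewrite negb_and => /orP[] /negbTE ->.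
    by rewrite !mul0r.
  by rewrite mulr0 mul0r.
rewrite -E; rewrite /bump.
suff H (r : seq 'I_d) : ((\prod_(i <- r) (psi 1 (n.+1%:R * (x ord0 i - a ord0 i)) * psi 1 (n.+1%:R * (b ord0 i - x ord0 i)))) @[n --> \oo]) --> (\prod_(i <- r) ((0 < x ord0 i - a ord0 i)%R%:R * (0 < b ord0 i - x ord0 i)%R%:R) : R).
  exact: H.
elim: r => [|i r IH].
  by rewrite big_nil; under eq_fun do rewrite big_nil; exact: cvg_cst.
rewrite big_cons; under eq_fun do rewrite big_cons.
by apply: cvgM => //; apply: cvgM; exact: psi1_cvg.
Qed.

End bump.

(** * Integrals of test functions *)

Section integration.
Context {R : realType} {d : nat}.
Local Notation V := 'rV[R]_d.
Local Notation mu := (lebesgue_rV d : {sigma_finite_measure set V -> \bar R}).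
Implicit Types (A U : set V) (f phi chi : V -> R) (x : V).

Lemma derive_eq0_on U f (v : V) : open U -> {in U, f =1 cst 0} -> {in U, 'D_v f =1 cst 0}.
Proof.
move=> oU f0 x xU; rewrite (near_eq_derive (g := cst 0)); first exact: derive_cst.
have : nbhs x U by move: oU; rewrite openE; apply; rewrite inE in xU.
by apply: filterS => y Uy; apply: f0; rewrite inE.
Qed.

Definition supp f := closure [set x | f x != 0].

Lemma supp_out f x : ~ supp f x -> f x = 0.
Proof. by move=> nx; apply: contra_notP nx => /eqP fx; exact: subset_closure. Qed.

Lemma supp_sub f g : (forall U, open U -> {in U, f =1 cst 0} -> {in U, g =1 cst 0}) ->
  supp g `<=` supp f.
Proof.
move=> fg; have /closure_id -> : closed (supp f) by exact: closed_closure.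
apply: closure_subset => x /= gx; apply: contrapT => nx.
move/eqP: gx; apply; apply: (fg (~` supp f)).
- by apply: closed_openC; exact: closed_closure.
- by move=> y; rewrite inE => /supp_out.
- by rewrite inE.
Qed.

Lemma test_sub A f g : test A f -> smooth g -> supp g `<=` supp f -> test A g.
Proof.
move=> [_ cf fA] sg gf; split => //; last exact: subset_trans fA.
by apply: subclosed_compact cf gf; exact: closed_closure.
Qed.

Lemma test_iter_deriv A l f : test A f -> test A (iter_deriv l f).
Proof.
move=> tf; have [sf _ _] := tf; apply: (test_sub tf); first exact: smooth_iter_deriv.
apply: supp_sub => U oU f0; elim: l => //= i l IH; exact: derive_eq0_on.
Qed.

Lemma testM A f g : test A f -> smooth g -> test A (fun x => f x * g x).
Proof.
move=> tf sg; have [sf _ _] := tf; apply: (test_sub tf); first exact: smoothM.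
by apply: supp_sub => U oU f0 x xU /=; rewrite f0//= mul0r.
Qed.

Lemma testZ A f c : test A f -> test A (fun x => c * f x).
Proof.
move=> tf; rewrite (_ : (fun x => _) = (fun x => f x * cst c x)); last first.
  by apply/funext => x /=; rewrite mulrC.
by apply: testM => //; exact: smooth_cst.
Qed.

Lemma test_out A f x : test A f -> ~ A x -> f x = 0.
Proof. by move=> [_ _ fA] nx; apply: supp_out => /fA. Qed.

Lemma cube_bounded (S : set V) : bounded_set S -> exists2 r : R, 0 < r & S `<=` cube 0 r.
Proof.
move=> [M [_ HM]]; exists (`|M| + 2); first by rewrite ltr_wpDl.
move=> x Sx i; have := HM (`|M| + 1) _ x Sx; rewrite mxE subr0 => H.
have {}H : `|x| <= `|M| + 1 by apply: H; rewrite ltr_pwDr// ler_norm.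
apply: le_lt_trans (_ : `|M| + 1 < _); last by rewrite ltrD2l ltr1n.
apply: le_trans H.
by rewrite [leRHS]mx_normrE (le_trans _ (le_bigmax _ _ (ord0, i)))//.
Qed.

Lemma test_cube A f : test A f -> exists2 r : R, 0 < r & forall x, ~ cube 0 r x -> f x = 0.
Proof.
move=> [_ /compact_bounded/cube_bounded[r r0 rf] _]; exists r => // x nx.
by apply: supp_out => /rf.
Qed.

Lemma continuous_bounded_cube f r : continuous f ->
  exists2 M : R, 0 <= M & forall x, cube 0 r x -> `|f x| <= M.
Proof.
move=> cf.
pose K := [set x : V | forall i, `[- r, r]%classic (x ord0 i)].
have cK : compact K by apply: (@rV_compact _ _ (fun=> `[- r, r]%classic)) => i; exact: segment_compact.
have cfK : compact (f @` K).
  by apply: continuous_compact => //; exact: continuous_subspaceT.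
have [M [_ HM]] := compact_bounded cfK.
exists (`|M| + 1); first by rewrite addr_ge0.
move=> x xr; apply: (HM (`|M| + 1)); first by rewrite ltr_pwDr// ler_norm.
exists x => // i; have := xr i; rewrite mxE subr0 /= in_itv/= ltr_norml => /andP[? ?].
by rewrite !ltW.
Qed.

Lemma integrable_cube f r : continuous f -> 0 < r ->
  mu.-integrable (cube 0 r) (EFin \o f).
Proof.
move=> cf r0; apply: measurable_bounded_integrable; first exact: measurable_cube.
- by rewrite [X in (X < _)%E]lebesgue_cube ?ltry// ltW.
- by apply: measurable_funTS; exact: continuous_measurable_rV.
- have [M _ HM] := continuous_bounded_cube r cf; exists M; split; first exact: num_real.
  by move=> M' MM' x xr; rewrite /= (le_trans (HM _ xr))// ltW.
Qed.

Lemma integrable_compact f r : continuous f -> 0 < r -> (forall x, ~ cube 0 r x -> f x = 0) ->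
  mu.-integrable setT (EFin \o f).
Proof.
move=> cf r0 f0; have := integrable_cube cf r0.
rewrite integrable_mkcond; last exact: measurable_cube.
congr (is_true (mu.-integrable _ _)); apply/funext => x; rewrite patchE /=.
by case: ifPn => // /negP; rewrite inE => /f0 ->.
Qed.

Lemma integrable_test A f : test A f -> mu.-integrable setT (EFin \o f).
Proof.
move=> tf; have [r r0 fr] := test_cube tf; have [sf _ _] := tf.
apply: integrable_compact r0 fr; exact: smooth_continuous.
Qed.

Lemma integral_shift (f : V -> \bar R) (h : V) : measurable_fun setT f ->
  (\int[mu]_x f (h + x)%R = \int[mu]_x f x)%E.
Proof.
move=> mf.
have ge0 (g : V -> \bar R) : measurable_fun setT g -> (forall x, 0 <= g x)%E ->
    (\int[mu]_x g (h + x)%R = \int[mu]_x g x)%E.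
  move=> mg g0; rewrite -(ge0_integral_affine h ltr01 mg g0) expr1n mul1e.
  by apply: eq_integral => x _; rewrite scale1r.
rewrite integralE [RHS]integralE; congr (_ - _)%E.
  by rewrite -[RHS](ge0 _ (measurable_funepos mf) (funepos_ge0 f)); apply: eq_integral => x _; rewrite !funeposE.
by rewrite -[RHS](ge0 _ (measurable_funeneg mf) (funeneg_ge0 f)); apply: eq_integral => x _; rewrite !funenegE.
Qed.

(** The difference quotients have integral 0 by translation invariance, and they converge to the
    partial derivative under a common bound supplied by the mean value theorem. *)
Lemma integral_partial A f i : test A f -> \int[mu]_x ('D_(basis_vec i) f x) = 0.
Proof.
move=> tf; have [sf _ _] := tf.
have cf := smooth_continuous sf.
have cD := @smooth_iter_continuous R d [:: i] f sf.
have [r r0 fr] := test_cube tf.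
(* Increments have length at most 1: the quotients vanish off the cube of radius r + 1, and the
   intermediate point moves by at most another 1. *)
have [M M0 HM] := continuous_bounded_cube (r + 2) cD.
pose e (n : nat) : V := n.+1%:R^-1 *: basis_vec i.
pose g n x : R := n.+1%:R * (f (e n + x) - f x).
have e1 n j : `|e n ord0 j| <= 1.
  rewrite !mxE eqxx /= normrM ger0_norm ?invr_ge0// mulr_ile1//.
    by rewrite invf_le1 ?ler1n.
  by case: eqP => _; rewrite ?normr1 ?normr0.
have mf : measurable_fun setT f by exact: continuous_measurable_rV.
have mfe n : measurable_fun setT (fun x => f (e n + x)).
  apply: (measurableT_comp mf); apply: measurable_rowP => j.
  by under eq_fun do rewrite mxE; apply: measurable_funD => //; exact: measurable_coor.
have If := integrable_test tf.
have Ife n : mu.-integrable setT (EFin \o (fun x => f (e n + x))).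
  have /integrableP[_ If2] := If.
  apply/integrableP; split; first exact/measurable_EFinP.
  by rewrite (integral_shift (f := fun x => `|(f x)%:E|%E))//; apply: measurableT_comp => //; exact/measurable_EFinP.
have Ig n : (\int[mu]_x (g n x)%:E = 0)%E.
  under eq_integral do rewrite EFinM EFinB.
  have Isub : mu.-integrable setT (fun x => (f (e n + x))%:E - (f x)%:E)%E by exact: (integrableB _ (Ife n) If).
  rewrite (integralZl measurableT Isub).
  have -> : (\int[mu]_x ((f (e n + x))%:E - (f x)%:E) =
     \int[mu]_x (f (e n + x))%:E - \int[mu]_x (f x)%:E)%E by exact: (integralB measurableT (Ife n) If).
  rewrite (integral_shift (f := EFin \o f)); last exact/measurable_EFinP.
  by rewrite subee ?mule0//; exact: (integrable_fin_num measurableT If).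
have gout n x : ~ cube 0 (r + 1) x -> g n x = 0.
  move=> nx; have nxr : ~ cube 0 r x.
    by move=> xr; apply: nx => j; rewrite (lt_trans (xr j))// ltrDl.
  rewrite /g (fr x nxr) (fr (e n + x)) ?subrr ?mulr0// => xr; apply: nx => j.
  have := xr j; have := e1 n j; rewrite !mxE !subr0; set a := (_ * _); set b := x _ _.
  by move=> a1 abr; rewrite -(addKr a b) (le_lt_trans (ler_normD _ _))// normrN; lra.
have gE n x : exists2 c : R, `|c| <= n.+1%:R^-1 & g n x = 'D_(basis_vec i) f (x + c *: basis_vec i).
  have [] := @MVT_dist R (fun t => f (x + t *: basis_vec i))
      (fun t => 'D_(basis_vec i) f (x + t *: basis_vec i)) 0 n.+1%:R^-1.
    by move=> t; apply: is_derive_line; exact: (smooth_C1 sf i).1.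
  move=> c; rewrite !subr0 scale0r addr0 [`|_^-1|]ger0_norm ?invr_ge0// => cn E; exists c => //.
  by rewrite /g /e (addrC _ x) E mulrCA mulfV ?mulr1// pnatr_eq0.
have cube_add n x c k : cube 0 k x -> `|c| <= n.+1%:R^-1 -> cube 0 (k + 1) (x + c *: basis_vec i).
  move=> xk cn j; have := xk j; rewrite !mxE eqxx /= !subr0 => xk'.
  rewrite (le_lt_trans (ler_normD _ _))// ltr_leD// normrM.
  rewrite (le_trans (ler_wpM2r _ cn))// mulr_ile1 ?invr_ge0// ?invf_le1 ?ler1n//.
  by case: eqP => _; rewrite ?normr1 ?normr0.
have gM n x : cube 0 (r + 1) x -> `|g n x| <= M.
  move=> xr; have [c cn ->] := gE n x; apply: HM.
  by have := cube_add n x c _ xr cn; rewrite -addrA.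
have glim x : (g n x @[n --> \oo]) --> 'D_(basis_vec i) f x.
  apply/cvgrPdist_le => eps eps0.
  have /cvgrPdist_le/(_ _ eps0)/nbhs_cubeP[u u0 Hu] := cD x.
  near=> n; have [c cn ->] := gE n x; apply: Hu => j.
  rewrite !mxE eqxx /= addrAC subrr add0r normrM.
  apply: (@le_lt_trans _ _ n.+1%:R^-1).
    rewrite (le_trans (ler_wpM2r _ cn))// ler_piMr ?invr_ge0//.
    by case: eqP => _; rewrite ?normr1 ?normr0.
  near: n; apply: (cvgr_lt (0 : R)) => //; exact: cvg_harmonic.
have mg n : measurable_fun setT (g n).
  by apply: measurable_funM => //; exact: measurable_funB.
have mc := measurable_cube (0 : V) (r + 1).
have [||||| _ _ lim] := @dominated_convergence _ _ _ mu setT measurableT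
   (fun n x => (g n x)%:E) (fun x => ('D_(basis_vec i) f x)%:E) ((EFin \o cst M) \_ (cube 0 (r + 1))).
- by move=> n; exact/measurable_EFinP.
- by apply/measurable_EFinP; exact: continuous_measurable_rV.
- by apply: aeW => x _; apply: cvg_EFin; [exact: nearW|exact: glim].
- rewrite -integrable_mkcond//; apply: integrable_cube; first exact: cst_continuous.
  by rewrite ltr_wpDr.
- apply: aeW => x n _; rewrite patchE; case: ifPn => xr.
    by rewrite /= lee_fin gM//; move: xr; rewrite inE.
  rewrite gout; last by move=> xr'; move/negP: xr; apply; rewrite inE.
  by rewrite abse0.
rewrite /Rintegral -[X in fine X](cvg_lim _ lim)//.
rewrite (_ : (fun n => _) = cst 0%E); last by apply/funext => n; exact: Ig.
by rewrite lim_cst.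
Unshelve. all: by end_near. Qed.

End integration.

(** * Fundamental lemma of the calculus of variations *)

Section density.
Local Open Scope ereal_scope.
Context {disp} {T : measurableType disp} {R : realType}.
Variables (m : {measure set T -> \bar R}) (f : T -> \bar R).
Hypotheses (mf : measurable_fun setT f) (f0 : forall x, 0 <= f x).

Definition density (A : set T) : \bar R := \int[m]_(x in A) f x.

Let density0 : density set0 = 0. Proof. exact: integral_set0. Qed.

Let density_ge0 A : 0 <= density A. Proof. exact: integral_ge0. Qed.

Let density_additive : semi_sigma_additive density.
Proof. exact: semi_sigma_additive_nng_induced. Qed.

HB.instance Definition _ := isMeasure.Build _ _ _
  density density0 density_ge0 density_additive.

(** Turns indefinite integrals into measures, so that they can be compared by uniqueness on a
    generating family. *)
Lemma density_measure : exists nu : {measure set T -> \bar R},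
  forall A, nu A = \int[m]_(x in A) f x.
Proof. by exists density. Qed.

End density.

Section fundamental_lemma.
Context {R : realType} {d : nat}.
Local Notation V := 'rV[R]_d.
Local Notation mu := (lebesgue_rV d : {sigma_finite_measure set V -> \bar R}).
Implicit Types (A U : set V) (f g u phi chi : V -> R) (x a b : V).

Lemma boxI a b a' b' : box a b `&` box a' b' =
  box (\row_i Num.max (a ord0 i) (a' ord0 i)) (\row_i Num.min (b ord0 i) (b' ord0 i)).
Proof.
apply/seteqP; split => [x [xb xb'] i|x xb].
  have /andP[? ?] := xb i; have /andP[? ?] := xb' i.
  by rewrite !mxE gt_max lt_min; apply/andP; split; apply/andP.
by split => i; have := xb i; rewrite !mxE gt_max lt_min => /andP[/andP[? ?] /andP[? ?]]; apply/andP.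
Qed.

Lemma cube_box (c : V) (r : R) : cube c r = box (c - const_mx r) (c + const_mx r).
Proof. by apply/seteqP; split => x xc i; have := xc i; rewrite !mxE ltr_distl. Qed.

Lemma measurable_boxes : @measurable _ V = <<s [set X | exists a b, X = box a b] >>.
Proof.
set G := [set X | _]; apply/seteqP; split; last first.
  apply: smallest_sub; first exact: sigma_algebra_measurable.
  move=> _ [a [b ->]]; apply: (measurable_box (A := fun i => `]a ord0 i, b ord0 i[%classic)) => i.
  exact: measurable_itv.
have open_G (U : set V) : open U -> <<s G >> U.
  move=> /open_bigcup_cube ->.
  apply: (@countable_bigcupT_measurable _ (g_sigma_algebraType G)); first exact: countableP.
  move=> q; case: ifP => _; last exact: (@measurable0 _ (g_sigma_algebraType G)).
  by apply: sub_sigma_algebra; rewrite cube_box; eexists; eexists.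
have Gcoor i : @measurable_fun _ _ (g_sigma_algebraType G) (measurableTypeR R) setT
    (fun x : V => x ord0 i).
  apply: (measurability _ (@RGenOInfty.measurableE R)).
  move=> _ [_ [t ->]] <-; rewrite setTI; apply: open_G.
  apply: open_comp; last exact: rray_open.
  by move=> x _; exact: coord_continuous.
apply: smallest_sub; first exact: smallest_sigma_algebra.
move=> B; rewrite -bigcup_seq/= => -[i _ [Y mY <-]].
exact: Gcoor.
Qed.

(** Boxes are stable under intersection and generate the measurable sets. The finite integral of [f]
    makes its measure finite on the exhausting boxes. *)
Lemma integral_boxes_eq (f g : V -> \bar R) : measurable_fun setT f -> measurable_fun setT g ->
  (forall x, 0 <= f x)%E -> (forall x, 0 <= g x)%E ->
  (\int[mu]_x f x < +oo)%E ->
  (forall a b, \int[mu]_(x in box a b) f x = \int[mu]_(x in box a b) g x)%E ->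
  forall E, measurable E -> (\int[mu]_(x in E) f x = \int[mu]_(x in E) g x)%E.
Proof.
move=> mf mg f0 g0 foo fg E mE.
have [n1 n1E] := density_measure mu mf f0; have [n2 n2E] := density_measure mu mg g0.
rewrite -n1E -n2E.
apply: (measure_unique [set X | exists a b, X = box a b]
  (fun n => box (const_mx (- n%:R)) (const_mx n%:R))) => //.
- exact: measurable_boxes.
- by move=> _ _ [a [b ->]] [a' [b' ->]]; rewrite boxI; eexists; eexists.
- by move=> n; eexists; eexists.
- rewrite -subTset => x _.
  have [r r0 xr] := cube_bounded (compact_bounded (@compact_set1 V (x : V))).
  have {}xr := xr x erefl.
  exists (Num.truncn r).+1 => // i; have := xr i; rewrite !mxE subr0 ltr_norml.
  have := truncnS_gt r; lra.
- by move=> _ [a [b ->]]; rewrite n1E n2E.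
- move=> n; rewrite n1E; apply: le_lt_trans foo.
  apply: ge0_subset_integral => //.
  apply: (measurable_box (A := fun i => `](const_mx (- n%:R) : V) ord0 i, (const_mx n%:R : V) ord0 i[%classic)) => i.
  exact: measurable_itv.
Qed.

Lemma L2_integrableM A u v : measurable A -> L2 A u -> L2 A v ->
  mu.-integrable A (EFin \o (fun x => u x * v x)).
Proof.
move=> mA [mu_ Iu] [mv Iv].
have I : mu.-integrable A (EFin \o (fun x => u x ^+ 2 + v x ^+ 2)).
  by have := integrableD mA Iu Iv; congr (is_true (mu.-integrable _ _)).
apply: le_integrable I => //.
  by apply/measurable_EFinP; exact: measurable_funM.
move=> x _; rewrite lee_fin normrM [leRHS]ger0_norm ?addr_ge0 ?sqr_ge0//.
rewrite -[u x ^+ 2]real_normK ?num_real// -[v x ^+ 2]real_normK ?num_real//.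
have := normr_ge0 (u x); have := normr_ge0 (v x); nra.
Qed.

Lemma L2_integrable A C g : measurable A -> measurable C -> C `<=` A ->
  (mu C < +oo)%E -> L2 A g -> mu.-integrable C (EFin \o g).
Proof.
move=> mA mC CA Cfin [mg Ig2].
have Ig2C := integrableS mA mC CA Ig2.
have I1 : mu.-integrable C (EFin \o cst (1 : R)).
  apply: measurable_bounded_integrable => //.
  by exists 1; split; [exact: num_real|move=> M M1 x _; rewrite /= normr1 ltW].
have I := integrableD mC I1 Ig2C.
apply: le_integrable I => //; first by apply/measurable_EFinP; exact: measurable_funS mg.
move=> x _; rewrite lee_fin [leRHS]ger0_norm ?addr_ge0 ?sqr_ge0//=.
rewrite -[g x ^+ 2]real_normK ?num_real//; have := normr_ge0 (g x); nra.
Qed.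

Lemma L2D A u v (c : R) : measurable A -> L2 A u -> L2 A v -> L2 A (fun x => c * u x + v x).
Proof.
move=> mA Lu Lv; have [mu_ Iu] := Lu; have [mv Iv] := Lv.
split; first by apply: measurable_funD => //; exact: measurable_funM.
have I1 := integrableZl mA (c ^+ 2) Iu.
have I2 := integrableZl mA (2 * c) (L2_integrableM mA Lu Lv).
have := integrableD mA (integrableD mA I1 I2) Iv.
congr (is_true (mu.-integrable _ _)); apply/funext => x /=.
by rewrite -!EFinM -!EFinD; congr EFin; ring.
Qed.

Lemma L2_test A phi : measurable A -> test A phi -> L2 A phi.
Proof.
move=> mA tphi; have [sphi _ _] := tphi; split.
  by apply: measurable_funTS; apply: continuous_measurable_rV; exact: smooth_continuous.
apply: (integrableS measurableT) => //.
rewrite (_ : (fun x => _) = (fun x => phi x * phi x)); last by apply/funext => x; rewrite expr2.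
exact: integrable_test (testM tphi sphi).
Qed.

Lemma supp_bump n a b : supp (bump n a b) `<=` [set x : V | forall i, a ord0 i <= x ord0 i <= b ord0 i].
Proof.
rewrite /supp; set C := [set x : V | forall i, _ <= _ <= _].
have cC : closed C.
  rewrite (_ : C = \bigcap_(i in setT) ((fun x : V => x ord0 i) @^-1` `[a ord0 i, b ord0 i]%classic)).
    apply: closed_bigI => i _; apply: closed_comp; last exact: interval_closed.
    by move=> x _; exact: coord_continuous.
  by apply/seteqP; split => [x xC i _|x xC i]; [rewrite /= in_itv/=; exact: xC|have := xC i I; rewrite /= in_itv].
rewrite -/C [X in _ `<=` X](closure_id C).1//; apply: closure_subset => x /= bx i.
apply: contrapT => nx; move/eqP: bx; apply; apply: bump_out => /(_ i) /andP[ax xb].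
by apply: nx; rewrite !ltW.
Qed.

Lemma test_bump A n a b : (forall x, (forall i, a ord0 i <= x ord0 i <= b ord0 i) -> A x) ->
  test A (bump n a b).
Proof.
move=> abA; split.
- exact: smooth_bump.
- apply: (subclosed_compact _ _ (@supp_bump n a b)); first exact: closed_closure.
  rewrite (_ : [set x : V | _] = [set x : V | forall i, `[a ord0 i, b ord0 i]%classic (x ord0 i)]); last first.
    by apply/seteqP; split => x H i; have := H i; rewrite /= in_itv.
  by apply: (@rV_compact _ _ (fun i => `[a ord0 i, b ord0 i]%classic)) => i; exact: segment_compact.
- by move=> x /supp_bump; exact: abA.
Qed.

Lemma measurable_box_set a b : measurable (box a b).
Proof.
apply: (measurable_box (A := fun i => `]a ord0 i, b ord0 i[%classic)) => i.
exact: measurable_itv.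
Qed.

(** The closed box stays inside the doubled cube, so its bumps are test functions on [A]. They
    converge to the indicator of the box, and |g| on the cube dominates. *)
Lemma test_orth_box A g a b (c : V) (r : R) : open A -> L2 A g ->
  (forall phi, test A phi -> Rintegral mu A (fun x => g x * phi x) = 0) ->
  0 < r -> cube c (2 * r) `<=` A -> box a b `<=` cube c r ->
  (\int[mu]_(x in box a b) (g x)%:E = 0)%E.
Proof.
move=> oA Lg g0 r0 cA ab.
have mA := open_measurable_rV oA.
have mC := measurable_cube c r.
have CA : cube c r `<=` A.
  by move=> x xr; apply: cA => i; rewrite (lt_trans (xr i))//; lra.
have mab := measurable_box_set a b.
have Cfin : (mu (cube c r) < +oo)%E by rewrite [X in (X < _)%E]lebesgue_cube ?ltry// ltW.
have [mg Ig2] := Lg.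
have IgC : mu.-integrable (cube c r) (EFin \o g) by exact: L2_integrable Lg.
have [[x0 x0ab]|nab] := pselect (exists x, box a b x); last first.
  rewrite (_ : box a b = set0) ?integral_set0//.
  by rewrite -subset0 => x xab; apply: nab; exists x.
have tb n : test A (bump n a b).
  apply: test_bump => x xab; apply: cA => i.
  (* Pushing one coordinate of the point [x0] towards a side of the box would leave the cube if that
     side lay beyond it. An empty box, whose sides could be anywhere, is already excluded. *)
  have abr : c ord0 i - r <= a ord0 i /\ b ord0 i <= c ord0 i + r.
    have key (t : R) : a ord0 i < t < b ord0 i -> `|t - c ord0 i| < r.
      move=> tab; have : box a b (\row_j if j == i then t else x0 ord0 j).
        by move=> j; rewrite mxE; case: eqP => [->|_] //; exact: x0ab.
      by move=> /ab /(_ i); rewrite mxE eqxx.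
    have /andP[xa xb] := x0ab i; split; rewrite leNgt; apply/negP => H.
      have := key (Num.min (x0 ord0 i) ((a ord0 i + (c ord0 i - r)) / 2)).
      rewrite lt_min xa gt_min xb/= !andbT.
      have h1 : a ord0 i < (a ord0 i + (c ord0 i - r)) / 2 by lra.
      move=> /(_ h1); rewrite ltr_distl lt_min => /andP[/andP[_ ?] _]; lra.
    have := key (Num.max (x0 ord0 i) ((b ord0 i + (c ord0 i + r)) / 2)).
    rewrite gt_max xb lt_max xa/=.
    have h1 : (b ord0 i + (c ord0 i + r)) / 2 < b ord0 i by lra.
    move=> /(_ h1); rewrite ltr_distl gt_max => /andP[_ /andP[_ ?]]; lra.
  have /andP[? ?] := xab i; rewrite ltr_distl; lra.
have mbump n : measurable_fun setT (bump n a b).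
  by apply: continuous_measurable_rV; apply: smooth_continuous; exact: smooth_bump.
have E n : (\int[mu]_(x in A) (g x * bump n a b x)%:E = 0)%E.
  have := g0 _ (tb n); rewrite /Rintegral => H.
  have I := L2_integrableM mA Lg (L2_test mA (tb n)).
  by rewrite -[LHS]fineK ?H//; exact: integrable_fin_num.
have [||||| _ _ lim] := @dominated_convergence _ _ _ mu A mA
   (fun n x => (g x * bump n a b x)%:E) (fun x => (g x * \1_(box a b) x)%:E)
   ((abse \o (EFin \o g)) \_ (cube c r)).
- by move=> n; apply/measurable_EFinP; apply: measurable_funM => //; exact: measurable_funTS.
- apply/measurable_EFinP; by apply: measurable_funM.
- apply: aeW => x _; apply: cvg_EFin; first exact: nearW.
  by apply: cvgMr; exact: bump_cvg.
- apply: (integrableS measurableT) => //; rewrite -integrable_mkcond//.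
  exact: integrable_abse.
- apply: aeW => x n _; rewrite patchE; case: ifPn => xC.
    have /andP[b0 b1] := bump_ge0_le1 n a b x.
    by rewrite /= lee_fin normrM ler_piMr// ger0_norm.
  rewrite bump_out ?mulr0 ?abse0// => xab; move/negP: xC; apply; rewrite inE; exact: ab.
have L0 : (\int[mu]_(x in A) (g x * \1_(box a b) x)%:E = 0)%E.
  rewrite -(cvg_lim _ lim)// (_ : (fun n => _) = cst 0%E); last by apply/funext => n; exact: E.
  by rewrite lim_cst.
rewrite -[RHS]L0 integral_mkcond [RHS]integral_mkcond; apply: eq_integral => x _.
rewrite !patchE indicE; case: ifPn => xab; last by rewrite mulr0; case: ifP.
by rewrite mulr1 ifT//; move: xab; rewrite !inE => /ab; exact: CA.
Qed.

(** An open set is a countable union of cubes whose doubles lie in it, so it is enough that [g]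
    vanishes almost everywhere on each of them. *)
Lemma fundamental_lemma A g : open A -> L2 A g ->
  (forall phi, test A phi -> Rintegral mu A (fun x => g x * phi x) = 0) ->
  ae_eq mu A g (cst 0).
Proof.
move=> oA Lg g0; have mA := open_measurable_rV oA; have [mg _] := Lg.
have cubeq (c : V) (r : R) : 0 < r -> cube c (2 * r) `<=` A -> ae_eq mu (cube c r) g (cst 0).
  move=> r0 cA.
  have mC := measurable_cube c r.
  have CA : cube c r `<=` A.
    by move=> x xr; apply: cA => i; rewrite (lt_trans (xr i))//; lra.
  have mgC : measurable_fun (cube c r) g by exact: measurable_funS mg.
  have Cfin : (mu (cube c r) < +oo)%E by rewrite [X in (X < _)%E]lebesgue_cube ?ltry// ltW.
  have IgC : mu.-integrable (cube c r) (EFin \o g) by exact: L2_integrable Lg.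
  pose h : V -> \bar R := (EFin \o g) \_ (cube c r).
  have Ih : mu.-integrable setT h by rewrite -integrable_mkcond.
  have mh : measurable_fun setT h by case/integrableP: Ih.
  have IhE E : measurable E -> mu.-integrable E h by move=> mE; exact: (integrableS measurableT).
  have fin E : measurable E -> (\int[mu]_(x in E) h^\- x)%E \is a fin_num.
    move=> mE; apply: integrable_fin_num => //; apply: integrable_funeneg => //.
    exact: IhE.
  have finp E : measurable E -> (\int[mu]_(x in E) h^\+ x)%E \is a fin_num.
    move=> mE; apply: integrable_fin_num => //; apply: integrable_funepos => //.
    exact: IhE.
  (* A box meets the cube in a box, over which [g] integrates to 0. So the positive and negative
     parts of [h] agree on boxes, and therefore on measurable sets. *)
  have posneg E : measurable E -> (\int[mu]_(x in E) h^\+ x = \int[mu]_(x in E) h^\- x)%E.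
    apply: integral_boxes_eq; [exact: measurable_funepos|exact: measurable_funeneg| | | |].
    - by move=> x; exact: funepos_ge0.
    - by move=> x; exact: funeneg_ge0.
    - exact: integral_funepos_lt_pinfty.
    move=> a b; have mab := measurable_box_set a b.
    have : (\int[mu]_(x in box a b) h x = 0)%E.
      have [a' [b' abE]] : exists a' b', box a b `&` cube c r = box a' b'.
        by rewrite cube_box boxI; eexists; eexists.
      have := @test_orth_box A g a' b' c r oA Lg g0 r0 cA.
      rewrite -abE => /(_ (@subIsetr _ _ _)) H.
      rewrite integral_mkcond -[RHS]H [RHS]integral_mkcond.
      apply: eq_integral => x _; rewrite !patchE in_setI /h patchE.
      by case: (x \in box a b); case: (x \in cube _ _).
    rewrite integralE => /eqP; rewrite sube_eq ?fin_num_adde_defl ?fin ?finp//.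
    by rewrite add0e => /eqP.
  have int0 E : measurable E -> (\int[mu]_(x in E) h x = 0)%E.
    by move=> mE; rewrite integralE posneg// subee// fin.
  have : ae_eq mu (cube c r) (EFin \o g) (cst 0%E).
    apply: integral_ae_eq => // E EC mE; rewrite integral0.
    rewrite -[RHS](int0 E mE); apply: eq_integral => x xE; rewrite /h patchE ifT//.
    by rewrite inE; apply: EC; rewrite inE in xE.
  by apply: filterS => x H /H [].
pose C (q : 'rV[rat]_d * nat) : set V :=
  if `[< cube (map_mx ratr q.1) (2 * q.2.+1%:R^-1) `<=` A >]
  then cube (map_mx ratr q.1) q.2.+1%:R^-1 else set0.
have CE q : ae_eq mu (C q) g (cst 0).
  rewrite /C; case: ifPn => [/asboolP qA|_]; first by apply: cubeq => //; rewrite invr_gt0.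
  by apply: aeW.
pose N n : set V := if unpickle n is Some q then ~` [set x | C q x -> g x = 0] else set0.
have Nneg n : mu.-negligible (N n).
  rewrite /N; case: unpickle => [q|]; last exact: negligible_set0.
  exact: CE.
apply: negligibleS (negligible_bigcup Nneg) => x /= nx.
have Ax : A x by apply: contrapT => nAx; exact: nx.
have gx : g x <> 0 by move=> gx; exact: nx.
have [q _ qx] : (\bigcup_q C q) x by rewrite -(open_bigcup_cube oA).
exists (pickle q) => //; rewrite /N pickleK => /= H; apply: gx; exact: H.
Qed.

End fundamental_lemma.

(** * Sobolev norm and dual space *)

Section sobolev_facts.
Context {R : realType} {d : nat}.
Local Notation V := 'rV[R]_d.
Local Notation mu := (lebesgue_rV d : {sigma_finite_measure set V -> \bar R}).
Implicit Types (f g u v phi chi : V -> R) (x : V).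

Lemma Rintegral_support (A : set V) f : (forall x, ~ A x -> f x = 0) ->
  Rintegral mu A f = Rintegral mu setT f.
Proof.
move=> f0; rewrite Rintegral_mkcond; congr Rintegral; apply/funext => x.
by rewrite patchE; case: ifPn => // /negP; rewrite inE => /f0 ->.
Qed.

Lemma integral_by_parts1 (A : set V) phi chi i : smooth phi -> test A chi ->
  Rintegral mu A (fun x => phi x * 'D_(basis_vec i) chi x) =
  - Rintegral mu A (fun x => 'D_(basis_vec i) phi x * chi x).
Proof.
move=> sp tc; have [sc _ _] := tc.
have t1 : test A (fun x => 'D_(basis_vec i) chi x * phi x).
  by exact: (testM (@test_iter_deriv R d A [:: i] chi tc) sp).
have t2 : test A (fun x => chi x * 'D_(basis_vec i) phi x).
  by exact: (testM tc (@smooth_iter_deriv R d [:: i] phi sp)).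
have I1 := integrable_test t1; have I2 := integrable_test t2.
apply/eqP; rewrite -addr_eq0; apply/eqP.
rewrite !Rintegral_support; last 2 first.
- by move=> x nx; rewrite (test_out tc nx) mulr0.
- move=> x nx; rewrite -[X in _ * X]/(iter_deriv [:: i] chi x).
  by rewrite (test_out (test_iter_deriv [:: i] tc) nx) mulr0.
under eq_Rintegral do rewrite mulrC.
under [X in _ + X]eq_Rintegral do rewrite mulrC.
rewrite -RintegralD//.
rewrite -[RHS](integral_partial i (testM tc sp)); congr Rintegral; apply/funext => x.
have dp := (smooth_C1 sp i).1 x; have dc := (smooth_C1 sc i).1 x.
by rewrite deriveM// addrC -![_ *: _]/(_ * _) [X in _ + X]mulrC.
Qed.

(** Each step moves the outermost derivative of [chi] to the innermost place on [phi];
    [iter_deriv_perm] restores the order. *)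
Lemma integral_by_parts (A : set V) l : forall phi chi, smooth phi -> test A chi ->
  Rintegral mu A (fun x => phi x * iter_deriv l chi x) =
  (-1) ^+ size l * Rintegral mu A (fun x => iter_deriv l phi x * chi x).
Proof.
elim: l => [|i l IH] phi chi sp tc; first by rewrite expr0 mul1r.
rewrite /= integral_by_parts1//; last exact: test_iter_deriv.
have sDp : smooth ('D_(basis_vec i) phi) by exact: (@smooth_iter_deriv R d [:: i] phi sp).
rewrite IH// exprS mulN1r mulNr; congr (- (_ * _)).
rewrite -[iter_deriv l _]/(iter_deriv l (iter_deriv [:: i] phi)) -iter_deriv_cat.
rewrite (@iter_deriv_perm R d _ (i :: l) phi sp)//.
by rewrite perm_catC.
Qed.

Lemma mderivE (a : 'I_d -> nat) phi : exists l, [/\ size l = mdeg a,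
  forall i, count_mem i l = a i & mderiv a phi = iter_deriv l phi].
Proof.
exists (flatten [seq nseq (a i) i | i <- enum 'I_d]); split => //.
  rewrite size_flatten /shape -map_comp sumnE big_map big_enum.
  by apply: eq_bigr => i _ /=; rewrite size_nseq.
move=> i; rewrite count_flatten -map_comp sumnE big_map big_enum.
rewrite (bigD1 i)//= count_nseq /= eqxx mul1n big1 ?addn0// => j /negbTE ji.
by rewrite count_nseq /= ji mul0n.
Qed.

Lemma is_wderiv_smooth (A : set V) a phi : smooth phi -> is_wderiv A a phi (mderiv a phi).
Proof.
move=> sp chi tc; have [l [ls lc lE]] := mderivE a phi.
have [l' [ls' lc' lE']] := mderivE a chi.
rewrite lE' integral_by_parts// ls'; congr (_ * Rintegral _ _ _); apply/funext => x.
rewrite lE (@iter_deriv_perm _ _ l l' phi sp)//.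
by apply/allP => i _ /=; rewrite lc lc'.
Qed.

Lemma test_mderiv (A : set V) a phi : test A phi -> test A (mderiv a phi).
Proof. by move=> tp; have [l [_ _ ->]] := mderivE a phi; exact: test_iter_deriv. Qed.

Lemma test_Hs (A : set V) s phi : measurable A -> test A phi -> Hs A s phi.
Proof.
move=> mA tp; have [sp _ _] := tp; split; first exact: L2_test.
move=> a _; exists (mderiv a phi); split; last exact: is_wderiv_smooth.
by apply: L2_test => //; exact: test_mderiv.
Qed.

Lemma is_wderivD (A : set V) a u v g h (c : R) : measurable A -> L2 A u -> L2 A v -> L2 A g -> L2 A h ->
  is_wderiv A a u g -> is_wderiv A a v h ->
  is_wderiv A a (fun x => c * u x + v x) (fun x => c * g x + h x).
Proof.
move=> mA Lu Lv Lg Lh ug vh chi tc.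
have tD := test_mderiv a tc.
have Lt := L2_test mA tc; have LD := L2_test mA tD.
have key (p q r : V -> R) : L2 A p -> L2 A q -> L2 A r ->
    Rintegral mu A (fun x => (c * p x + q x) * r x) =
    c * Rintegral mu A (fun x => p x * r x) + Rintegral mu A (fun x => q x * r x).
  move=> Lp Lq Lr; have I1 := L2_integrableM mA Lp Lr; have I2 := L2_integrableM mA Lq Lr.
  under eq_Rintegral do rewrite mulrDl -mulrA.
  rewrite RintegralD//; first by rewrite RintegralZl.
  by have := integrableZl mA c I1.
by rewrite !key// ug// vh//; ring.
Qed.

(** [wderiv] is an arbitrary choice. Uniqueness lets [Hnorm] be computed from any weak derivatives,
    such as the classical ones of a test function. *)
Lemma wderiv_unique (A : set V) a u g h : open A -> L2 A g -> L2 A h ->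
  is_wderiv A a u g -> is_wderiv A a u h -> ae_eq mu A g h.
Proof.
move=> oA Lg Lh ug uh; have mA := open_measurable_rV oA.
have := @fundamental_lemma R d A (fun x => -1 * h x + g x) oA (L2D _ mA Lh Lg).
have H chi : test A chi -> Rintegral mu A (fun x => (-1 * h x + g x) * chi x) = 0.
  move=> tc; have Lt := L2_test mA tc.
  have I1 := L2_integrableM mA Lh Lt; have I2 := L2_integrableM mA Lg Lt.
  have E : Rintegral mu A (fun x => g x * chi x) = Rintegral mu A (fun x => h x * chi x).
    have := ug chi tc; rewrite (uh chi tc) => /eqP.
    by rewrite (inj_eq (mulfI _)) ?signr_eq0// => /eqP.
  under eq_Rintegral do rewrite mulrDl mulN1r mulNr addrC.
  by rewrite RintegralB// E subrr.
move=> /(_ H); apply: filterS => x xg /xg /eqP.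
by rewrite mulN1r addrC subr_eq0 => /eqP.
Qed.

Lemma wderivP (A : set V) s a u : Hs A s u -> (mdeg a <= s)%N ->
  L2 A (wderiv A a u) /\ is_wderiv A a u (wderiv A a u).
Proof.
move=> [_ Hu] /Hu [g Hg].
exact: (@xgetPex _ (fun=> 0) [set g | L2 A g /\ is_wderiv A a u g] (ex_intro _ g Hg)).
Qed.

Lemma Rintegral_sqr_ae (A : set V) g h : measurable A -> L2 A g -> L2 A h -> ae_eq mu A g h ->
  Rintegral mu A (fun x => g x ^+ 2) = Rintegral mu A (fun x => h x ^+ 2).
Proof.
move=> mA [mg _] [mh _] gh; rewrite /Rintegral; congr fine.
apply: ae_eq_integral => //.
- by apply/measurable_EFinP; exact: measurable_funX.
- by apply/measurable_EFinP; exact: measurable_funX.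
- by apply: filterS gh => x gh /gh ->.
Qed.

Lemma Rintegral_sqr_comb (A : set V) g h (c : R) : measurable A -> L2 A g -> L2 A h ->
  Rintegral mu A (fun x => (c * g x + h x) ^+ 2) <=
  2 * c ^+ 2 * Rintegral mu A (fun x => g x ^+ 2) + 2 * Rintegral mu A (fun x => h x ^+ 2).
Proof.
move=> mA Lg Lh; have [_ Ig] := Lg; have [_ Ih] := Lh.
have [_ Igh] := L2D c mA Lg Lh.
have I1 := integrableZl mA (2 * c ^+ 2) Ig; have I2 := integrableZl mA 2 Ih.
rewrite -RintegralZl// -RintegralZl// -RintegralD//.
apply: le_Rintegral => //; first by have := integrableD mA I1 I2.
move=> x _; rewrite -subr_ge0 (_ : _ - _ = (c * g x - h x) ^+ 2) ?sqr_ge0//; ring.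
Qed.

Lemma Hs_comb (A : set V) s u v (c : R) : measurable A -> Hs A s u -> Hs A s v ->
  Hs A s (fun x => c * u x + v x).
Proof.
move=> mA Hu Hv; split; first by apply: L2D => //; [exact: Hu.1|exact: Hv.1].
move=> a al; have [Lg ug] := wderivP Hu al; have [Lh vh] := wderivP Hv al.
eexists; split; first exact: (L2D c mA Lg Lh).
exact: (is_wderivD c mA Hu.1 Hv.1 Lg Lh ug vh).
Qed.

Lemma Hnorm_ge0 (A : set V) s u : 0 <= Hnorm A s u.
Proof. exact: sqrtr_ge0. Qed.

Lemma Hnorm_sqr (A : set V) s u : Hnorm A s u ^+ 2 =
  \sum_(a : {ffun 'I_d -> 'I_s.+1} | (mdeg (fun i => a i) <= s)%N)
    Rintegral mu A (fun x => wderiv A (fun i => a i) u x ^+ 2).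
Proof.
rewrite sqr_sqrtr// sumr_ge0// => a _; apply: Rintegral_ge0 => x _; exact: sqr_ge0.
Qed.

(** Termwise (x + y)^2 <= 2 x^2 + 2 y^2. The resulting triangle inequality [Hnorm_comb] loses a
    factor 2, which reappears in the constants below. *)
Lemma Hnorm_comb_sqr (A : set V) s u v (c : R) : open A -> Hs A s u -> Hs A s v ->
  Hnorm A s (fun x => c * u x + v x) ^+ 2 <= 2 * c ^+ 2 * Hnorm A s u ^+ 2 + 2 * Hnorm A s v ^+ 2.
Proof.
move=> oA Hu Hv; have mA := open_measurable_rV oA.
have key (X Y Z X' Y' Z' : R) : X = X' -> Y = Y' -> Z = Z' ->
  X' <= 2 * c ^+ 2 * Y' + 2 * Z' -> X <= 2 * c ^+ 2 * Y + 2 * Z by move=> -> -> ->.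
apply: (key _ _ _ _ _ _ (Hnorm_sqr A s (fun x => c * u x + v x)) (Hnorm_sqr A s u) (Hnorm_sqr A s v)).
rewrite mulr_sumr [X in _ <= _ + X]mulr_sumr -big_split/=; apply: ler_sum => a al.
have [Lg ug] := wderivP Hu al; have [Lh vh] := wderivP Hv al.
have [Lk uk] := wderivP (Hs_comb c mA Hu Hv) al.
have Lgh := L2D c mA Lg Lh.
have ugh := is_wderivD c mA Hu.1 Hv.1 Lg Lh ug vh.
rewrite (Rintegral_sqr_ae mA Lk Lgh (wderiv_unique oA Lk Lgh uk ugh)).
exact: Rintegral_sqr_comb.
Qed.

Lemma Hnorm_comb (A : set V) s u v (c : R) : open A -> Hs A s u -> Hs A s v ->
  Hnorm A s (fun x => c * u x + v x) <= 2 * `|c| * Hnorm A s u + 2 * Hnorm A s v.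
Proof.
move=> oA Hu Hv; have := Hnorm_comb_sqr c oA Hu Hv.
have p0 := Hnorm_ge0 A s u; have q0 := Hnorm_ge0 A s v.
rewrite -[c ^+ 2]real_normK ?num_real//; have := normr_ge0 c.
move: (Hnorm _ _ _) (Hnorm_ge0 A s (fun x => c * u x + v x)) (`|c|) p0 q0.
move: (Hnorm A s u) (Hnorm A s v) => p q r r0 t p0 q0 t0 H.
rewrite -(@ler_pXn2r _ 2)// ?nnegrE// ?addr_ge0 ?mulr_ge0//.
apply: (le_trans H); have := mulr_ge0 (mulr_ge0 t0 p0) q0; have := sqr_ge0 (t * p); have := sqr_ge0 q; nra.
Qed.

Lemma Hnorm_test (A : set V) s phi : open A -> test A phi ->
  Hnorm A s phi ^+ 2 = \sum_(a : {ffun 'I_d -> 'I_s.+1} | (mdeg (fun i => a i) <= s)%N)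
    Rintegral mu A (fun x => mderiv (fun i => a i) phi x ^+ 2).
Proof.
move=> oA tp; have mA := open_measurable_rV oA; have [sp _ _] := tp.
rewrite Hnorm_sqr; apply: eq_bigr => a al.
have [Lk uk] := wderivP (test_Hs s mA tp) al.
have Lm := L2_test mA (test_mderiv (fun i => a i) tp).
apply: Rintegral_sqr_ae => //; apply: (wderiv_unique oA Lk Lm uk).
exact: is_wderiv_smooth.
Qed.

Lemma test0 (A : set V) : test A (fun=> 0).
Proof.
split; first exact: smooth_cst.
- rewrite (_ : [set x | _] = set0) ?closure0; first exact: compact0.
  by rewrite -subset0 => x /=; rewrite eqxx.
- rewrite (_ : [set x | _] = set0) ?closure0; first by [].
  by rewrite -subset0 => x /=; rewrite eqxx.
Qed.

Lemma Hnorm0 (A : set V) s : open A -> Hnorm A s (fun=> 0) = 0.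
Proof.
move=> oA; apply/eqP; rewrite -sqrf_eq0 Hnorm_test//; last exact: test0.
apply/eqP; apply: big1 => a _; have [l [_ _ ->]] := mderivE (fun i => a i) (fun=> 0 : R).
have E : iter_deriv l (fun=> 0 : R) = (fun=> 0 : R).
  elim: l => //= i l ->; apply/funext => x; exact: derive_cst.
rewrite E; under eq_Rintegral do rewrite expr0n.
by rewrite /Rintegral integral0.
Qed.

Lemma H0_test (A : set V) s phi : open A -> test A phi -> H0 A s phi.
Proof.
move=> oA tp; split; first exact: test_Hs (open_measurable_rV oA) tp.
exists (fun=> phi); split; first by move=> _.
have -> : (fun x => phi x - phi x) = (fun=> 0) by apply/funext => x; rewrite subrr.
by rewrite Hnorm0//; exact: cvg_cst.
Qed.

Lemma smoothD phi chi : smooth phi -> smooth chi -> smooth (fun x => phi x + chi x).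
Proof.
move=> sp sc; apply: (@smooth_coind _ _ (fun h => exists f g, [/\ smooth f, smooth g & h = f + g])).
  move=> _ [f [g [sf sg ->]]]; split.
    by move=> x; apply: continuousD; exact: smooth_continuous.
  move=> i; have df x := (smooth_C1 sf i).1 x; have dg x := (smooth_C1 sg i).1 x.
  split; first by move=> x; exact: derivableD.
  exists ('D_(basis_vec i) f), ('D_(basis_vec i) g); split.
  - exact: (@smooth_iter_deriv R d [:: i] f sf).
  - exact: (@smooth_iter_deriv R d [:: i] g sg).
  - by apply/funext => x; rewrite deriveD.
by exists phi, chi.
Qed.

Lemma cvg_comb0 (K L : R) (a b : nat -> R) : a n @[n --> \oo] --> (0 : R) ->
  b n @[n --> \oo] --> (0 : R) -> K * a n + L * b n @[n --> \oo] --> (0 : R).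
Proof.
move=> ha hb; rewrite [X in _ --> X](_ : 0 = K * 0 + L * 0); last by rewrite !mulr0 addr0.
exact: (cvgD (@cvgMr _ _ _ _ _ K _ ha) (@cvgMr _ _ _ _ _ L _ hb)).
Qed.

Lemma testD (A : set V) phi chi : test A phi -> test A chi -> test A (fun x => phi x + chi x).
Proof.
move=> tp tc; have [sp cp pA] := tp; have [sc cc cA] := tc.
have sub : closure [set x | phi x + chi x != 0] `<=` supp phi `|` supp chi.
  have cl : closed (supp phi `|` supp chi) by apply: closedU; exact: closed_closure.
  rewrite [X in _ `<=` X](closure_id _).1//; apply: closure_subset => x /= nz.
  apply: contrapT => /not_orP[np nc]; move/eqP: nz; apply.
  by rewrite (supp_out np) (supp_out nc) addr0.
split; first exact: smoothD.
- apply: subclosed_compact sub; first exact: closed_closure.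
  exact: compactU.
- by move=> x /sub [/pA|/cA].
Qed.

Lemma H0_comb (A : set V) s u v (c : R) : open A -> H0 A s u -> H0 A s v ->
  H0 A s (fun x => c * u x + v x).
Proof.
move=> oA [Hu [p [tp pu]]] [Hv [q [tq qv]]]; have mA := open_measurable_rV oA.
split; first exact: Hs_comb.
exists (fun n x => c * p n x + q n x); split.
  by move=> n; apply: testD => //; exact: testZ.
have Hup n : Hs A s (fun x => u x - p n x).
  have := Hs_comb (-1) mA (test_Hs s mA (tp n)) Hu.
  by under eq_fun do rewrite mulN1r addrC.
have Hvq n : Hs A s (fun x => v x - q n x).
  have := Hs_comb (-1) mA (test_Hs s mA (tq n)) Hv.
  by under eq_fun do rewrite mulN1r addrC.
apply: (@squeeze_cvgr _ _ _ _ (fun=> 0) (fun n => 2 * `|c| * Hnorm A s (fun x => u x - p n x) + 2 * Hnorm A s (fun x => v x - q n x))).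
- apply: nearW => n; rewrite Hnorm_ge0/=.
  rewrite (_ : (fun x => _) = (fun x => c * (u x - p n x) + (v x - q n x))).
    exact: Hnorm_comb.
  by apply/funext => x; ring.
- exact: cvg_cst.
- exact: (@cvg_comb0 (2 * `|c|) 2 (fun n => Hnorm A s (fun x => u x - p n x)) (fun n => Hnorm A s (fun x => v x - q n x)) pu qv).
Qed.

(** The multi-index that counts the letters of [l] contributes one of the nonnegative terms of the
    squared norm. *)
Lemma energy_le_Hnorm (A : set V) s phi l : open A -> test A phi -> size l = s ->
  Rintegral mu A (fun x => iter_deriv l phi x ^+ 2) <= Hnorm A s phi ^+ 2.
Proof.
move=> oA tp ls; rewrite Hnorm_test//; have [sp _ _] := tp.
have cle i : (count_mem i l < s.+1)%N by rewrite ltnS -ls count_size.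
pose a : {ffun 'I_d -> 'I_s.+1} := [ffun i => Ordinal (cle i)].
have aE i : (a i = count_mem i l :> nat) by rewrite ffunE.
have al : mdeg (fun i => a i) = s.
  rewrite /mdeg (eq_bigr (fun i => count_mem i l)); last by move=> i _; rewrite aE.
  rewrite -[RHS]ls; elim: l {ls cle a aE} => [|j l IH]; first by rewrite big1.
  rewrite /= big_split/= IH (bigD1 j)//= eqxx big1 ?addn0 ?add1n// => i.
  by rewrite eq_sym => /negbTE ->.
rewrite (bigD1 a) ?al//=.
have [l' [ls' lc' ->]] := mderivE (fun i => a i) phi.
rewrite (@iter_deriv_perm _ _ l l' phi sp); last first.
  by apply/allP => i _ /=; rewrite lc' aE.
rewrite lerDl sumr_ge0// => b _; apply: Rintegral_ge0 => x _; exact: sqr_ge0.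
Qed.

End sobolev_facts.

(** * Quadratic forms and Cholesky factors *)

Section cauchy_schwarz.
Context {R : realType}.

(** Evaluate at t = -b/a. If a = 0, a nonnegative affine function of t forces b = 0. *)
Lemma bilinear_schwarz (a b c : R) : 0 <= a -> 0 <= c ->
  (forall t, 0 <= a * t ^+ 2 + 2 * b * t + c) -> b ^+ 2 <= a * c.
Proof.
move=> a0 c0 H; have [az|anz] := eqVneq a 0.
  have := H (- (c + 1) / (2 * b)); have [->|bnz] := eqVneq b 0; first by rewrite expr0n mulr_ge0.
  rewrite az mul0r add0r (_ : 2 * b * _ = - (c + 1)); last by field.
  by lra.
have ap : 0 < a by rewrite lt_neqAle eq_sym anz.
have := H (- b / a); rewrite (_ : _ + _ = (a * c - b ^+ 2) / a); last by field.
by rewrite pmulr_lge0 ?invr_gt0// subr_ge0.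
Qed.

Lemma sum_schwarz (T : finType) (P : pred T) (p q : T -> R) :
  (\sum_(i | P i) p i * q i) ^+ 2 <= (\sum_(i | P i) p i ^+ 2) * (\sum_(i | P i) q i ^+ 2).
Proof.
apply: bilinear_schwarz; try by apply: sumr_ge0 => i _; exact: sqr_ge0.
move=> t; rewrite !mulr_suml mulr_sumr mulr_suml -!big_split/=.
apply: sumr_ge0 => i _; rewrite (_ : _ + _ = (t * p i + q i) ^+ 2) ?sqr_ge0//; ring.
Qed.

End cauchy_schwarz.

Section euclidean_facts.
Context {R : realType} {d : nat}.
Implicit Types x y z : 'rV[R]_d.

Lemma dotpp_ge0 x : 0 <= dotp x x.
Proof. by apply: sumr_ge0 => i _; rewrite -expr2 sqr_ge0. Qed.

Lemma enorm_sqr x : enorm x ^+ 2 = dotp x x.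
Proof. by rewrite sqr_sqrtr// dotpp_ge0. Qed.

Lemma enorm_ge0 x : 0 <= enorm x.
Proof. exact: sqrtr_ge0. Qed.

Lemma dotp_schwarz x y : dotp x y ^+ 2 <= dotp x x * dotp y y.
Proof. exact: (sum_schwarz predT (x ord0) (y ord0)). Qed.

Lemma dotp_le x y : dotp x y <= enorm x * enorm y.
Proof.
apply: (le_trans (ler_norm _)); rewrite -(@ler_pXn2r _ 2)// ?nnegrE ?mulr_ge0 ?enorm_ge0//.
by rewrite real_normK ?num_real// exprMn !enorm_sqr dotp_schwarz.
Qed.

Lemma enormN x : enorm (- x) = enorm x.
Proof. by congr Num.sqrt; apply: eq_bigr => i _; rewrite !mxE mulrNN. Qed.

Lemma enorm_distC x y : enorm (x - y) = enorm (y - x).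
Proof. by rewrite -enormN opprB. Qed.

Lemma enormD x y : enorm (x + y) <= enorm x + enorm y.
Proof.
rewrite -(@ler_pXn2r _ 2)// ?nnegrE ?addr_ge0 ?enorm_ge0// sqrrD !enorm_sqr.
have -> : dotp (x + y) (x + y) = dotp x x + dotp x y *+ 2 + dotp y y.
  rewrite mulr2n /dotp -!big_split/=; apply: eq_bigr => i _; rewrite !mxE; ring.
by rewrite lerD2r lerD2l lerMn2r /= dotp_le.
Qed.

Lemma enorm_dist_triangle x y z : enorm (x - z) <= enorm (x - y) + enorm (y - z).
Proof. by rewrite (le_trans _ (enormD _ _))// addrA subrK. Qed.

Lemma enormZ (c : R) x : enorm (c *: x) = `|c| * enorm x.
Proof.
rewrite /enorm (_ : dotp _ _ = c ^+ 2 * dotp x x); first by rewrite sqrtrM ?sqr_ge0// sqrtr_sqr.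
by rewrite /dotp mulr_sumr; apply: eq_bigr => i _; rewrite !mxE; ring.
Qed.

Lemma coord_le_enorm x i : `|x ord0 i| <= enorm x.
Proof.
rewrite -(@ler_pXn2r _ 2)// ?nnegrE ?enorm_ge0// enorm_sqr real_normK ?num_real//.
by rewrite /dotp (bigD1 i)//= -expr2 lerDl sumr_ge0// => j _; rewrite -expr2 sqr_ge0.
Qed.

Lemma enorm_le (r : R) x : (forall i, `|x ord0 i| <= r) -> enorm x <= d%:R * r.
Proof.
move=> xr; have [d0|d0] := posnP d.
  rewrite {2}d0 mul0r /enorm /dotp big1 ?sqrtr0// => i.
  by exfalso; move: (ltn_ord i); move: (nat_of_ord i) => m; rewrite d0.
have r0 : 0 <= r by rewrite (le_trans _ (xr (Ordinal d0))).
have nr0 : 0 <= d%:R * r by apply: mulr_ge0.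
rewrite -(@ler_pXn2r _ 2) ?nnegrE ?enorm_ge0// enorm_sqr.
apply: (@le_trans _ _ (\sum_(i < d) r ^+ 2)).
  apply: ler_sum => i _; rewrite -expr2 -real_normK ?num_real// ler_pXn2r ?nnegrE//.
rewrite sumr_const card_ord -[X in X <= _]mulr_natl exprMn ler_wpM2r ?sqr_ge0//.
by rewrite -natrX ler_nat leq_pmulr.
Qed.

Lemma enorm_eq0 x : enorm x = 0 -> x = 0.
Proof.
move=> x0; apply/rowP => i; rewrite mxE; apply/eqP.
by rewrite -normr_le0 -x0 coord_le_enorm.
Qed.

End euclidean_facts.

Section operator_norm.
Context {R : realType}.

Definition quad n (A : 'M[R]_n) (v : 'cV[R]_n) : R := dotp v^T (A *m v)^T.

Lemma quad_sum n (A : 'M[R]_n) v :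
  quad A v = \sum_i \sum_j v i ord0 * v j ord0 * A i j.
Proof.
rewrite /quad /dotp; apply: eq_bigr => i _; rewrite !mxE mulr_sumr.
by apply: eq_bigr => j _; ring.
Qed.

Lemma dotp_trmx n (x y : 'cV[R]_n) : dotp x^T y^T = (x^T *m y) ord0 ord0.
Proof. by rewrite mxE; apply: eq_bigr => i _; rewrite !mxE. Qed.

Lemma enorm0 n : enorm (0 : 'rV[R]_n) = 0.
Proof. by rewrite /enorm /dotp big1 ?sqrtr0// => i _; rewrite !mxE mul0r. Qed.

Lemma opnorm_has_ubound m n (A : 'M[R]_(m, n)) :
  has_ubound [set enorm (A *m v)^T | v in [set v : 'cV[R]_n | enorm v^T <= 1]].
Proof.
exists (m%:R * \sum_i \sum_j `|A i j|) => _ [v /= v1 <-].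
apply: enorm_le => i; rewrite !mxE.
apply: (le_trans (ler_norm_sum _ _ _)).
apply: (@le_trans _ _ (\sum_j `|A i j|)).
  apply: ler_sum => j _; rewrite normrM ler_piMr//.
  by have := coord_le_enorm v^T j; rewrite mxE => /le_trans -> //.
by rewrite [leRHS](bigD1 i)//= lerDl; apply: sumr_ge0 => ? _; apply: sumr_ge0.
Qed.

Lemma opnorm_ge0 m n (A : 'M[R]_(m, n)) : 0 <= opnorm A.
Proof.
apply: (le_trans (enorm_ge0 (A *m (0 : 'cV_n))^T)); apply: ub_le_sup; first exact: opnorm_has_ubound.
by exists 0 => //=; rewrite trmx0 enorm0 ler01.
Qed.

Lemma opnorm_bound m n (A : 'M[R]_(m, n)) (v : 'cV[R]_n) :
  enorm (A *m v)^T <= opnorm A * enorm v^T.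
Proof.
have [v0|vnz] := eqVneq (enorm v^T) 0.
  have /(congr1 trmx) := enorm_eq0 v0; rewrite trmxK => ->.
  by rewrite !trmx0 mulmx0 trmx0 !enorm0 mulr0.
have vp : 0 < enorm v^T by rewrite lt_neqAle eq_sym vnz enorm_ge0.
have n0 : 0 <= (enorm v^T)^-1 by rewrite invr_ge0 ltW.
rewrite -ler_pdivrMr// mulrC -[X in X * _](ger0_norm n0) -enormZ -linearZ/= scalemxAr.
apply: ub_le_sup; first exact: opnorm_has_ubound.
exists ((enorm v^T)^-1 *: v) => //=.
by rewrite linearZ/= enormZ ger0_norm// mulVf.
Qed.

Lemma quad_le_opnorm n (A : 'M[R]_n) v : quad A v <= opnorm A * dotp v^T v^T.
Proof.
apply: (le_trans (dotp_le _ _)); rewrite -enorm_sqr expr2 mulrCA.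
by rewrite ler_wpM2l ?enorm_ge0// opnorm_bound.
Qed.

Lemma quad_gram n p (M : 'M[R]_(n, p)) v :
  quad (M *m M^T) v = dotp (M^T *m v)^T (M^T *m v)^T.
Proof. by rewrite /quad !dotp_trmx trmx_mul trmxK !mulmxA. Qed.

(* Cauchy-Schwarz for the form of [M *m M^T] at [y = M *m M^T *m v] and [v]. *)
Lemma opnorm_le_quad n p (M : 'M[R]_(n, p)) (b : R) : 0 <= b ->
  (forall v, quad (M *m M^T) v <= b * dotp v^T v^T) -> opnorm (M *m M^T) <= b.
Proof.
move=> b0 H; apply: ge_sup.
  by exists (enorm ((M *m M^T) *m (0 : 'cV_n))^T), 0 => //=; rewrite trmx0 enorm0 ler01.
move=> _ [v /= v1 <-]; set y := (_ *m v).
have v1' : dotp v^T v^T <= 1 by rewrite -enorm_sqr expr_le1 ?enorm_ge0.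
have yE : dotp y^T y^T = dotp (M^T *m y)^T (M^T *m v)^T.
  by rewrite !dotp_trmx [(M^T *m y)^T]trmx_mul trmxK /y -!mulmxA.
have := dotp_schwarz (M^T *m y)^T (M^T *m v)^T; rewrite -yE -!quad_gram.
have := H y; have := H v; have p0 := dotpp_ge0 y^T; have q0 := dotpp_ge0 v^T.
have e0 := enorm_ge0 y^T; rewrite -enorm_sqr in p0 *.
move: (quad _ y) (quad_gram M y) (quad _ v) (quad_gram M v) => a aE c cE.
have a0 : 0 <= a by rewrite aE dotpp_ge0. have c0 : 0 <= c by rewrite cE dotpp_ge0.
move: (enorm y^T) (dotp v^T v^T) e0 p0 q0 v1' {aE cE yE} => e q e0 p0 q0 q1 cb ab aa.
have cb' : c <= b by apply: (le_trans cb); rewrite ler_piMr.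
rewrite leNgt; apply/negP => be.
have ep : 0 < e by exact: le_lt_trans be.
have : (e ^+ 2) ^+ 2 <= b ^+ 2 * e ^+ 2.
  apply: (le_trans aa); rewrite expr2 mulrAC; exact: ler_pM.
by rewrite expr2 ler_pM2r ?exprn_gt0// ler_pXn2r ?nnegrE// leNgt be.
Qed.

(* For a lower triangular factor, columns [k, k+1, ...] only see the entries of
   index at least [k], so the Schur complement form of [v] is unaffected when the
   entries of index less than [k] are changed. *)
Lemma cholesky_opnorm n (T L : 'M[R]_n) k (hk : (k <= n)%N) (b : R) :
  cholesky_factor T L -> 0 <= b ->
  (forall v : 'cV[R]_n, exists2 c : 'cV[R]_n,
    (forall i : 'I_n, (k <= i)%N -> c i ord0 = v i ord0) & quad T c <= b * dotp v^T v^T) ->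
  opnorm (T - first_columns hk L *m (first_columns hk L)^T) <= b.
Proof.
move=> [Ltrig _ TE] b0 H.
pose M : 'M[R]_n := \matrix_(i, j) (if (j < k)%N then 0 else L i j).
have -> : T - first_columns hk L *m (first_columns hk L)^T = M *m M^T.
  apply/matrixP => i j; rewrite -TE !mxE.
  rewrite (bigID (fun l : 'I_n => (l < k)%N))/=.
  rewrite [X in X + _ - _](_ : _ = \sum_(l < k) first_columns hk L i l * (first_columns hk L)^T l j).
    rewrite addrAC subrr add0r [RHS](bigID (fun l : 'I_n => (l < k)%N))/= [X in _ = X + _]big1 ?add0r.
      by apply: eq_bigr => l; rewrite !mxE => /negbTE ->.
    by move=> l lk; rewrite !mxE lk mul0r.
  rewrite (big_ord_narrow hk); apply: eq_bigr => l _; rewrite !mxE//.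
apply: opnorm_le_quad => // v; have [c cv cb] := H v; apply: le_trans cb.
rewrite -TE !quad_gram; apply: ler_sum => j _; rewrite -!expr2.
rewrite !mxE; case: (ltnP j k) => jk.
  by rewrite big1 ?expr0n ?sqr_ge0// => i _; rewrite !mxE jk mul0r.
rewrite le_eqVlt; apply/orP; left; apply/eqP; congr (_ ^+ 2); apply: eq_bigr => i _.
rewrite !mxE ltnNge jk/=; have [ij|ji] := ltnP i j.
  by rewrite (is_trig_mxP Ltrig)// !mul0r.
by rewrite cv// (leq_trans jk).
Qed.

End operator_norm.

(** * Point sets *)

Section packing.
Context {R : realType} {d : nat}.
Local Notation V := 'rV[R]_d.
Local Notation mu := (lebesgue_rV d : {sigma_finite_measure set V -> \bar R}).

Lemma cube_sym (x y : V) r : cube x r y -> cube y r x.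
Proof. by move=> h i; rewrite distrC. Qed.

Lemma enorm_cube (x y : V) r : enorm (x - y) < r -> cube x r y.
Proof.
move=> h i; apply: le_lt_trans h; rewrite distrC.
by have := coord_le_enorm (x - y) i; rewrite !mxE.
Qed.

Lemma cube_enorm (c x y : V) r : cube c r x -> cube c r y -> enorm (x - y) <= d%:R * (2 * r).
Proof.
move=> cx cy; apply: enorm_le => i; rewrite !mxE.
have := cx i; have := cy i; rewrite !ltr_distlC => /andP[? ?] /andP[? ?].
by rewrite ler_norml; apply/andP; split; lra.
Qed.

Lemma enorm_separated (x y : V) t : 0 < t -> (0 < d)%N -> t <= enorm (x - y) ->
  exists i, t / d%:R <= `|x ord0 i - y ord0 i|.
Proof.
move=> t0 d0 h; apply: contrapT => /forallNP H.
have dR : 0 < d%:R :> R by rewrite ltr0n.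
pose i0 := Ordinal d0.
pose m := \big[Order.max/`|x ord0 i0 - y ord0 i0|]_i `|x ord0 i - y ord0 i|.
have mlt : m < t / d%:R.
  rewrite /m; apply: (big_ind (fun u => u < t / d%:R)) => [|u v ut vt|i _].
  - by rewrite ltNge; apply/negP; exact: H.
  - by rewrite gt_max ut.
  - by rewrite ltNge; apply/negP; exact: H.
have : enorm (x - y) <= d%:R * m.
  by apply: enorm_le => i; rewrite !mxE /m (bigD1 i)//= le_max lexx.
move/(le_trans h); rewrite leNgt mulrC -ltr_pdivlMr//.
by rewrite mlt.
Qed.

(** Cut the cube into cells of side [t]: two points of one cell differ by less than [t] in every
    coordinate, so a cell holds at most one point. *)
Lemma packing (J : finType) (P : {pred J}) (p : J -> V) c (r t : R) : 0 < t -> 0 <= r ->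
  (forall j, j \in P -> cube c r (p j)) ->
  (forall i j, i \in P -> j \in P -> i != j -> exists a, t <= `|p i ord0 a - p j ord0 a|) ->
  #|P|%:R <= (2 * r / t + 1) ^+ d.
Proof.
move=> t0 r0 pc sep; pose q j a := (p j ord0 a - (c ord0 a - r)) / t.
pose m := Num.trunc (2 * r / t).
have rt : 0 <= 2 * r / t by rewrite divr_ge0 ?mulr_ge0// ltW.
have qb j a : j \in P -> 0 <= q j a <= 2 * r / t.
  move=> jP; have := pc j jP a; rewrite ltr_distlC => /andP[h1 h2].
  by rewrite /q divr_ge0 ?ler_pM2r ?invr_gt0//; [lra|lra|exact: ltW].
have qm j a : j \in P -> (Num.trunc (q j a) < m.+1)%N.
  by move=> /(qb j a)/andP[_]; rewrite ltnS; exact: le_truncn.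
pose f j : {ffun 'I_d -> 'I_m.+1} := [ffun a => inord (Num.trunc (q j a))].
have finj : {in P &, injective f}.
  move=> i j iP jP fij; apply/eqP; apply: contraT => /(sep i j iP jP) [a].
  have /(congr1 (fun g : {ffun 'I_d -> 'I_m.+1} => nat_of_ord (g a))) := fij.
  rewrite !ffunE !inordK ?qm// => E.
  have /andP[qi0 _] := qb i a iP; have /andP[qj0 _] := qb j a jP.
  have /andP[h1 h2] := truncn_itv qi0; have /andP[h3 h4] := truncn_itv qj0.
  rewrite leNgt => /negP []; move: h1 h2 h3 h4; rewrite E -!natr1.
  have <- : (q i a - q j a) * t = p i ord0 a - p j ord0 a by rewrite /q; field; lra.
  rewrite normrM (gtr0_norm t0) gtr_pMl//.
  move: (Num.trunc _)%:R => u h1 h2 h3 h4; rewrite ltr_norml; apply/andP; split; lra.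
apply: (@le_trans _ _ (#|{ffun 'I_d -> 'I_m.+1}|%:R)).
  by rewrite ler_nat; exact: leq_card_in finj.
rewrite card_ffun !card_ord natrX lerXn2r ?nnegrE ?addr_ge0//.
by rewrite -natr1 lerD2r truncn_le.
Qed.

(** The cubes that contain [y] have their centres in the cube of radius [r] around [y], so [packing]
    bounds their number. *)
Lemma overlap_integral (J : finType) (P : {pred J}) (p : J -> V) (r t : R) (g : V -> R) :
  0 < t -> 0 <= r -> (forall y, 0 <= g y) -> measurable_fun setT (EFin \o g) ->
  (forall i j, i \in P -> j \in P -> i != j -> exists a, t <= `|p i ord0 a - p j ord0 a|) ->
  (\sum_(j in P) \int[mu]_(y in cube (p j) r) (g y)%:E <=
   ((2 * r / t + 1) ^+ d)%:E * \int[mu]_y (g y)%:E)%E.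
Proof.
move=> t0 r0 g0 mg sep; pose ind j y : R := \1_(cube (p j) r) y.
have -> : (\sum_(j in P) \int[mu]_(y in cube (p j) r) (g y)%:E =
    \sum_(j in P) \int[mu]_y (g y * ind j y)%:E)%E.
  apply: eq_bigr => j _; rewrite integral_mkcond; apply: eq_integral => y _.
  by rewrite patchE /ind indicE; case: ifPn; rewrite ?mulr1 ?mulr0.
have mi j : measurable_fun setT (fun y => (g y * ind j y)%:E).
  apply/measurable_EFinP; apply: measurable_funM; first exact/measurable_EFinP.
  by apply: measurable_indic; exact: measurable_cube.
have i0 j y : (0 <= (g y * ind j y)%:E)%E by rewrite lee_fin mulr_ge0.
rewrite -[X in (X <= _)%E]big_filter -ge0_integral_sum//.
rewrite -ge0_integralZl//; [|by move=> y _; rewrite lee_fin|by rewrite lee_fin exprn_ge0// addr_ge0// divr_ge0 ?mulr_ge0// ltW].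
apply: ge0_le_integral => //.
- by move=> y _; apply: sume_ge0.
- exact: emeasurable_sum.
- exact: measurable_funeM.
move=> y _; rewrite big_filter sumEFin lee_fin -mulr_sumr mulrC ler_wpM2r//.
rewrite /ind; under eq_bigr do rewrite indicE.
pose Q := [pred j | (j \in P) && (y \in cube (p j) r)].
rewrite -natr_sum -big_mkcondr/= sum1_card.
apply: (@packing J Q p y r t) => // [j|i j /andP[iP _] /andP[jP _]]; last exact: sep.
by rewrite inE => /andP[_]; rewrite inE => /cube_sym.
Qed.

End packing.

Section distance.
Context {R : realType} {d : nat}.
Local Notation V := 'rV[R]_d.
Implicit Types (x y : V) (A B : set V).

Lemma dist_le x y A : A y -> dist x A <= enorm (x - y).
Proof.
move=> Ay; apply: ge_inf; last by exists y.
by exists 0 => _ [z _ <-]; exact: enorm_ge0.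
Qed.

Lemma dist_ge (r : R) x A : A !=set0 -> (forall y, A y -> r <= enorm (x - y)) -> r <= dist x A.
Proof.
move=> [y Ay] H; apply: lb_le_inf; first by exists (enorm (x - y)), y.
by move=> _ [z Az <-]; exact: H.
Qed.

Lemma dist_lt (r : R) x A : A !=set0 -> dist x A < r -> exists2 y, A y & enorm (x - y) < r.
Proof.
move=> A0 h; apply: contrapT => H; move: h; rewrite ltNge => /negP; apply.
apply: dist_ge => // y Ay; rewrite leNgt; apply/negP => ry; apply: H; by exists y.
Qed.

Lemma dist_ge0 x A : A !=set0 -> 0 <= dist x A.
Proof. by move=> A0; apply: dist_ge => // y _; exact: enorm_ge0. Qed.

Lemma dist_antitone x A B : A !=set0 -> A `<=` B -> dist x B <= dist x A.
Proof. by move=> A0 AB; apply: dist_ge => // y /AB; exact: dist_le. Qed.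

Lemma boundary_open A x : open A -> boundary A x -> ~ A x.
Proof. by move=> /interior_id oA [_]; rewrite oA. Qed.

End distance.

(** * Separation, fill distance and the maximin ordering *)

Section point_sets.
Context {R : realType} {d : nat} {I : finType}.
Local Notation V := 'rV[R]_d.
Variables (A : set V) (R0 : R) (x : I -> V).
Hypothesis d_gt0 : (0 < d)%N.
Hypothesis oA : open A.
Hypothesis R0_gt0 : 0 < R0.
Hypothesis AR0 : A `<=` cube 0 R0.
Hypothesis xinj : injective x.
Hypothesis xA : forall i, A (x i).

(** With [fill], the numerator and denominator into which [homogeneity] unfolds. *)
Definition separation : R := inf [set dist (x ij.1) (x ij.2 |` boundary A) |
        ij in [set ij : I * I | ij.1 != ij.2]].

Definition fill : R := sup [set dist y (range x `|` boundary A) | y in A].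

Lemma separation_le i j : i != j -> separation <= dist (x i) (x j |` boundary A).
Proof.
move=> ij; apply: ge_inf; last by exists (i, j).
by exists 0 => _ [ij' _ <-]; apply: dist_ge0; exists (x ij'.2); left.
Qed.

Lemma dist_point_gt0 i j : i != j -> 0 < dist (x i) (x j |` boundary A).
Proof.
move=> ij; have /open_cubeP oA' := oA; have [r r0 rA] := oA' _ (xA i).
have xij : 0 < enorm (x i - x j).
  rewrite lt_neqAle enorm_ge0 andbT eq_sym; apply: contra ij => /eqP/enorm_eq0/eqP.
  by rewrite subr_eq0 => /eqP/xinj ->.
apply: (@lt_le_trans _ _ (Num.min r (enorm (x i - x j)))); first by rewrite lt_min r0.
apply: dist_ge; first by exists (x j); left.
move=> y [->|yb]; first by rewrite ge_min lexx orbT.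
rewrite ge_min; apply/orP; left; rewrite leNgt; apply/negP => /enorm_cube/rA.
exact: boundary_open yb.
Qed.

Lemma separation_gt0 : (1 < #|I|)%N -> 0 < separation.
Proof.
move=> /card_gt1P [i0 [j0 [_ _ ij0]]].
pose F (ij : I * I) := dist (x ij.1) (x ij.2 |` boundary A).
pose m := \big[Order.min/F (i0, j0)]_(ij : I * I | ij.1 != ij.2) F ij.
have m0 : 0 < m.
  rewrite /m; apply: (big_ind (fun t => 0 < t)) => [|u v u0 v0|ij h]; last exact: dist_point_gt0.
  - exact: dist_point_gt0.
  - by rewrite lt_min u0.
apply: (lt_le_trans m0); apply: lb_le_inf; first by exists (F (i0, j0)), (i0, j0).
by move=> _ [ij /= h <-]; rewrite /m (bigD1 ij)//= ge_min lexx.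
Qed.

Lemma fill_ge y : (0 < #|I|)%N -> A y -> dist y (range x `|` boundary A) <= fill.
Proof.
move=> /card_gt0P [i _] Ay; apply: ub_le_sup; last by exists y.
exists (d%:R * (2 * R0)) => _ [z Az <-].
apply: (@le_trans _ _ (enorm (z - x i))); first by apply: dist_le; left; exists i.
by apply: (cube_enorm (c := 0)); exact: AR0.
Qed.

Lemma fill_near y r : (0 < #|I|)%N -> A y -> fill < r ->
  exists2 z, (range x `|` boundary A) z & enorm (y - z) < r.
Proof.
move=> I0 Ay fr; apply: dist_lt; last by exact: le_lt_trans (fill_ge I0 Ay) fr.
by move/card_gt0P: I0 => [i _]; exists (x i); left; exists i.
Qed.

(** Split the cube into m^d disjoint cubes of half-side r/m. Around each centre there is a point of
    the family or of the boundary within r/m, and the boundary is excluded because the cube lies in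
    [A]. *)
Lemma fill_count z0 r m : (0 < #|I|)%N -> cube z0 r `<=` A -> (0 < m)%N -> fill < r / m%:R ->
  (m ^ d <= #|[pred i | x i \in cube z0 r]|)%N.
Proof.
move=> I0 zA m0 fm.
have m0' : 0 < m%:R :> R by rewrite ltr0n.
have rm0 : 0 < r / m%:R.
  apply: le_lt_trans fm; case/card_gt0P: (I0) => i _.
  by apply: le_trans (fill_ge I0 (xA i)); apply: dist_ge0; exists (x i); left; exists i.
pose h := r / m%:R; have rE : r = m%:R * h by rewrite /h; field; lra.
pose c (b : {ffun 'I_d -> 'I_m}) : V := \row_a (z0 ord0 a - r + (2 * (b a)%:R + 1) * h).
have sub b : cube (c b) h `<=` cube z0 r.
  move=> y yc a; have := yc a; rewrite mxE !ltr_distlC => /andP[h1 h2].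
  have bm : (b a).+1%:R * h <= m%:R * h by rewrite ler_pM2r// ler_nat.
  have b0 : 0 <= (b a)%:R * h by rewrite mulr_ge0// ltW.
  by move: bm h1 h2; rewrite -rE -natr1 => bm h1 h2; apply/andP; split; lra.
have cA b : A (c b).
  by apply/zA/(sub b) => a; rewrite subrr normr0.
have pt b : exists i, cube (c b) h (x i).
  have [z [[i _ <-]|zb] zr] := fill_near I0 (cA b) fm; first by exists i; exact: enorm_cube.
  by have := boundary_open oA zb => /(_ (zA _ (sub _ _ (enorm_cube zr)))).
pose f b := sval (cid (pt b)).
have fP b : cube (c b) h (x (f b)) by rewrite /f; case: cid.
have finj : injective f.
  move=> b b' bb; have := fP b; have := fP b'; rewrite -bb => h1 h2.
  apply/ffunP => a; apply/val_inj => /=.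
  have := h1 a; have := h2 a; rewrite !mxE !ltr_distlC => /andP[h3 h4] /andP[h5 h6].
  have [lt|lt|//] := ltngtP (b a) (b' a).
    have H : (b a).+1%:R * h <= (b' a)%:R * h by rewrite ler_pM2r// ler_nat.
    by exfalso; move: h3 h4 h5 h6 H; rewrite -natr1; lra.
  have H : (b' a).+1%:R * h <= (b a)%:R * h by rewrite ler_pM2r// ler_nat.
  by exfalso; move: h3 h4 h5 h6 H; rewrite -natr1; lra.
have -> : (m ^ d)%N = #|{ffun 'I_d -> 'I_m}| by rewrite card_ffun !card_ord.
rewrite -(card_imset _ finj); apply: subset_leq_card; apply/fintype.subsetP => _ /imsetP[b _ ->].
by rewrite -topredE /=; apply/mem_set; exact: sub (fP b).
Qed.

(** Otherwise [fill_count] would apply with every [m], and m = #I + 1 gives more points than there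
    are. *)
Lemma fill_gt0 : (0 < #|I|)%N -> A !=set0 -> 0 < fill.
Proof.
move=> I0 [z Az]; have /open_cubeP oA' := oA; have [r r0 rA] := oA' _ Az.
rewrite ltNge; apply/negP => f0.
have := @fill_count z r #|I|.+1 I0 rA isT.
have -> : fill < r / #|I|.+1%:R by rewrite (le_lt_trans f0)// divr_gt0.
move=> /(_ isT); apply/negP; rewrite -ltnNge.
apply: (@leq_ltn_trans #|I|); first exact: max_card.
by rewrite (leq_trans (ltnSn _))// -[X in (X <= _)%N]expn1 leq_pexp2l.
Qed.

Variable o : 'I_#|I| -> I.
Hypothesis Ho : maximin_ordering A x o.

Definition prefix (k : 'I_#|I|) : set V :=
  [set x (o l) | l in [set l : 'I_#|I| | (l < k)%N]] `|` boundary A.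

(** Indices start at 0, so this is the maximin distance once [k] points have been chosen. *)
Definition level k : R := dist (x (o k)) (prefix k).

Lemma ordering_inj : injective o.
Proof. by have [/bij_inj] := Ho. Qed.

Lemma prefix_neq0 (k : 'I_#|I|) : (0 < k)%N -> prefix k !=set0.
Proof. by move=> k0; exists (x (o (Ordinal (ltn_trans k0 (ltn_ord k))))); left; exists (Ordinal (ltn_trans k0 (ltn_ord k))). Qed.

Lemma separation_le_level (k : 'I_#|I|) : (0 < k)%N -> separation <= level k.
Proof.
move=> k0; have neq (l : 'I_#|I|) : (l < k)%N -> o k != o l.
  by move=> lk; rewrite (inj_eq ordering_inj) eq_sym -val_eqE/= neq_ltn lk.
apply: dist_ge; first exact: prefix_neq0.
move=> y [[l /= lk <-]|yb].
  by apply: (le_trans (separation_le (neq _ lk))); apply: dist_le; left.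
have lk : (Ordinal (ltn_trans k0 (ltn_ord k)) < k)%N by [].
by apply: (le_trans (separation_le (neq _ lk))); apply: dist_le; right.
Qed.

(** At step [q] the point chosen was at least as far from the earlier ones as [x (o k)], whose
    distance only decreases as points are added. *)
Lemma level_separated (l q k : 'I_#|I|) : (l < q)%N -> (q <= k)%N ->
  level k <= enorm (x (o q) - x (o l)).
Proof.
move=> lq qk; have q0 : (0 < q)%N by exact: leq_ltn_trans lq.
apply: (@le_trans _ _ (dist (x (o q)) (prefix q))); last by apply: dist_le; left; exists l.
apply: (@le_trans _ _ (dist (x (o k)) (prefix q))).
  apply: dist_antitone; first exact: prefix_neq0.
  by move=> y [[p /= pq <-]|yb]; [left; exists p => //=; exact: leq_trans qk|right].
apply: Ho.2 => p pq; rewrite (inj_eq ordering_inj) eq_sym -val_eqE/= neq_ltn.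
by rewrite (leq_trans pq qk).
Qed.

Lemma level_cover (k : 'I_#|I|) i : (0 < k)%N -> dist (x i) (prefix k) <= level k.
Proof.
move=> k0; have [[l [lk ->]]|H] := pselect (exists l : 'I_#|I|, (l < k)%N /\ i = o l).
  apply: (@le_trans _ _ 0); last by apply: dist_ge0; exact: prefix_neq0.
  by rewrite -[0](@enorm0 R d) -[0 in leRHS](subrr (x (o l))); apply: dist_le; left; exists l.
apply: Ho.2 => l lk; apply/eqP => E; apply: H; by exists l.
Qed.

(** Two hops: from [y] to some point of the family or of the boundary within fill + level, then on
    to one of the first [k] points or the boundary within 2 level. As separation <= level, fill is
    at most level / dlt. Landing outside [A] is allowed, since test functions vanish there. *)
Lemma level_near (k : 'I_#|I|) dlt y : (0 < k)%N -> (1 < #|I|)%N -> A !=set0 ->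
  separation / fill = dlt ->
  exists2 z, (exists2 l : 'I_#|I|, (l < k)%N & z = x (o l)) \/ ~ A z &
             enorm (y - z) < (dlt^-1 + 3) * level k.
Proof.
move=> k0 I1 A0 E; have I0 : (0 < #|I|)%N by exact: ltnW.
have f0 := fill_gt0 I0 A0; have s0 := separation_gt0 I1.
have sl := separation_le_level k0; have l0 := lt_le_trans s0 sl.
have fl : fill <= dlt^-1 * level k.
  by rewrite -E invf_div mulrAC ler_pdivlMr// ler_pM2l.
have [yA|nyA] := pselect (A y); last first.
  exists y; first by right.
  rewrite subrr enorm0 mulr_gt0// addr_gt0// -E invr_gt0 divr_gt0//.
have [|z [[i _ <-]|zb] zy] := fill_near (r := fill + level k) I0 yA; first by rewrite ltrDl.
  have [|w [[l lk <-]|wb] zw] := @dist_lt _ _ (2 * level k) (x i) (prefix k) (prefix_neq0 k0).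
  - by rewrite (le_lt_trans (level_cover i k0))//; lra.
  - exists (x (o l)); first by left; exists l.
    by rewrite (le_lt_trans (enorm_dist_triangle _ (x i) _))//; lra.
  - exists w; first by right; exact: boundary_open.
    by rewrite (le_lt_trans (enorm_dist_triangle _ (x i) _))//; lra.
exists z; first by right; exact: boundary_open.
by lra.
Qed.

(** Packing of the first [k] points, which are separated by [level k / d] in some coordinate. The
    added 1 is absorbed by doubling the ratio, which is at least 1 because the level is at most the
    diameter bound. *)
Lemma level_count (k : 'I_#|I|) : (0 < k)%N -> 0 < level k ->
  k%:R <= (4 * R0 * d%:R / level k) ^+ d.
Proof.
move=> k0 l0; have dR : 0 < d%:R :> R by rewrite ltr0n.
have lb : level k <= d%:R * (2 * R0).
  apply: (@le_trans _ _ (enorm (x (o k) - x (o (Ordinal (ltn_trans k0 (ltn_ord k))))))).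
    exact: level_separated.
  by apply: (cube_enorm (c := 0)); exact: AR0.
pose P := [pred l : 'I_#|I| | (l < k)%N].
have cP : #|P| = k.
  have -> : #|P| = #|[set widen_ord (ltnW (ltn_ord k)) j | j : 'I_k]|.
    apply: eq_card => l; rewrite inE; apply/idP/imsetP => [lk|[j _ ->]]; last exact: (ltn_ord j).
    by exists (Ordinal lk) => //; apply/val_inj.
  by rewrite card_imset ?card_ord// => i j /(congr1 val)/= /val_inj.
have := @packing R d _ P (x \o o) 0 R0 (level k / d%:R).
rewrite cP divr_gt0// => /(_ isT (ltW R0_gt0) (fun j _ => AR0 (xA _))) H.
apply: le_trans (H _) _.
  move=> i j iP jP ij; apply: enorm_separated => //=.
  move: ij; rewrite -val_eqE/= neq_ltn => /orP[ij|ji].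
    by rewrite enorm_distC; apply: level_separated => //; exact: ltnW.
  by apply: level_separated => //; exact: ltnW.
have p0 : 0 <= 2 * R0 / (level k / d%:R) by rewrite divr_ge0 ?mulr_ge0 ?divr_ge0// ltW.
have -> : 4 * R0 * d%:R / level k = 2 * R0 / (level k / d%:R) * 2 by field; lra.
have p1 : 1 <= 2 * R0 / (level k / d%:R).
  by rewrite ler_pdivlMr ?divr_gt0// mul1r ler_pdivrMr//; lra.
move: p0 p1; set q := _ / _ => p0 p1.
by apply: lerXn2r; rewrite ?nnegrE; lra.
Qed.

End point_sets.

(** * Dual functionals and the Gram matrix of the Dirac functionals *)

Lemma le_of_cvg0 (R : realType) (a b K : R) (e : nat -> R) : e n @[n --> \oo] --> (0 : R) ->
  (forall n, a <= K * e n + b) -> a <= b.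
Proof.
move=> e0 H; rewrite -subr_le0; have C := @cvg_comb0 R K 0 e e e0 e0.
apply: (ler_cvg_to (@cvg_cst R (a - b) nat \oo _) C).
by apply: nearW => n; have := H n; rewrite mul0r addr0 lerBlDr.
Qed.

Section dual_facts.
Context {R : realType} {d : nat}.
Local Notation V := 'rV[R]_d.
Variables (A : set V) (s : nat).
Hypothesis oA : open A.
Implicit Types (f g : (V -> R) -> R) (u v w phi : V -> R).

Lemma H0_zero : H0 A s (fun=> 0).
Proof. by apply: H0_test => //; exact: test0. Qed.

Lemma H0_sum (T : Type) (r : seq T) (c : T -> R) (u : T -> V -> R) :
  (forall i, H0 A s (u i)) -> H0 A s (fun y => \sum_(i <- r) c i * u i y).
Proof.
move=> Hu; elim: r => [|i r IH].
  by under eq_fun do rewrite big_nil; exact: H0_zero.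
rewrite (_ : (fun y => _) = (fun y => c i * u i y + \sum_(j <- r) c j * u j y)).
  exact: (H0_comb (c i) oA (Hu i) IH).
by apply/funext => y; rewrite big_cons.
Qed.

Lemma Hdual_zero f : Hdual A s f -> f (fun=> 0) = 0.
Proof.
move=> [lf _]; have := lf 1 _ _ H0_zero H0_zero.
under [X in f X = _ -> _]eq_fun do rewrite mulr0 addr0.
by rewrite mul1r => /eqP; rewrite -subr_eq0 opprD addNKr oppr_eq0 => /eqP.
Qed.

Lemma Hdual_linear_sum f (T : Type) (r : seq T) (c : T -> R) (u : T -> V -> R) :
  Hdual A s f -> (forall i, H0 A s (u i)) ->
  f (fun y => \sum_(i <- r) c i * u i y) = \sum_(i <- r) c i * f (u i).
Proof.
move=> Hf Hu; elim: r => [|i r IH].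
  by under eq_fun do rewrite big_nil; rewrite big_nil Hdual_zero.
under eq_fun do rewrite big_cons.
by rewrite big_cons -IH Hf.1//; exact: H0_sum.
Qed.

Lemma Hdual_comb f g (c : R) : Hdual A s f -> Hdual A s g ->
  Hdual A s (fun v => c * f v + g v).
Proof.
move=> [lf [M fM]] [lg [N gN]]; split.
  by move=> a u v Hu Hv; rewrite lf// lg//; ring.
exists (`|c| * M + N) => v Hv; rewrite mulrDl (le_trans (ler_normD _ _))//.
by rewrite lerD ?gN// normrM -mulrA ler_wpM2l// fM.
Qed.

Lemma Hdual_cst0 : Hdual A s (fun=> 0).
Proof.
split; first by move=> *; rewrite mulr0 addr0.
by exists 0 => v _; rewrite normr0 mul0r.
Qed.

Lemma Hdual_sum (T : Type) (r : seq T) (c : T -> R) (F : T -> (V -> R) -> R) :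
  (forall i, Hdual A s (F i)) -> Hdual A s (fun v => \sum_(i <- r) c i * F i v).
Proof.
move=> HF; elim: r => [|i r IH].
  by under eq_fun do rewrite big_nil; exact: Hdual_cst0.
under eq_fun do rewrite big_cons; exact: Hdual_comb.
Qed.

(** Approximate [v] by test functions. The uncontrolled bound [M] of [f] only multiplies the error,
    which tends to 0; the 2 is that of [Hnorm_comb]. *)
Lemma Hdual_le_of_test f (B : R) : Hdual A s f -> 0 <= B ->
  (forall phi, test A phi -> `|f phi| <= B * Hnorm A s phi) ->
  forall v, H0 A s v -> `|f v| <= 2 * B * Hnorm A s v.
Proof.
move=> [lf [M fM]] B0 fB v Hv; have [Hsv [p [tp pv]]] := Hv.
pose e n := Hnorm A s (fun x => v x - p n x).
have Hp n : H0 A s (p n) by exact: H0_test.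
have H0e n : H0 A s (fun x => v x - p n x).
  have := H0_comb (-1) oA (Hp n) Hv.
  by rewrite (_ : (fun x => -1 * _ + _) = (fun x => v x - p n x))//; apply/funext => x; rewrite mulN1r addrC.
have key n : `|f v| <= (M + 2 * B) * e n + 1 * (2 * B * Hnorm A s v).
  have E1 : f v = f (fun x => v x - p n x) + f (p n).
    have := lf 1 _ _ (H0e n) (Hp n); rewrite mul1r => <-; congr f.
    by apply/funext => x; rewrite mul1r subrK.
  have : Hnorm A s (p n) <= 2 * e n + 2 * Hnorm A s v.
    have := Hnorm_comb (-1) oA (H0e n).1 Hsv; rewrite normrN1 mulr1.
    rewrite (_ : (fun x => -1 * _ + _) = p n)//; apply/funext => x; ring.
  have := fM _ (H0e n); have := fB _ (tp n); rewrite -/(e n) E1 => h1 h2 h3.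
  apply: (le_trans (ler_normD _ _)).
  apply: (@le_trans _ _ (M * e n + B * (2 * e n + 2 * Hnorm A s v))); last first.
    by rewrite le_eqVlt; apply/orP; left; apply/eqP; ring.
  by apply: lerD => //; apply: (le_trans h1); rewrite ler_wpM2l.
apply: (@le_of_cvg0 R _ _ (M + 2 * B) e pv) => n.
by have := key n; rewrite mul1r.
Qed.

(* Without a Dirac functional, [delta] and hence [green] would be 0. *)
Lemma delta_green_gt0 L x : 0 < green A s L x x ->
  Hdual A s (delta A s x) /\ forall phi, test A phi -> delta A s x phi = phi x.
Proof.
move=> g0; have [[f Hf]|H] := pselect (exists f, Hdual A s f /\ forall phi, test A phi -> f phi = phi x).
  exact: (@xgetPex _ (fun=> 0) [set f | Hdual A s f /\ forall phi, test A phi -> f phi = phi x] (ex_intro _ f Hf)).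
move: g0; rewrite /green {1}/delta xgetPN ?ltxx// => f Hf; apply: H; by exists f.
Qed.

Variables (L : (V -> R) -> (V -> R) -> R) (normL normLinv : R).
Hypothesis linL : linear_operator A s L.
Hypothesis bijL : bijective_operator A s L.
Hypothesis symL : symmetric_operator A s L.
Hypothesis posL : positive_operator A s L.
Hypothesis normLE : operator_norm A s L = normL%:E.
Hypothesis normLinvE : inv_operator_norm A s L = normLinv%:E.

Lemma inv_operatorP f : Hdual A s f ->
  H0 A s (inv_operator A s L f) /\ forall v, H0 A s v -> L (inv_operator A s L f) v = f v.
Proof.
move=> /bijL.2 [u Hu Lu].
exact: (@xgetPex _ (fun=> 0) [set u | H0 A s u /\ forall v, H0 A s v -> L u v = f v] (ex_intro _ u (conj Hu Lu))).
Qed.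

(** Dividing [f] by [B] puts it in the dual unit ball, where [normLinv] bounds the preimage; one
    factor [B] is from this scaling, the other from applying [f]. *)
Lemma inv_operator_bound f w (B : R) : Hdual A s f -> 0 < B ->
  (forall v, H0 A s v -> `|f v| <= B * Hnorm A s v) ->
  H0 A s w -> (forall v, H0 A s v -> L w v = f v) -> f w <= normLinv * B ^+ 2.
Proof.
move=> Hf B0 fB Hw Lw.
pose g v := B^-1 * f v + 0.
have Hg : Hdual A s g by exact: (Hdual_comb B^-1 Hf Hdual_cst0).
have [Hw' Lw'] := inv_operatorP Hg.
have g1 : (dual_norm A s g <= 1)%E.
  apply: ge_ereal_sup => _ [v [Hv v1] <-]; rewrite lee_fin /g addr0 normrM.
  rewrite gtr0_norm ?invr_gt0// mulrC ler_pdivrMr// mul1r.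
  by apply: (le_trans (fB v Hv)); rewrite ler_piMr// ltW.
have nw' : Hnorm A s (inv_operator A s L g) <= normLinv.
  rewrite -lee_fin -normLinvE; apply: ereal_sup_ubound; by exists g.
(* Both sides are evaluations of the form at [w] and the chosen preimage of [g]; symmetry compares
   them without identifying [w] with that choice. *)
have E : f w = B * f (inv_operator A s L g).
  have := Lw _ Hw'; rewrite (symL Hw Hw') (Lw' _ Hw) /g addr0 => <-.
  by rewrite mulrA mulfV ?mul1r//; exact: lt0r_neq0.
rewrite E; apply: (@le_trans _ _ (B * (B * normLinv))).
  rewrite ler_pM2l// (le_trans (ler_norm _))// (le_trans (fB _ Hw'))// ler_pM2l//.
by rewrite le_eqVlt; apply/orP; left; apply/eqP; ring.
Qed.

Lemma operator_form_le u : H0 A s u -> Hnorm A s u <= 1 -> L u u <= normL.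
Proof.
move=> Hu u1; rewrite -lee_fin -normLE.
apply: (@le_trans _ _ (dual_norm A s (L u))); last by apply: ereal_sup_ubound; exists u.
apply: (@le_trans _ _ `|L u u|%:E); first by rewrite lee_fin ler_norm.
by apply: ereal_sup_ubound; exists u.
Qed.

Section gram.
Variables (n : nat) (p : 'I_n -> V).
Let Theta : 'M[R]_n := \matrix_(i, j) green A s L (p i) (p j).
Hypothesis Theta_gt0 : forall i, 0 < Theta i i.

Let delta_p i : Hdual A s (delta A s (p i)) /\ forall phi, test A phi -> delta A s (p i) phi = phi (p i).
Proof. by apply: (@delta_green_gt0 L); have := Theta_gt0 i; rewrite mxE. Qed.

Variable c : 'cV[R]_n.

(** [w] is a preimage of [f] under the operator, so [f w] is both the energy of [w] and, by [fw],
    the quadratic form of [Theta] at [c]. *)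
Let f v := \sum_i c i ord0 * delta A s (p i) v.
Let u i := inv_operator A s L (delta A s (p i)).
Let w y := \sum_i c i ord0 * u i y.

Let Hu i : H0 A s (u i). Proof. exact: (inv_operatorP (delta_p i).1).1. Qed.
Let Hw : H0 A s w. Proof. exact: H0_sum. Qed.
Let Hf : Hdual A s f. Proof. by apply: Hdual_sum => i; exact: (delta_p i).1. Qed.

Let Lw v : H0 A s v -> L w v = f v.
Proof.
move=> Hv; have [Ld _ _] := linL.
rewrite (symL Hw Hv) (Hdual_linear_sum _ (fun i => c i ord0) (Ld v Hv) Hu).
apply: eq_bigr => i _; congr (_ * _); rewrite (symL Hv (Hu i)).
exact: (inv_operatorP (delta_p i).1).2 Hv.
Qed.

Let fw : f w = quad Theta c.
Proof.
rewrite quad_sum; apply: eq_bigr => i _.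
rewrite (Hdual_linear_sum _ (fun i => c i ord0) (delta_p i).1 Hu).
by rewrite mulr_sumr; apply: eq_bigr => j _; rewrite mxE mulrA.
Qed.

Let f_test phi : test A phi -> f phi = \sum_i c i ord0 * phi (p i).
Proof. by move=> tp; apply: eq_bigr => i _; rewrite (delta_p i).2. Qed.

Lemma gram_upper (B : R) : 0 < B ->
  (forall phi, test A phi -> `|\sum_i c i ord0 * phi (p i)| <= B * Hnorm A s phi) ->
  quad Theta c <= normLinv * (2 * B) ^+ 2.
Proof.
move=> B0 H; rewrite -fw; have B20 : 0 < 2 * B by rewrite mulr_gt0.
have fB phi : test A phi -> `|f phi| <= B * Hnorm A s phi.
  by move=> tp; rewrite f_test//; exact: H.
exact: (inv_operator_bound Hf B20 (Hdual_le_of_test Hf (ltW B0) fB) Hw Lw).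
Qed.

(** The sum is [L w phi]; apply Cauchy-Schwarz for the positive form and bound [L phi phi] by the
    operator norm. *)
Lemma gram_lower phi : test A phi -> Hnorm A s phi <= 1 ->
  (\sum_i c i ord0 * phi (p i)) ^+ 2 <= quad Theta c * normL.
Proof.
move=> tp p1; have Hp := H0_test s oA tp; rewrite -f_test// -Lw//.
have a0 : 0 <= L w w by exact: posL.
have c0 : 0 <= L phi phi by exact: posL.
rewrite -fw -Lw//; apply: (@le_trans _ _ (L w w * L phi phi)); last first.
  by apply: ler_wpM2l => //; exact: operator_form_le.
apply: bilinear_schwarz => // t.
have Hc := H0_comb t oA Hw Hp; have [Ld _ Ll] := linL.
have := posL Hc; rewrite Ll// (Ld w Hw).1// (Ld phi Hp).1// (symL Hp Hw).
by congr (_ <= _); ring.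
Qed.

End gram.
End dual_facts.

Section sampling_sum.
Context {R : realType} {d : nat}.
Local Notation V := 'rV[R]_d.
Local Notation mu := (lebesgue_rV d : {sigma_finite_measure set V -> \bar R}).
Variables (A : set V) (s : nat).
Hypothesis oA : open A.

Lemma energy_integral_le phi : test A phi ->
  (\int[mu]_y (energy phi s y)%:E <= ((size (words (d := d) s))%:R * Hnorm A s phi ^+ 2)%:E)%E.
Proof.
move=> tp; have [sp _ _] := tp; rewrite /energy.
have c l : continuous (fun y => iter_deriv l phi y ^+ 2).
  by move=> x; have c := @smooth_iter_continuous _ _ l _ sp x; exact: (continuousM c c).
have -> : (\int[mu]_y (\sum_(l <- words s) iter_deriv l phi y ^+ 2)%:E =
   \sum_(l <- words s) \int[mu]_y (iter_deriv l phi y ^+ 2)%:E)%E.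
  rewrite -ge0_integral_sum//; last 2 first.
  - by move=> l; apply/measurable_EFinP; apply: continuous_measurable_rV.
  - by move=> l y _; rewrite lee_fin sqr_ge0.
  by apply: eq_integral => y _; rewrite sumEFin.
have H l : l \in words s -> (\int[mu]_y (iter_deriv l phi y ^+ 2)%:E <= (Hnorm A s phi ^+ 2)%:E)%E.
  move=> lw; have := energy_le_Hnorm oA tp (size_words lw).
  rewrite Rintegral_support; last first.
    by move=> x nx; rewrite (test_out (test_iter_deriv l tp) nx) expr0n.
  have sl : smooth (iter_deriv l phi) by have [] := test_iter_deriv l tp.
  have := integrable_test (testM (test_iter_deriv l tp) sl).
  rewrite /Rintegral -lee_fin => /integrableP[_ Ioo]; rewrite fineK// ge0_fin_numE.
    apply: le_lt_trans Ioo; rewrite le_eqVlt; apply/orP; left; apply/eqP.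
    by apply: eq_integral => y _ /=; rewrite -expr2 ger0_norm ?sqr_ge0.
  by apply: integral_ge0 => y _; rewrite lee_fin sqr_ge0.
move: (Hnorm A s phi ^+ 2) H => h; elim: (words s) => [|l r IH] H.
  by rewrite big_nil mul0r.
rewrite big_cons /= -natr1 mulrDl mul1r EFinD addeC; apply: leeD.
  by apply: H; rewrite inE eqxx.
by apply: IH => l' lr; apply: H; rewrite inE lr orbT.
Qed.

Hypothesis s_large : (d < 2 * s)%N.

Lemma sampling_sum (J B : finType) (P : {pred J}) (p : J -> V) (r t : R)
    (zz : J -> B -> V) (w : J -> B -> R) phi :
  test A phi -> 0 < r -> 0 < t ->
  (forall i j, i \in P -> j \in P -> i != j -> exists a, t <= `|p i ord0 a - p j ord0 a|) ->
  (forall j b, j \in P -> cube (p j) r (zz j b)) ->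
  (forall j, j \in P -> \sum_b `|w j b| <= 2) ->
  (forall j y l, j \in P -> (size l < s)%N -> monv (y - p j) l = \sum_b w j b * monv (y - zz j b) l) ->
  (2 * r) ^+ d * \sum_(j in P) (phi (p j) - \sum_b w j b * phi (zz j b)) ^+ 2 <=
  36 * (size (words (d := d) s))%:R * (2 * r) ^+ (2 * s) *
    ((2 * r / t + 1) ^+ d * ((size (words (d := d) s))%:R * Hnorm A s phi ^+ 2)).
Proof.
move=> tp r0 t0 sep zr w2 we; have [sp _ _] := tp.
set W := (size _)%:R; have W0 : 0 <= W by rewrite /W.
have c0 : 0 <= 36 * W * (2 * r) ^+ (2 * s) by rewrite !mulr_ge0// exprn_ge0// mulr_ge0// ltW.
have p0 : 0 <= (2 * r / t + 1) ^+ d by rewrite exprn_ge0// addr_ge0// divr_ge0 ?mulr_ge0// ltW.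
rewrite -lee_fin mulr_sumr -sumEFin.
apply: (@le_trans _ _ (\sum_(j in P) ((36 * W * (2 * r) ^+ (2 * s))%:E * \int[mu]_(y in cube (p j) r) (energy phi s y)%:E))%E).
  apply: lee_sum => j jP; apply: sampling_inequality => //.
  - by move=> a; rewrite subrr normr0.
  - by move=> b; exact: zr.
  - exact: w2.
  - by move=> y l ls; exact: we.
rewrite -ge0_sume_distrr; last by move=> j _; apply: integral_ge0 => y _; rewrite lee_fin energy_ge0.
rewrite [leRHS]EFinM; apply: lee_wpmul2l; first by rewrite lee_fin.
rewrite EFinM; apply: le_trans (lee_wpmul2l _ (energy_integral_le tp)); last by rewrite lee_fin.
apply: overlap_integral => //; first exact: ltW.
- exact: energy_ge0.
- by apply/measurable_EFinP; apply: continuous_measurable_rV; exact: energy_continuous.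
Qed.

End sampling_sum.

Section test_function.
Context {R : realType} {d : nat}.
Local Notation V := 'rV[R]_d.

(** Chosen from the domain and [s] alone, so that [r] and [c] may enter the final constant. *)
Lemma positive_test_exists (A : set V) s : open A -> A !=set0 ->
  exists phi z (r c : R), [/\ test A phi, Hnorm A s phi <= 1, 0 < r, 0 < c &
    cube z r `<=` A /\ forall y, cube z r y -> c <= phi y].
Proof.
move=> oA [z Az]; have /open_cubeP oA' := oA; have [r r0 rA] := oA' _ Az.
pose a : V := \row_i (z ord0 i - r / 2); pose b : V := \row_i (z ord0 i + r / 2).
have [n n0] : exists n, 0 < bump n a b z.
  have := @bump_cvg R d a b z.
  have -> : \1_(box a b) z = 1 :> R.
    by rewrite indicE mem_set// => i; rewrite !mxE; apply/andP; split; lra.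
  move=> /cvgr_gt /(_ 0 ltr01) [N _ H]; exists N; exact: H N (leqnn N).
have tb : test A (bump n a b).
  apply: test_bump => x xab; apply: rA => i; have := xab i; rewrite !mxE ltr_distlC.
  by move=> /andP[h1 h2]; apply/andP; split; lra.
(* [Hnorm_comb] gives scaling up to a factor 2; the 1 keeps the denominator positive. *)
pose K := (2 * Hnorm A s (bump n a b) + 1)^-1.
have H0' := Hnorm_ge0 A s (bump n a b).
have K0 : 0 < K by rewrite invr_gt0; lra.
have tK := testZ K tb.
have mA := open_measurable_rV oA.
have cK : nbhs z [set y | K * bump n a b z / 2 < K * bump n a b y].
  have sK : smooth (fun x => K * bump n a b x) by have [] := tK.
  have /cvgr_gt := @smooth_continuous R d _ sK z; apply.
  by rewrite ltr_pdivrMr// ltr_pMr ?mulr_gt0// ltr1n.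
have [r' r'0 r'K] := (nbhs_cubeP _ _).1 cK.
exists (fun x => K * bump n a b x), z, (Num.min r r'), (K * bump n a b z / 2).
have sub (r1 r2 : R) : r1 <= r2 -> cube z r1 `<=` cube z r2.
  by move=> h y yc i; exact: lt_le_trans (yc i) h.
split=> //.
- have := Hnorm_comb K oA (test_Hs s mA tb) (test_Hs s mA (test0 A)).
  rewrite Hnorm0// mulr0 addr0 (_ : (fun x => _ + 0) = (fun x => K * bump n a b x)); last first.
    by apply/funext => x; rewrite addr0.
  move=> /le_trans -> //; rewrite gtr0_norm// mulrAC /K ler_pdivrMr; lra.
- by rewrite lt_min r0.
- by rewrite divr_gt0// mulr_gt0.
- split; first by apply: subset_trans rA; apply: sub; rewrite ge_min lexx.
  move=> y yc; apply/ltW; apply: r'K; apply: sub yc; by rewrite ge_min lexx orbT.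
Qed.

End test_function.

(** * Decay of the Cholesky error *)

Section node_coefficients.
Context {R : realType} {d n : nat} {B : finType}.
Local Notation V := 'rV[R]_d.
Variables (k : nat) (p : 'I_n -> V) (v : 'cV[R]_n) (zz : 'I_n -> B -> V) (w : 'I_n -> B -> R).
Hypothesis p_inj : injective p.

(* The sum over [j >= k] of [v_j] times the sampling error at [p j], written on
   the points; nodes that are none of the first [k] points are dropped. *)
Definition node_coefficients : 'cV[R]_n := \col_i
  (if (k <= i)%N then v i ord0
   else - \sum_(j < n | (k <= j)%N) v j ord0 * \sum_b w j b * (zz j b == p i)%:R).

Lemma node_coefficients_sum (phi : V -> R) :
  (forall (j : 'I_n) b, (k <= j)%N -> (exists2 l : 'I_n, (l < k)%N & zz j b = p l) \/ phi (zz j b) = 0) ->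
  \sum_i node_coefficients i ord0 * phi (p i) =
  \sum_(j < n | (k <= j)%N) v j ord0 * (phi (p j) - \sum_b w j b * phi (zz j b)).
Proof.
(* A node equal to one of the first [k] points is hit by exactly one index, as [p] is injective; at
   any other node [phi] is 0, so dropping it changes nothing. *)
move=> H; have E (j : 'I_n) b : (k <= j)%N ->
    \sum_(i < n | ~~ (k <= i)%N) (zz j b == p i)%:R * phi (p i) = phi (zz j b).
  move=> kj; have [[l lk zl]|z0] := H j b kj; last first.
    by rewrite big1 ?z0// => i _; case: eqP => [<-|_]; rewrite ?z0 ?mulr0 ?mul0r.
  rewrite (bigD1 l) -?ltnNge//= {1}zl eqxx mul1r zl big1 ?addr0// => i /andP[_ il].
  by rewrite (inj_eq p_inj) eq_sym (negbTE il) mul0r.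
rewrite (bigID (fun i : 'I_n => (k <= i)%N))/=; under [RHS]eq_bigr do rewrite mulrBr.
rewrite sumrB; congr (_ + _); first by apply: eq_bigr => i ki; rewrite mxE ki.
rewrite (eq_bigr (fun i => - \sum_(j < n | (k <= j)%N) \sum_b v j ord0 * (w j b * ((zz j b == p i)%:R * phi (p i))))); last first.
  move=> i /negbTE ki; rewrite mxE ki mulNr mulr_suml; congr (- _).
  by apply: eq_bigr => j _; rewrite mulr_sumr mulr_suml; apply: eq_bigr => b _; rewrite !mulrA.
rewrite sumrN exchange_big/=; congr (- _); apply: eq_bigr => j kj.
rewrite exchange_big/= mulr_sumr; apply: eq_bigr => b _.
by rewrite -!mulr_sumr E.
Qed.

End node_coefficients.

Section upper_bound.
Context {R : realType} {d s : nat}.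
Local Notation V := 'rV[R]_d.

(** [K] is fixed before the domain, the operator and the points; the dependence on [normLinv] and
    [dlt] is explicit in the bound. *)
Lemma quad_upper_bound : (0 < d)%N -> (d < 2 * s)%N -> exists2 K : R, 0 < K &
  forall (A : set V) (R0 : R) (L : (V -> R) -> (V -> R) -> R) (normLinv dlt : R),
  open A -> A !=set0 -> A `<=` cube 0 R0 ->
  linear_operator A s L -> bijective_operator A s L -> symmetric_operator A s L ->
  inv_operator_norm A s L = normLinv%:E ->
  forall (I : finType) (x : I -> V), injective x -> (forall i, A (x i)) ->
  forall o : 'I_#|I| -> I, maximin_ordering A x o ->
  separation A x / fill A x = dlt ->
  let T : 'M[R]_#|I| := \matrix_(i, j) green A s L (x (o i)) (x (o j)) in
  (forall i, 0 < T i i) ->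
  forall k : 'I_#|I|, (0 < k)%N -> forall v : 'cV[R]_#|I|,
  exists2 c : 'cV[R]_#|I|, (forall i : 'I_#|I|, (k <= i)%N -> c i ord0 = v i ord0) &
    quad T c <= `|normLinv| * K * ((dlt^-1 + 3) * level A x o k) ^+ (2 * s) / separation A x ^+ d * dotp v^T v^T.
Proof.
move=> d0 ds; have s0 : (0 < s)%N by case: s ds.
have [eps /andP[eps0 eps1] we] := @weights_exist R d s s0.
pose W : R := (size (words (d := d) s)).+1%:R.
have W0 : 0 < W by rewrite /W ltr0n.
(* 144 is 36 from the sampling inequality times 4 from [gram_upper]; one [W] is from sampling, the
   other from [energy_integral_le]; [2 * d] is from the overlap and [2 * s / eps] is the cube side
   in units of [rho]. *)
exists (144 * W ^+ 2 * (2 * d%:R) ^+ d * (2 * s%:R / eps) ^+ (2 * s)).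
  by rewrite !mulr_gt0 ?exprn_gt0 ?divr_gt0 ?mulr_gt0 ?ltr0n.
move=> A R0 L normLinv dlt oA A0 AR linL bijL symL nLi I x xinj xA o Ho dltE T T0 k k0 v.
have I1 : (1 < #|I|)%N by apply: leq_ltn_trans (ltn_ord k).
set h := separation A x; have h0 : 0 < h := separation_gt0 oA xinj xA I1.
have f0 : 0 < fill A x := fill_gt0 d0 oA AR xA (ltnW I1) A0.
have dlt0 : 0 < dlt by rewrite -dltE divr_gt0.
have hl : h <= level A x o k := separation_le_level Ho k0.
have l0 := lt_le_trans h0 hl.
set rho := _ * level A x o k.
have rl : level A x o k <= rho.
  have i0 : 0 < dlt^-1 by rewrite invr_gt0.
  by rewrite /rho ler_peMl ?(ltW l0)//; move: (dlt^-1) i0 => q q0; lra.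
have rho0 : 0 < rho := lt_le_trans l0 rl.
(* With this grid step a displacement of [rho] is the tolerated [eps * u]. Nodes then stay within (s
   - 1) u + rho <= s u of the point, whence the cube radius [r] below. *)
pose u := rho / eps; have u0 : 0 < u by rewrite divr_gt0.
have epsu : eps * u = rho by rewrite /u mulrC divfK// gt_eqF.
pose r := s%:R * u.
have sR : 1 <= s%:R :> R by rewrite ler1n.
have ur : u <= r by rewrite /r ler_peMl// ltW.
have ru : rho <= u by rewrite -epsu ler_piMl ?ltW.
have r0 : 0 < r := lt_le_trans u0 ur.
pose p i := x (o i).
have pinj : injective p by move=> i j /xinj /(ordering_inj Ho).
pose node (j : 'I_#|I|) (b : {ffun 'I_d -> 'I_s}) : V := \row_i (p j ord0 i + u * (b i)%:R).
have near j b : exists z, ((exists2 l : 'I_#|I|, (l < k)%N & z = p l) \/ ~ A z) /\ enorm (node j b - z) < rho.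
  have [z zP zn] := level_near d0 oA AR xinj xA Ho (node j b) k0 I1 A0 dltE.
  by exists z.
pose zz j b := sval (cid (near j b)).
have zzP j b : (exists2 l : 'I_#|I|, (l < k)%N & zz j b = p l) \/ ~ A (zz j b).
  by rewrite /zz; case: cid => z [].
have zzn j b i : `|zz j b ord0 i - (p j ord0 i + u * (b i)%:R)| < rho.
  have h1 : enorm (node j b - zz j b) < rho by rewrite /zz; case: cid => z [].
  by have := enorm_cube h1 i; rewrite mxE.
have wex j : exists w : {ffun 'I_d -> 'I_s} -> R, \sum_b `|w b| <= 2 /\
   forall y l, (size l < s)%N -> monv (y - p j) l = \sum_b w b * monv (y - zz j b) l.
  by apply: (we (p j) u) => // b i; rewrite epsu; exact/ltW/zzn.
pose w j := sval (cid (wex j)).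
have w2 j : \sum_b `|w j b| <= 2 by rewrite /w; case: cid => ? [].
have wE j y l : (size l < s)%N -> monv (y - p j) l = \sum_b w j b * monv (y - zz j b) l.
  by rewrite /w; case: cid => ? [] /= _; apply.
exists (node_coefficients k p v zz w); first by move=> i ki; rewrite mxE ki.
have vv0 := dotpp_ge0 v^T.
(* [gram_upper] needs a positive bound [B], so the zero vector is treated apart. *)
have [vz|vnz] := eqVneq (dotp v^T v^T) 0.
  rewrite vz mulr0 (_ : node_coefficients _ _ _ _ _ = 0); last first.
    have v0 : v = 0.
      by have := enorm_sqr v^T; rewrite vz => /eqP; rewrite sqrf_eq0 => /eqP/enorm_eq0/(congr1 trmx); rewrite trmxK trmx0.
    apply/colP => i; rewrite !mxE v0; case: ifP => _; rewrite ?mxE//.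
    by rewrite big1 ?oppr0// => j _; rewrite mxE mul0r.
  by rewrite quad_sum big1// => i _; rewrite big1// => j _; rewrite mxE !mul0r.
pose K0 := 36 * W ^+ 2 * (2 * r) ^+ (2 * s) * (2 * d%:R / h) ^+ d.
have dR : 0 < d%:R :> R by rewrite ltr0n.
have r20 : 0 < 2 * r by rewrite mulr_gt0.
have dh0 : 0 < 2 * d%:R / h by rewrite divr_gt0// mulr_gt0.
have K00 : 0 < K0 by rewrite /K0 !mulr_gt0// exprn_gt0.
pose B := Num.sqrt (K0 * dotp v^T v^T).
have KB : 0 < K0 * dotp v^T v^T by rewrite mulr_gt0// lt_neqAle eq_sym vnz.
have B0 : 0 < B by rewrite sqrtr_gt0.
have B2 : B ^+ 2 = K0 * dotp v^T v^T by rewrite sqr_sqrtr// ltW.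
have G := @gram_upper R d A s oA L normLinv linL bijL symL nLi _ p T0 (node_coefficients k p v zz w) B B0.
apply: le_trans (G _) _ => [phi tp|]; last first.
  rewrite exprMn B2; apply: (@le_trans _ _ (`|normLinv| * (2 ^+ 2 * (K0 * dotp v^T v^T)))).
    by rewrite ler_wpM2r ?ler_norm// mulr_ge0// ltW.
  rewrite le_eqVlt; apply/orP; left; apply/eqP.
  rewrite /K0 /r /u !exprMn !exprVn; field; rewrite ?expf_neq0 ?gt_eqF//=.
rewrite node_coefficients_sum//; last first.
  by move=> j b _; have [?|nA] := zzP j b; [left|right; exact: test_out nA].
rewrite -(@ler_pXn2r _ 2)// ?nnegrE ?mulr_ge0 ?Hnorm_ge0// ?(ltW B0)//.
rewrite real_normK ?num_real// exprMn B2.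
(* Separates the entries of [v] from the sampling errors, which [sampling_sum] bounds in square
   sum. *)
apply: (le_trans (sum_schwarz _ _ _)).
rewrite mulrAC [leRHS]mulrC; apply: ler_pM.
- by apply: sumr_ge0 => j _; exact: sqr_ge0.
- by apply: sumr_ge0 => j _; exact: sqr_ge0.
- rewrite /dotp [leRHS](bigID (fun i : 'I_#|I| => (k <= i)%N))/=.
  under [X in _ <= X + _]eq_bigr do rewrite !mxE -expr2.
  by rewrite lerDl; apply: sumr_ge0 => j _; rewrite -expr2 sqr_ge0.
have sep i j : i \in [pred j : 'I_#|I| | (k <= j)%N] -> j \in [pred j : 'I_#|I| | (k <= j)%N] -> i != j ->
    exists a, h / d%:R <= `|p i ord0 a - p j ord0 a|.
  move=> _ _ ij; apply: enorm_separated => //.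
  have oij : o i != o j by rewrite (inj_eq (ordering_inj Ho)).
  by apply: (le_trans (separation_le A x oij)); apply: dist_le; left.
have zr j b : j \in [pred j : 'I_#|I| | (k <= j)%N] -> cube (p j) r (zz j b).
  move=> _ i; have := zzn j b i; rewrite !ltr_norml.
  have bs : (b i)%:R * u + u <= r.
    by rewrite -[X in _ + X]mul1r -mulrDl natr1 /r ler_pM2r// ler_nat ltn_ord.
  have bu : 0 <= u * (b i)%:R by rewrite mulr_ge0// ltW.
  by move=> /andP[h1 h2]; apply/andP; split; lra.
have t0 : 0 < h / d%:R by rewrite divr_gt0.
have S := sampling_sum oA ds tp r0 t0 sep zr (fun j _ => w2 j) (fun j y l _ => @wE j y l).
have r2 : 0 < (2 * r) ^+ d by rewrite exprn_gt0// mulr_gt0.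
rewrite -(ler_pM2l r2); apply: (le_trans S).
set N2 := Hnorm A s phi ^+ 2; have N20 : 0 <= N2 by exact: sqr_ge0.
set W' := (size _)%:R; have W'0 : 0 <= W' by rewrite /W'.
have W'W : W' <= W by rewrite /W' /W ler_nat.
have q1 : 1 <= 2 * r / (h / d%:R).
  rewrite ler_pdivlMr// mul1r ler_pdivrMr//.
  have hr : h <= r by rewrite (le_trans hl)// (le_trans rl)// (le_trans ru).
  have d1 : 1 <= d%:R :> R by rewrite ler1n.
  by rewrite (le_trans hr)// -[leLHS]mulr1 ler_pM ?(ltW r0)//; lra.
have E1 : (2 * r / (h / d%:R) + 1) ^+ d <= (2 * r) ^+ d * (2 * d%:R / h) ^+ d.
  rewrite -exprMn (_ : 2 * r * (2 * d%:R / h) = 2 * r / (h / d%:R) + 2 * r / (h / d%:R)).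
    by apply: lerXn2r; rewrite ?nnegrE; lra.
  by field; rewrite !gt_eqF.
have c0 : 0 <= 36 * (2 * r) ^+ (2 * s) * N2.
  by apply: mulr_ge0 => //; apply: mulr_ge0 => //; exact: exprn_ge0 (ltW r20).
have E2 : W' ^+ 2 * (2 * r / (h / d%:R) + 1) ^+ d <= W ^+ 2 * ((2 * r) ^+ d * (2 * d%:R / h) ^+ d).
  apply: ler_pM => //; first exact: sqr_ge0.
  - by rewrite exprn_ge0//; lra.
  - by apply: lerXn2r; rewrite ?nnegrE// ltW.
have := ler_wpM2l c0 E2; rewrite /K0; move: ((2 * r / _ + 1) ^+ d) => Q.
move: ((2 * r) ^+ (2 * s)) ((2 * r) ^+ d) ((2 * d%:R / h) ^+ d) => a b c H.
apply: le_trans (le_trans H _); rewrite le_eqVlt; apply/orP; left; apply/eqP; ring.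
Qed.

End upper_bound.

Section lower_bound.
Context {R : realType} {d s : nat}.
Local Notation V := 'rV[R]_d.

(** The indicator of the points in the cube has squared norm equal to their number and pairs with
    [phi] to at least [c] times it; one factor of the number cancels. *)
Lemma opnorm_lower_bound (A : set V) L (normL : R) (n : nat) (p : 'I_n -> V) (phi : V -> R)
    (z : V) (r c : R) :
  open A -> linear_operator A s L -> bijective_operator A s L -> symmetric_operator A s L ->
  positive_operator A s L -> operator_norm A s L = normL%:E -> 
  test A phi -> Hnorm A s phi <= 1 -> 0 < c -> (forall y, cube z r y -> c <= phi y) ->
  let T : 'M[R]_n := \matrix_(i, j) green A s L (p i) (p j) in
  (forall i, 0 < T i i) ->
  c ^+ 2 * #|[pred i | p i \in cube z r]|%:R <= opnorm T * `|normL|.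
Proof.
move=> oA linL bijL symL posL nL tp p1 c0 cphi T T0; set P := [pred i | _].
pose e : 'cV[R]_n := \col_i (i \in P)%:R.
have ee : dotp e^T e^T = #|P|%:R.
  rewrite /dotp -sum1_card natr_sum [RHS]big_mkcond/=; apply: eq_bigr => i _.
  by rewrite !mxE -natrM mulnb andbb; case: (i \in P).
have [P0|P0] := posnP #|P|; first by rewrite P0 mulr0 mulr_ge0 ?opnorm_ge0.
have PR : 0 < #|P|%:R :> R by rewrite ltr0n.
have G := @gram_lower R d A s oA L normL linL bijL symL posL nL n p T0 e phi tp p1.
have S : c * #|P|%:R <= \sum_i e i ord0 * phi (p i).
  rewrite -sum1_card natr_sum mulr_sumr big_mkcond/=; apply: ler_sum => i _; rewrite mxE.
  case: ifPn => [iP|_]; last by rewrite mul0r.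
  by rewrite mulr1 mul1r; apply: cphi; move: iP; rewrite -topredE /= => /set_mem.
have Q := quad_le_opnorm T e; rewrite ee in Q.
have : (c * #|P|%:R) ^+ 2 <= opnorm T * `|normL| * #|P|%:R.
  apply: (@le_trans _ _ ((\sum_i e i ord0 * phi (p i)) ^+ 2)).
    by apply: lerXn2r; rewrite ?nnegrE ?(le_trans _ S)// mulr_ge0// ltW.
  have Hp := H0_test s oA tp.
  have normL0 : 0 <= normL := le_trans (posL _ Hp) (operator_form_le nL Hp p1).
  by apply: (le_trans G); rewrite (ger0_norm normL0) mulrAC ler_wpM2r.
by rewrite exprMn [X in _ * X]expr2 mulrA ler_pM2r.
Qed.

End lower_bound.

Section rates.
Context {R : realType}.

Lemma powR_decay (a : R) (k d s : nat) : 0 < a -> (0 < k)%N -> (0 < d)%N -> k%:R <= a ^+ d ->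
  (a ^+ (2 * s))^-1 <= k%:R `^ (- (2 * s%:R / d%:R)).
Proof.
move=> a0 k0 d0 ka; have kR : 0 < k%:R :> R by rewrite ltr0n.
have dR : 0 < d%:R :> R by rewrite ltr0n.
rewrite powRN lef_pV2 ?posrE ?powR_gt0 ?exprn_gt0//.
have e0 : 0 <= 2 * s%:R / d%:R :> R by rewrite divr_ge0// mulr_ge0.
apply: (@le_trans _ _ ((a ^+ d) `^ (2 * s%:R / d%:R))).
  by apply: ge0_ler_powR; rewrite ?nnegrE// exprn_ge0// ltW.
rewrite -powR_mulrn ?(ltW a0)// -powRrM -powR_mulrn ?(ltW a0)//.
by rewrite mulrC divfK ?gt_eqF// natrM.
Qed.

(** A diagonal entry is the squared norm of a row of [L]. Through [delta_green_gt0] this yields the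
    Dirac functionals. *)
Lemma cholesky_diag_gt0 n (T L : 'M[R]_n) : cholesky_factor T L -> forall i, 0 < T i i.
Proof.
move=> [_ L0 <-] i; rewrite mxE (bigD1 i)//= mxE ltr_pwDl//; first by rewrite mulr_gt0 ?L0.
by apply: sumr_ge0 => j _; rewrite mxE -expr2 sqr_ge0.
Qed.

End rates.

Theorem theorem2p3 (R : realType) (d s : nat) (Omega : set 'rV[R]_d)
    (normL normLinv dlt : R) :
  (0 < d)%N -> (d < 2 * s)%N -> bounded_lipschitz_domain Omega ->
  exists2 C : R, 0 < C &
  forall L : ('rV[R]_d -> R) -> ('rV[R]_d -> R) -> R,
    linear_operator Omega s L -> bijective_operator Omega s L ->
    symmetric_operator Omega s L -> positive_operator Omega s L ->
    local_operator Omega s L ->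
    operator_norm Omega s L = normL%:E ->
    inv_operator_norm Omega s L = normLinv%:E ->
  forall (I : finType) (x : I -> 'rV[R]_d),
    injective x -> (forall i, Omega (x i)) -> homogeneity Omega x = dlt ->
  forall o : 'I_#|I| -> I, maximin_ordering Omega x o ->
  let Theta : 'M[R]_#|I| :=
    \matrix_(i, j) green Omega s L (x (o i)) (x (o j)) in
  forall Lc : 'M[R]_#|I|, cholesky_factor Theta Lc ->
  forall (k : nat) (hk : (k <= #|I|)%N), (0 < k)%N ->
    let Lk := first_columns hk Lc in
    opnorm (Theta - Lk *m Lk^T) <=
      C * opnorm Theta * k%:R `^ (- (2 * s%:R / d%:R)).
Proof.
move=> d0 ds [A0 oA _ bA _].
have [R0 R00 AR] := cube_bounded bA.
have [K K0 HK] := @quad_upper_bound R d s d0 ds.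
have [phi [z [r [c [tp p1 r0 c0 [zA phic]]]]]] := positive_test_exists s oA A0.
have dR : 0 < d%:R :> R by rewrite ltr0n.
(* A fill distance above r/2 makes the separation exceed dlt r/2, and packing then leaves room for
   at most a^d points. *)
pose a := 4 * R0 * d%:R / (dlt * r) + 1.
(* The upper bound, with the level replaced by its estimate from [level_count], times the constant
   that bounds h^(-d) by the norm of Theta. *)
pose Ca := `|normLinv| * K * ((dlt^-1 + 3) * (4 * R0 * d%:R)) ^+ (2 * s) *
  ((4 / (dlt * r)) ^+ d * (`|normL| / c ^+ 2)).
pose Cb := a ^+ (2 * s).
have Cb0 : 0 <= Cb by rewrite /Cb exprM exprn_ge0// sqr_ge0.
(* No points are given yet and [dlt] may have any sign; the absolute value and the 1 ensure
   positivity. *)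
exists (1 + `|Ca| + Cb); first by rewrite -addrA ltr_wpDr// addr_ge0.
move=> L linL bijL symL posL _ nL nLi I x xinj xA dltE o Ho T Lc chol k hk k0; cbv zeta.
have T0 := cholesky_diag_gt0 chol.
have C0 : 0 < 1 + `|Ca| + Cb by rewrite -addrA ltr_wpDr// addr_ge0.
have oT := opnorm_ge0 T.
have rhs0 : 0 <= (1 + `|Ca| + Cb) * opnorm T * k%:R `^ (- (2 * s%:R / d%:R)).
  by rewrite mulr_ge0 ?powR_ge0// mulr_ge0// ltW.
(* With all columns taken no index constrains the coefficients, and 0 shows that the error vanishes.
   From here on 1 <= k < N, so there are at least two points and the separation is a genuine
   minimum. *)
have [Nk|kN] := leqP #|I| k.
  apply: (le_trans _ rhs0); apply: (cholesky_opnorm hk chol) => // v.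
  exists 0; first by move=> i ki; have := ltn_ord i; rewrite ltnNge (leq_trans Nk ki).
  by rewrite quad_sum big1 ?mul0r// => i _; rewrite big1// => j _; rewrite mxE !mul0r.
pose ko := Ordinal kN.
have I1 : (1 < #|I|)%N := leq_ltn_trans k0 kN.
have I0 : (0 < #|I|)%N by exact: ltnW.
have h0 : 0 < separation Omega x := separation_gt0 oA xinj xA I1.
have f0 : 0 < fill Omega x := fill_gt0 d0 oA AR xA I0 A0.
have dltE' : separation Omega x / fill Omega x = dlt by [].
have dlt0 : 0 < dlt by rewrite -dltE' divr_gt0.
have hE : separation Omega x = dlt * fill Omega x by rewrite -dltE' divfK// gt_eqF.
have l0 : 0 < level Omega x o ko := lt_le_trans h0 (separation_le_level (k := ko) Ho k0).
(* [r] is the size of the cube where [phi] is bounded below. In the coarse case k <= N <= a^d, so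
   k^(-2s/d) is at least 1/Cb, and bounding the error by the norm of Theta is enough. *)
have [fr|fr] := leP (2 * fill Omega x) r; last first.
  have a1 : 1 <= a by rewrite /a lerDr divr_ge0 ?mulr_ge0// ltW.
  apply: (@le_trans _ _ (opnorm T)).
    by apply: (cholesky_opnorm hk chol) => // v; exists v => //; exact: quad_le_opnorm.
  rewrite mulrAC ler_peMl//; apply: (@le_trans _ _ (Cb * (a ^+ (2 * s))^-1)).
    by rewrite mulfV// expf_neq0// gt_eqF//; lra.
  have Ka : k%:R <= a ^+ d.
    apply: (@le_trans _ _ #|I|%:R); first by rewrite ler_nat.
    have t0 : 0 < separation Omega x / d%:R by rewrite divr_gt0.
    have := @packing R d I predT x 0 R0 _ t0 (ltW R00) (fun j _ => AR _ (xA j)).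
    move=> /(_ _)/le_trans; apply => [i j _ _ ij|].
      apply: enorm_separated => //.
      by apply: (le_trans (separation_le Omega x ij)); apply: dist_le; left.
    have q0 : 0 <= 2 * R0 / (separation Omega x / d%:R) by rewrite divr_ge0 ?mulr_ge0// ltW.
    apply: lerXn2r; first by rewrite nnegrE addr_ge0.
      by rewrite nnegrE (le_trans _ a1).
    rewrite /a lerD2r invf_div mulrA ler_pdivrMr// [leRHS]mulrAC ler_pdivlMr ?mulr_gt0// hE.
    have H : dlt * r <= dlt * (2 * fill Omega x) by rewrite ler_pM2l// ltW.
    have RD : 0 < R0 * d%:R by rewrite mulr_gt0.
    have := ler_wpM2l (ltW RD) H; rewrite -(ler_pM2l (ltr0Sn R 1)).
    by congr (_ <= _); ring.
  apply: ler_pM => //; first by rewrite invr_ge0.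
    by rewrite lerDr addr_ge0.
  by apply: powR_decay => //; lra.
apply: (cholesky_opnorm hk chol) => // v.
have [cv cvE cvQ] := HK Omega R0 L normLinv dlt oA A0 AR linL bijL symL nLi I x xinj xA o Ho dltE' T0 ko k0 v.
exists cv => //; apply: (le_trans cvQ); rewrite ler_wpM2r ?dotpp_ge0//.
have lev : level Omega x o ko ^+ (2 * s) <= (4 * R0 * d%:R) ^+ (2 * s) * k%:R `^ (- (2 * s%:R / d%:R)).
  have RD : 0 < 4 * R0 * d%:R by rewrite !mulr_gt0.
  have := @powR_decay R (4 * R0 * d%:R / level Omega x o ko) k d s (divr_gt0 RD l0) k0 d0
    (level_count (k := ko) d0 R00 AR xA Ho k0 l0).
  rewrite -(ler_pM2l (exprn_gt0 (2 * s) RD)); apply: le_trans.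
  by rewrite -exprVn -exprMn invf_div mulrC divfK// gt_eqF.
have low : (separation Omega x ^+ d)^-1 <= (4 / (dlt * r)) ^+ d * (`|normL| / c ^+ 2) * opnorm T.
  (* At least 1 since 2 fill <= r. Rounding down gives r/m >= 2 fill > fill, as [fill_count]
     requires, and loses at most a factor 2, so m >= r / (4 fill). *)
  pose m := Num.trunc (r / (2 * fill Omega x)).
  have q1 : 1 <= r / (2 * fill Omega x) by rewrite ler_pdivlMr ?mul1r// mulr_gt0.
  have m0 : (0 < m)%N by rewrite truncn_gt0.
  have mR : 0 < m%:R :> R by rewrite ltr0n.
  have /andP[mq qm] := truncn_itv (le_trans ler01 q1).
  have fm : fill Omega x < r / m%:R.
    rewrite ltr_pdivlMr//; move: mq; rewrite -/m ler_pdivlMr ?mulr_gt0// mulrCA mulrC.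
    have : 0 < m%:R * fill Omega x by rewrite mulr_gt0.
    by rewrite [_ * m%:R]mulrC; lra.
  have cnt := fill_count oA AR xA I0 zA m0 fm.
  have B := opnorm_lower_bound oA linL bijL symL posL nL tp p1 c0 phic T0.
  have cE : (#|[pred i | x i \in cube z r]| <= #|[pred i | x (o i) \in cube z r]|)%N.
    have oinj : injective o := bij_inj Ho.1.
    rewrite -[leqRHS](fintype.card_image oinj); apply: subset_leq_card.
    apply/fintype.subsetP => i iP; have [[g _ go] _] := Ho.
    by apply/fintype.imageP; exists (g i); rewrite ?go//; move: iP; rewrite -!topredE /= go.
  have rf : r / (4 * fill Omega x) <= m%:R.
    have m1 : 1 <= m%:R :> R by rewrite ler1n.
    move: qm; rewrite -/m -natr1 (_ : r / (2 * _) = 2 * (r / (4 * fill Omega x))); first by lra.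
    by field; rewrite gt_eqF.
  have -> : (separation Omega x ^+ d)^-1 = (4 / (dlt * r)) ^+ d * (r / (4 * fill Omega x)) ^+ d.
    by rewrite -exprVn -exprMn hE; congr (_ ^+ d); field; rewrite !gt_eqF.
  rewrite -mulrA ler_pM2l ?exprn_gt0 ?divr_gt0 ?mulr_gt0//.
  apply: (@le_trans _ _ (m%:R ^+ d)).
    have rf0 : 0 < r / (4 * fill Omega x) by apply: divr_gt0 => //; apply: mulr_gt0.
    by apply: lerXn2r => //; rewrite nnegrE ltW.
  have c20 : 0 < c ^+ 2 by rewrite exprn_gt0.
  rewrite mulrAC ler_pdivlMr// mulrC [_ * opnorm T]mulrC; apply: le_trans B.
  by rewrite ler_pM2l// -natrX ler_nat (leq_trans cnt).
have i0 : 0 < dlt^-1 by rewrite invr_gt0.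
have P0 : 0 <= `|normLinv| * K * (dlt^-1 + 3) ^+ (2 * s).
  by rewrite !mulr_ge0 ?(ltW K0)// exprn_ge0// addr_ge0// ltW.
have l20 : 0 <= level Omega x o ko ^+ (2 * s) by rewrite exprn_ge0// ltW.
have h20 : 0 <= (separation Omega x ^+ d)^-1 by rewrite invr_ge0 exprn_ge0// ltW.
apply: (@le_trans _ _ (Ca * opnorm T * k%:R `^ (- (2 * s%:R / d%:R)))); last first.
  rewrite ler_wpM2r ?powR_ge0// ler_wpM2r//.
  by apply: (le_trans (ler_norm Ca)); rewrite addrAC lerDr addr_ge0.
have H := ler_wpM2l P0 (ler_pM l20 h20 lev low).
have E1 : ((dlt^-1 + 3) * level Omega x o ko) ^+ (2 * s) =
  (dlt^-1 + 3) ^+ (2 * s) * level Omega x o ko ^+ (2 * s) by rewrite exprMn.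
have E2 : ((dlt^-1 + 3) * (4 * R0 * d%:R)) ^+ (2 * s) =
  (dlt^-1 + 3) ^+ (2 * s) * (4 * R0 * d%:R) ^+ (2 * s) by rewrite exprMn.
rewrite /Ca E1 E2; apply: le_trans (le_trans H _).
  by rewrite le_eqVlt; apply/orP; left; apply/eqP; rewrite !mulrA.
rewrite le_eqVlt; apply/orP; left; apply/eqP.
move: (k%:R `^ _) ((dlt^-1 + 3) ^+ _) ((4 * R0 * d%:R) ^+ _) ((4 / (dlt * r)) ^+ d) (`|normL| / c ^+ 2).
by move=> q b1 b2 b3 b4; ring.
Qed.
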